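(* Let $M$ be a von Neumann algebra with a fixed (faithful normal) tracial state $\varphi$, and let $X=\{x_1,\ldots,x_n\}$ be an $n$-tuple of selfadjoint elements of $M$. If $y$ is a selfadjoint element contained in the algebra generated by $X$ (i.e. $y=f(x_1,\ldots,x_n)$ for some polynomial $f$ with complex coefficients in $n$ noncommuting variables), then $$\delta^*(X\cup\{y\})\le\delta_1(X\cup\{y\})<\delta_1(X)+1\le n+1,$$ and in particular $\chi^*(X\cup\{y\})=-\infty$.
   Context: All notions are Voiculescu's nonmicrostates ones. Let $Y=\{y_1,\ldots,y_N\}$ be selfadjoint elements in a von Neumann algebra with faithful normal tracial state $\varphi$. Conjugate variable: for a selfadjoint $x$ and a unital $*$-subalgebra $B$, $B[x]$ is the algebra generated by $B$ and $x$, and $J(x:B)$ is the (unique, if it exists) element $\xi\in L^2(W^*(B[x]),\varphi)$ with $\varphi(\xi b_0xb_1x\cdots xb_m)=\sum_{j=1}^m\varphi(b_0xb_1\cdots xb_{j-1})\varphi(b_jx\cdots xb_m)$ for all $m\ge0$ and $b_0,\ldots,b_m\in B$. Free Fisher information: $\Phi^*(Y)=\sum_{i=1}^N|J(y_i:\mathbb C[y_1,\ldots,\hat y_i,\ldots,y_N])|_2^2$ if all these conjugate variables exist, and $\Phi^*(Y)=+\infty$ otherwise. Throughout, $S=\{s_1,\ldots,s_N\}$ is a free family of semicircular elements (mean $0$, variance $1$) free from $Y$ (in a possibly larger tracial von Neumann algebra), and $Y+\epsilon S=\{y_1+\epsilon s_1,\ldots,y_N+\epsilon s_N\}$. Nonmicrostates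 free entropy: $\chi^*(Y)=\frac12\int_0^\infty\left(\frac N{1+t}-\Phi^*(Y+\sqrt t\,S)\right)dt+\frac N2\log(2\pi e)$. Dimensions: $\delta^*(Y)=N+\limsup_{\epsilon\to0}\frac{\chi^*(Y+\epsilon S)}{|\log\epsilon|}$ and $\delta_1(Y)=N-\liminf_{\epsilon\to0}\epsilon^2\Phi^*(Y+\epsilon S)$. $X\cup\{y\}$ denotes the $(n+1)$-tuple $\{x_1,\ldots,x_n,y\}$. *)

(* Defs.v *)
From HB Require Import structures.
From mathcomp Require Import all_boot all_order all_algebra.
From mathcomp Require Export complex sesquilinear.
From mathcomp Require Export all_classical all_reals all_analysis.

Set Implicit Arguments.
Unset Strict Implicit.
Unset Printing Implicit Defensive.

Import Order.TTheory GRing.Theory Num.Theory.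
Import numFieldNormedType.Exports.

Local Open Scope classical_set_scope.
Local Open Scope ring_scope.
Local Open Scope complex_scope.

(** ** Hilbert spaces and bounded operators *)

(* The inner product is linear in its first argument. *)
Record hilbert (R : realType) := Hilbert {
  hcarrier :> lmodType R[i];
  inner : {dot hcarrier for (@Num.conj R[i])};
  hnorm : hcarrier -> R := fun u => Num.sqrt (complex.Re (inner u u));
  hcomplete : forall u : nat -> hcarrier,
    (forall e : R, 0 < e -> exists N : nat, forall k l : nat,
       (N <= k)%N -> (N <= l)%N -> hnorm (u k - u l) < e) ->
    exists v : hcarrier, (fun k => hnorm (u k - v)) @ \oo --> (0 : R)
}.

(* Operators are plain functions; their product is composition [\o], their
   unit is [idfun], and [+], [*:] are pointwise. *)
Notation op H := (hcarrier H -> hcarrier H).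

Definition cvgC (R : realType) (u : nat -> R[i]) (l : R[i]) : Prop :=
  (fun k => Normc.normc (u k - l)) @ \oo --> (0 : R).

Section Operators.
Variables (R : realType) (H : hilbert R).

Definition bounded_op (T : op H) : Prop :=
  linear T /\ exists c : R, forall u, hnorm (T u) <= c * hnorm u.

Definition is_adjoint (T T' : op H) : Prop :=
  forall u v, inner H (T u) v = inner H u (T' v).

(* The adjoint of a bounded operator exists (Riesz) and is unique. *)
Definition adj (T : op H) : op H := xget 0 [set T' | is_adjoint T T'].

Definition selfadjoint (T : op H) : Prop := is_adjoint T T.

Definition commutant (A : set (op H)) : set (op H) :=
  [set T | bounded_op T /\ forall S, A S -> T \o S = S \o T].

Definition is_vna (A : set (op H)) : Prop :=
  [/\ A `<=` bounded_op,
      (forall T, A T -> exists2 T', A T' & is_adjoint T T') &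
      commutant (commutant A) = A].

(* [W* G], the von Neumann algebra generated by G. *)
Definition vna_gen (G : set (op H)) : set (op H) := smallest is_vna G.

Definition unital_subalgebra (A : set (op H)) : Prop :=
  [/\ A idfun,
      (forall (a : R[i]) S T, A S -> A T -> A (a *: S + T)) &
      (forall S T, A S -> A T -> A (S \o T))].

(* The complex algebra C[G] of noncommutative polynomials in elements of G
   (constant terms allowed). *)
Definition alg_gen (G : set (op H)) : set (op H) := smallest unital_subalgebra G.

Definition square_summable (xi : nat -> H) : Prop :=
  cvg (series (fun k => hnorm (xi k) ^+ 2) @ \oo).

(* Ultraweak continuity: [phi] is in the predual of [A]. *)
Definition normal_on (A : set (op H)) (phi : op H -> R[i]) : Prop :=
  exists xi eta : nat -> H,
    [/\ square_summable xi, square_summable eta &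
        forall T, A T ->
          cvgC (series (fun k => inner H (T (xi k)) (eta k))) (phi T)].

(* Values of [phi] outside [A] are irrelevant. *)
Record faithful_normal_tracial_state (A : set (op H)) (phi : op H -> R[i]) :
    Prop := {
  state_linear : forall (a : R[i]) S T, A S -> A T ->
    phi (a *: S + T) = a * phi S + phi T;
  state_unit : phi idfun = 1;
  state_pos : forall T, A T -> 0 <= phi (adj T \o T);
  state_faithful : forall T, A T -> phi (adj T \o T) = 0 -> T = 0;
  state_tracial : forall S T, A S -> A T -> phi (S \o T) = phi (T \o S);
  state_normal : normal_on A phi
}.

End Operators.

Record tracial_vna (R : realType) := TracialVNA {
  hspace :> hilbert R;
  vna : set (op hspace);
  trace : op hspace -> R[i];
  vnaP : is_vna vna;
  traceP : faithful_normal_tracial_state vna trace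
}.
Arguments vna {R} M : rename.
Arguments trace {R} M T : rename.

Section Tracial.
Variables (R : realType) (M : tracial_vna R).

(** ** Conjugate variables and free Fisher information *)

Definition norm2 (T : op M) : R := Num.sqrt (complex.Re (trace M (adj T \o T))).

(* A sequence representing an element of L^2(W, trace), the completion of the
   von Neumann subalgebra W for [norm2]; two sequences represent the same
   element when the [norm2] of their difference tends to 0. *)
Definition L2_rep (W : set (op M)) (xi : nat -> op M) : Prop :=
  (forall k, W (xi k)) /\
  (forall e : R, 0 < e -> exists N : nat, forall k l : nat,
     (N <= k)%N -> (N <= l)%N -> norm2 (xi k - xi l) < e).

Definition L2_norm (xi : nat -> op M) : R := lim (norm2 (xi k) @[k --> \oo]).

(* [altword x b i k] is b_i x b_{i+1} x ... x b_{i+k}. *)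
Fixpoint altword (x : op M) (b : nat -> op M) (i k : nat) : op M :=
  if k is k'.+1 then b i \o x \o altword x b i.+1 k' else b i.

(* [xi] represents J(x : B); the left-hand side phi(xi T) of the defining
   relation is the limit of the phi(xi_k T). *)
Definition is_conjugate_variable (x : op M) (B : set (op M))
    (xi : nat -> op M) : Prop :=
  L2_rep (vna_gen (alg_gen (B `|` [set x]))) xi /\
  forall (m : nat) (b : nat -> op M), (forall k, B (b k)) ->
    cvgC (fun k => trace M (xi k \o altword x b 0 m))
         (\sum_(1 <= j < m.+1)
            trace M (altword x b 0 j.-1) * trace M (altword x b j (m - j))).

Definition conjugate_variable (x : op M) (B : set (op M)) : nat -> op M :=
  xget (fun=> 0) [set xi | is_conjugate_variable x B xi].

Definition alg_others (N : nat) (Y : 'I_N -> op M) (i : 'I_N) : set (op M) :=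
  alg_gen [set Y j | j in [set j | j != i]].

Definition fisher (N : nat) (Y : 'I_N -> op M) : \bar R :=
  if `[< forall i, exists xi, is_conjugate_variable (Y i) (alg_others Y i) xi >]
  then (\sum_i L2_norm (conjugate_variable (Y i) (alg_others Y i)) ^+ 2)%:E
  else +oo%E.

(** ** Freeness and semicircular elements *)

Definition free_algebras (I : Type) (A : I -> set (op M)) : Prop :=
  forall (k : nat) (i : nat -> I) (a : nat -> op M),
    (forall j, (j <= k)%N -> A (i j) (a j) /\ trace M (a j) = 0) ->
    (forall j, (j < k)%N -> i j <> i j.+1) ->
    trace M (\big[(fun S T => S \o T)/idfun]_(0 <= j < k.+1) a j) = 0.

Definition free_elements (N : nat) (S : 'I_N -> op M) : Prop :=
  free_algebras (fun i => alg_gen [set S i]).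

Definition free_sets (G1 G2 : set (op M)) : Prop :=
  free_algebras (fun b : bool => alg_gen (if b then G1 else G2)).

(* Mean 0 and variance 1: the law is the semicircle law on [-2, 2]. *)
Definition semicircular (s : op M) : Prop :=
  [/\ vna M s, selfadjoint s &
      forall k : nat, trace M (iter k (fun T => s \o T) idfun) =
        (\int[lebesgue_measure]_(t in `[(-2 : R), 2])
           (t ^+ k * (Num.sqrt (4 - t ^+ 2) / (2 * pi))))%R%:C].

End Tracial.

(** ** Semicircular perturbations *)

Record trace_embedding (R : realType) (M M' : tracial_vna R)
    (p : op M -> op M') : Prop := {
  emb_vna : forall T, vna M T -> vna M' (p T);
  emb_linear : forall (a : R[i]) S T, vna M S -> vna M T ->
    p (a *: S + T) = a *: p S + p T;
  emb_unit : p idfun = idfun;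
  emb_mul : forall S T, vna M S -> vna M T -> p (S \o T) = p S \o p T;
  emb_adj : forall T, vna M T -> p (adj T) = adj (p T);
  emb_trace : forall T, vna M T -> trace M' (p T) = trace M T
}.

(* A possibly larger tracial von Neumann algebra, with a free family of
   semicircular elements which is free from Y. *)
Record semicircular_ext (R : realType) (M : tracial_vna R) (N : nat)
    (Y : 'I_N -> op M) := SemicircularExt {
  ext :> tracial_vna R;
  ext_emb : op M -> op ext;
  ext_sc : 'I_N -> op ext;
  ext_embP : trace_embedding ext_emb;
  ext_scP : forall i, semicircular (ext_sc i);
  ext_free : free_elements ext_sc;
  ext_freeY : free_sets (range ext_sc) (range (fun i => ext_emb (Y i)))
}.
Arguments ext_emb {R M N Y} E T : rename.
Arguments ext_sc {R M N Y} E i : rename.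

(* Y + e S *)
Definition perturb (R : realType) (M : tracial_vna R) (N : nat)
    (Y : 'I_N -> op M) (E : semicircular_ext Y) (e : R) : 'I_N -> op E :=
  fun i => ext_emb E (Y i) + e%:C *: ext_sc E i.
Arguments perturb {R M N Y} E e i T : rename.

Definition chi_star (R : realType) (M : tracial_vna R) (N : nat)
    (Y : 'I_N -> op M) (E : semicircular_ext Y) : \bar R :=
  ((2^-1)%:E * \int[lebesgue_measure]_(t in `]0%R, +oo[)
      ((N%:R / (1 + t))%:E - fisher (perturb E (Num.sqrt t)))
   + (N%:R / 2 * ln (2 * pi * expR 1))%:E)%E.

(* [F e] provides the semicircular family, free from Y + e S, which enters the
   definition of chi_star(Y + e S). *)
Definition delta_star (R : realType) (M : tracial_vna R) (N : nat)
    (Y : 'I_N -> op M) (E : semicircular_ext Y)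
    (F : forall e : R, semicircular_ext (perturb E e)) : \bar R :=
  (N%:R%:E + limf_esup (fun e : R => chi_star (F e) * (`|ln e|^-1)%:E)
                       (0%R : R)^'+)%E.

Definition delta1 (R : realType) (M : tracial_vna R) (N : nat)
    (Y : 'I_N -> op M) (E : semicircular_ext Y) : \bar R :=
  (N%:R%:E - limf_einf (fun e : R => (e ^+ 2)%:E * fisher (perturb E e))
                       (0%R : R)^'+)%E.

(* (x_1, ..., x_n, y) *)
Definition adjoin (T : Type) (n : nat) (X : 'I_n -> T) (y : T) : 'I_n.+1 -> T :=
  fun i => if unlift ord_max i is Some j then X j else y.

(* Main.v *)
(** Write Z = X + e S for the perturbed tuple. Its conjugate variable at z_i is
    the projection of s_i / e onto L^2(W^*(Z)): freeness turns the joint moments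
    into the Schwinger-Dyson equations tau(s_i w) = (tau (x) tau)(d_i w), where d_i
    is the free difference quotient at s_i. Hence the squared norm of the
    conjugate variable is at most e^-2, and by Cramer-Rao at least
    1 / (|x_i|^2 + e^2).

    If y = f(X), then (y + e s) - f(X + e S) has norm O(e), while its pairing with
    s / e is 1. So the last conjugate variable has squared norm at least c / e^2
    with c > 0 independent of e <= 1, whereas adjoining y + e s to X + e S only
    increases the other conjugate variables. This gives
    e^2 Phi(X, y) >= e^2 Phi(X) + c, hence delta_1(X, y) < delta_1(X) + 1.

    For the entropy, Phi(Y + e S + sqrt(t) S') = Phi(Y + sqrt(e^2 + t) S), since
    the moments of Y + r S depend on the moments of Y and on r^2 only: along the
    perturbation they solve a differential equation in r^2. A lower bound
    lam / r^2 for Phi(Y + r S) at small r makes the entropy integral at Y + e S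
    at most K + (lam / 2) ln(e^2). Letting lam tend to the liminf gives
    delta^* <= delta_1, and lam = c at e = 0 gives chi^* = -oo. *)
From HB Require Import structures.
Require Import Defs.
From mathcomp Require Import all_boot all_order all_algebra.
From mathcomp Require Import all_classical all_reals all_analysis.
From mathcomp Require Import ring lra measurable_realfun.

Set Implicit Arguments.
Unset Strict Implicit.
Unset Printing Implicit Defensive.

Import Order.TTheory GRing.Theory Num.Theory.
Import numFieldNormedType.Exports.

Local Open Scope classical_set_scope.
Local Open Scope ring_scope.
Local Open Scope complex_scope.

(** The space L^2(W^*(Z)) is never built: its elements are given by Cauchy sequences in [norm2]. The
    norm of a conjugate variable is recovered instead as the least constant bounding the functional
    tau(S .) by the 2-norm on C[Z], S being any element with the right pairings. That constant
    depends only on the moments of Z, and it can only decrease when test polynomials are removed.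
    This is how [E], [E0] and the [F e], unrelated extensions, are compared: always through moments.
    That C[Z] suffices for testing rests on its 2-norm density in W^*(Z). This is von Neumann's
    double commutant argument on l2(H), carried over to the 2-norm by normality of the trace. The
    uniformity of c in e comes from a Lipschitz bound for f(X + e S) - f(X) in the 2-norm, valid for
    all e <= 1. The entropy integrals are only bounded from above, by integrating explicit majorants
    of the integrand. *)

(** * Real positive forms and approximate Riesz representation *)

(** Shared by three forms: the real part of the inner product on H, its sum over l2(H), and the
    trace form on M. The last two behave well only on a subset of the ambient module, hence the set
    S. Positivity may be degenerate. *)
Record preform (R : realType) (V : lmodType R[i]) (S : set V) (b : V -> V -> R)
    : Prop := {
  preform_lin : forall (a : R[i]) u v, S u -> S v -> S (a *: u + v);
  preformD : forall u v w, S u -> S v -> S w -> b (u + v) w = b u w + b v w;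
  preformZ : forall (r : R) u w, S u -> S w -> b (r%:C *: u) w = r * b u w;
  preformC : forall u v, S u -> S v -> b u v = b v u;
  preform_ge0 : forall u, S u -> 0 <= b u u
}.

Lemma nonneg_quadratic (R : realFieldType) (c d q : R) :
  0 <= c -> 0 <= q -> (forall t, 0 <= c + t * d *+ 2 + t ^+ 2 * q) ->
  d ^+ 2 <= c * q.
Proof.
move=> c0 q0 H.
have [q00|qn0] := eqVneq q 0.
  have [->|dn0] := eqVneq d 0; first by rewrite expr0n mulr_ge0.
  (* For q = 0 the expression is affine in t, and this t gives it the negative value - c - 2. *)
  have := H (- (c + 1) / d); rewrite q00 mulr0 addr0 divfK //.
  by rewrite mulr2n => h; exfalso; lra.
have := H (- d / q).
have -> : c + - d / q * d *+ 2 + (- d / q) ^+ 2 * q = (c * q - d ^+ 2) / q.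
  by field.
by rewrite pmulr_lge0 ?subr_ge0 // invr_gt0 lt_def qn0.
Qed.

Section Preform.
Variables (R : realType) (V : lmodType R[i]) (S : set V) (b : V -> V -> R).
Hypothesis bP : preform S b.

Local Notation nrm u := (Num.sqrt (b u u)).

Lemma preform_sub u v : S u -> S v -> S (u - v).
Proof. by move=> Su Sv; rewrite addrC -scaleN1r; apply: (preform_lin bP). Qed.

Lemma preform_add u v : S u -> S v -> S (u + v).
Proof. by move=> Su Sv; rewrite -(scale1r u); apply: (preform_lin bP). Qed.

Lemma preform_set0 u : S u -> S 0.
Proof. by move=> Su; rewrite -(subrr u); apply: preform_sub. Qed.

Lemma preform_scale a u : S u -> S (a *: u).
Proof.
move=> Su; rewrite -(addr0 (_ *: _)); apply: (preform_lin bP) => //.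
exact: preform_set0 Su.
Qed.

Lemma preformBl u v w : S u -> S v -> S w -> b (u - v) w = b u w - b v w.
Proof.
move=> Su Sv Sw; rewrite (preformD bP) //; last first.
  by rewrite -scaleN1r; apply: preform_scale.
rewrite -scaleN1r (_ : -1 = (-1)%:C); last by rewrite rmorphN1.
by rewrite (preformZ bP) // mulN1r.
Qed.

Lemma preform_sqrD t u v : S u -> S v ->
  b (u + t%:C *: v) (u + t%:C *: v) =
  b u u + t * b u v *+ 2 + t ^+ 2 * b v v.
Proof.
move=> Su Sv; have Stv : S (t%:C *: v) by apply: preform_scale.
have Suv : S (u + t%:C *: v) by apply: preform_add.
rewrite (preformD bP) // (preformZ bP) //.
rewrite (preformC bP Su Suv) (preformC bP Sv Suv) !(preformD bP) //.
rewrite !(preformZ bP) // (preformC bP Sv Su).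
by ring.
Qed.

Lemma preform_CS u v : S u -> S v -> `|b u v| <= nrm u * nrm v.
Proof.
move=> Su Sv; rewrite -sqrtrM ?(preform_ge0 bP) //.
rewrite -sqrtr_sqr ler_wsqrtr //; apply: nonneg_quadratic.
- exact: (preform_ge0 bP).
- exact: (preform_ge0 bP).
- move=> t; rewrite -preform_sqrD //; apply: (preform_ge0 bP).
  by apply: preform_add => //; apply: preform_scale.
Qed.

Lemma preform_nrm_sqr u : S u -> nrm u ^+ 2 = b u u.
Proof. by move=> Su; rewrite sqr_sqrtr // (preform_ge0 bP). Qed.

Lemma preform_triangle u v : S u -> S v -> nrm (u + v) <= nrm u + nrm v.
Proof.
move=> Su Sv; rewrite -(ler_pXn2r (n := 2)) ?nnegrE ?addr_ge0 ?sqrtr_ge0 //.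
have Suv := preform_add Su Sv.
rewrite preform_nrm_sqr // sqrrD !preform_nrm_sqr //.
have := preform_sqrD 1 Su Sv; rewrite scale1r expr1n !mul1r => ->.
rewrite lerD2r lerD2l lerMn2r /=.
exact: le_trans (ler_norm _) (preform_CS Su Sv).
Qed.

Lemma preform_nrmZ (r : R) u : S u -> nrm (r%:C *: u) = `|r| * nrm u.
Proof.
move=> Su; have Sru : S (r%:C *: u) by apply: preform_scale.
rewrite (preformZ bP) // (preformC bP) // (preformZ bP) //.
by rewrite mulrA -expr2 sqrtrM ?sqr_ge0 // sqrtr_sqr.
Qed.

Lemma preform_nrmN u : S u -> nrm (- u) = nrm u.
Proof.
move=> Su; rewrite -scaleN1r (_ : -1 = (-1)%:C); last by rewrite rmorphN1.
by rewrite preform_nrmZ // normrN1 mul1r.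
Qed.

Lemma preform_nrm_dist u v : S u -> S v -> `|nrm u - nrm v| <= nrm (u - v).
Proof.
move=> Su Sv; rewrite ler_norml.
have Suv := preform_sub Su Sv; have Svu := preform_sub Sv Su.
have h1 := preform_triangle Suv Sv; rewrite subrK in h1.
have h2 := preform_triangle Svu Su; rewrite subrK in h2.
rewrite -(preform_nrmN Svu) opprB in h2.
by apply/andP; split; lra.
Qed.

(* Riesz representation without completeness: minimise |v|^2 - 2 f(v) over the
   subspace D. *)
Lemma preform_riesz (D : set V) (f : V -> R) (B : R) :
  D `<=` S -> D !=set0 ->
  (forall (r : R) u v, D u -> D v -> D (r%:C *: u + v)) ->
  (forall (r : R) u v, D u -> D v -> f (r%:C *: u + v) = r * f u + f v) ->
  (forall v, D v -> `|f v| <= B * nrm v) ->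
  exists u : nat -> V, (forall k, D (u k)) /\
    forall k v, D v -> `|b (u k) v - f v| <= k.+1%:R^-1 * nrm v.
Proof.
move=> DS [d0 Dd0] Dlin flin fB.
pose I v := b v v - f v *+ 2.
pose A := [set I v | v in D].
have Alb : has_inf A.
  split; first by exists (I d0), d0.
  exists (- B ^+ 2) => _ [v Dv <-]; rewrite /I.
  have := le_trans (ler_norm _) (fB v Dv).
  have := preform_nrm_sqr (DS _ Dv).
  by set c := Num.sqrt _ => <-; have := sqr_ge0 (B - c); rewrite mulr2n; nra.
have ex k : exists u, D u /\ I u < inf A + k.+1%:R^-1 ^+ 2.
  have k0 : (0 : R) < k.+1%:R^-1 ^+ 2 by rewrite exprn_gt0 // invr_gt0.
  by have [_ [u Du <-] Iu] := inf_adherent k0 Alb; exists u.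
have {ex}[u uP] := boolp.choice ex.
exists u; split=> [k|k v Dv]; first by case: (uP k).
have [Du Iu] := uP k; have Su := DS _ Du; have Sv := DS _ Dv.
set d := k.+1%:R^-1.
have d0' : 0 <= d by rewrite invr_ge0.
rewrite -(ler_pXn2r (n := 2)) ?nnegrE ?mulr_ge0 ?sqrtr_ge0 //.
rewrite real_normK ?num_real // exprMn preform_nrm_sqr //.
(* Because u k comes within d^2 of the infimum, moving it by t v gives 0 <= d^2 + 2 t (b (u k) v - f
   v) + t^2 b v v for every t. The discriminant of this is the claim, which is why the tolerance was
   chosen to be a square. *)
apply: nonneg_quadratic; rewrite ?sqr_ge0 ?(preform_ge0 bP) // => t.
have DI : D (u k + t%:C *: v) by rewrite addrC; apply: Dlin.
have : inf A <= I (u k + t%:C *: v) by apply: ge_inf; [case: Alb|exists (u k + t%:C *: v)].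
rewrite /I preform_sqrD //.
rewrite [u k + _]addrC flin //.
move: Iu; rewrite /I -/d !mulr2n => h1 h2; lra.
Qed.

(** Test both approximate representers against their own difference: the values of f cancel and only
    the two errors remain. *)
Lemma preform_riesz_cauchy (D : set V) (f : V -> R) (u : nat -> V) :
  D `<=` S -> (forall v w, D v -> D w -> D (v - w)) -> (forall k, D (u k)) ->
  (forall k v, D v -> `|b (u k) v - f v| <= k.+1%:R^-1 * nrm v) ->
  forall e : R, 0 < e -> exists N : nat, forall k l : nat,
    (N <= k)%N -> (N <= l)%N -> nrm (u k - u l) < e.
Proof.
move=> DS Dsub Du uP e e0.
have e2 : 0 < e / 2 by rewrite divr_gt0.
have [N _ NP] := near_infty_natSinv_lt (PosNum e2).
exists N => k l Nk Nl; set w := u k - u l.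
have Dw : D w by apply: Dsub.
have [[Sk Sl] Sw] := (DS _ (Du k), DS _ (Du l), DS _ Dw).
have := uP k w Dw; have := uP l w Dw.
have ae : k.+1%:R^-1 < e / 2 := NP k Nk.
have ce : l.+1%:R^-1 < e / 2 := NP l Nl.
move: ae ce.
set a := k.+1%:R^-1; set c := l.+1%:R^-1 => ae ce hl hk.
have bw : b w w = (b (u k) w - f w) - (b (u l) w - f w).
  by rewrite {1}/w preformBl //; ring.
have h : nrm w ^+ 2 <= (a + c) * nrm w.
  rewrite (preform_nrm_sqr Sw) {1}bw (le_trans (ler_norm _)) //.
  by rewrite (le_trans (ler_normB _ _)) // mulrDl lerD.
have [n0|n0] := eqVneq (nrm w) 0; first by rewrite n0.
have np : 0 < nrm w by rewrite lt_def n0 sqrtr_ge0.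
move: h; rewrite expr2 ler_pM2r // => h; lra.
Qed.

End Preform.

(** * Real parts, moduli and convergence of complex numbers *)

Section Complex.
Variable R : realType.
Implicit Types z w l m : R[i].
Local Notation Re := (@complex.Re R).

Lemma ReD z w : Re (z + w) = Re z + Re w.
Proof. by case: z => a b; case: w. Qed.

Lemma ReN z : Re (- z) = - Re z.
Proof. by case: z. Qed.

Lemma ReB z w : Re (z - w) = Re z - Re w.
Proof. by rewrite ReD ReN. Qed.

Lemma ReZ (r : R) z : Re (r%:C * z) = r * Re z.
Proof. by case: z => a b; rewrite /= mul0r subr0. Qed.

Lemma conjCE z : Num.conj z = conjc z.
Proof. by []. Qed.

Lemma Re_conjC z : Re (Num.conj z) = Re z.
Proof. by rewrite conjCE; case: z. Qed.

Lemma conj_realC (r : R) : Num.conj r%:C = r%:C.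
Proof. by rewrite conjCE conjc_real. Qed.

Lemma Re_le_normc z : `|Re z| <= Normc.normc z.
Proof.
case: z => a b /=; rewrite -sqrtr_sqr ler_wsqrtr // lerDl sqr_ge0 //.
Qed.

Lemma normc_ge0 z : 0 <= Normc.normc z.
Proof. by case: z => a b; rewrite sqrtr_ge0. Qed.

Lemma normcD z w : Normc.normc (z + w) <= Normc.normc z + Normc.normc w.
Proof. exact: (le_normcD z w). Qed.

Lemma normcNE z : Normc.normc (- z) = Normc.normc z.
Proof. exact: (normcN z). Qed.

Lemma normcBC z w : Normc.normc (z - w) = Normc.normc (w - z).
Proof. by rewrite -normcNE opprB. Qed.

Lemma normc_real (r : R) : Normc.normc r%:C = `|r|.
Proof. by rewrite /= expr0n addr0 sqrtr_sqr. Qed.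

Lemma normc_conj z : Normc.normc (Num.conj z) = Normc.normc z.
Proof. by rewrite conjCE; case: z => a b /=; rewrite sqrrN. Qed.

Lemma Re_mul_conj z : Re (z * Num.conj z) = Normc.normc z ^+ 2.
Proof.
rewrite conjCE; case: z => a b /=.
by rewrite sqr_sqrtr ?addr_ge0 ?sqr_ge0 //; ring.
Qed.

(* Rotating by a phase c turns a bound on real parts into one on moduli. *)
Lemma normc_phase z :
  exists2 c, Normc.normc c = 1 & Re (c * z) = Normc.normc z.
Proof.
have [->|zn0] := eqVneq z 0.
  by exists 1; [exact: Normc.normc1 | rewrite mulr0 Normc.normc0].
have nz0 : Normc.normc z != 0.
  by apply: contra_neq zn0; exact: Normc.eq0_normc.
exists (((Normc.normc z)^-1)%:C * Num.conj z).
  rewrite Normc.normcM normc_real normc_conj normfV.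
  by rewrite ger0_norm ?normc_ge0 ?mulVf.
rewrite -mulrA ReZ [_ * z]mulrC Re_mul_conj expr2.
by rewrite mulrA mulVf // mul1r.
Qed.

Lemma cvg0P (u : nat -> R) :
  u @ \oo --> 0 <->
  forall e, 0 < e -> exists N, forall k, (N <= k)%N -> `|u k| < e.
Proof.
split=> [h e e0|h].
  have /cvgrPdistC_lt/(_ e e0) [N _ NP] := h.
  by exists N => k Nk; have := NP k Nk; rewrite subr0.
apply/cvgrPdistC_lt => e e0; have [N NP] := h e e0.
by exists N => // k /= Nk; rewrite subr0; apply: NP.
Qed.

Lemma cvgCP (u : nat -> R[i]) l :
  cvgC u l <->
  forall e, 0 < e -> exists N, forall k, (N <= k)%N ->
    Normc.normc (u k - l) < e.
Proof.
split=> [/cvg0P h e /h[N NP]|h].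
  by exists N => k /NP; rewrite ger0_norm ?normc_ge0.
apply/cvg0P => e /h[N NP]; exists N => k /NP.
by rewrite ger0_norm ?normc_ge0.
Qed.

Lemma cvgC_squeeze (u : nat -> R[i]) l (v : nat -> R) :
  (forall k, Normc.normc (u k - l) <= v k) -> v @ \oo --> 0 -> cvgC u l.
Proof.
move=> uv /cvg0P v0; apply/cvgCP => e /v0[N NP]; exists N => k /NP.
by apply: le_lt_trans; rewrite (le_trans (uv k)) // ler_norm.
Qed.

Lemma cvgC_cst l : cvgC (fun _ : nat => l) l.
Proof.
apply/cvgCP => e e0; exists 0%N => k _; rewrite subrr.
by rewrite [X in X < _]Normc.normc0.
Qed.

Lemma cvgC_lin (a : R[i]) (u v : nat -> R[i]) l m :
  cvgC u l -> cvgC v m -> cvgC (fun k => a * u k + v k) (a * l + m).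
Proof.
move=> ul vm.
apply: (@cvgC_squeeze _ _
  (fun k => Normc.normc a * Normc.normc (u k - l) + Normc.normc (v k - m))).
  move=> k; rewrite opprD addrACA -mulrBr -Normc.normcM; exact: normcD.
rewrite -[X in _ --> X](addr0 0) -{1}(mulr0 (Normc.normc a)).
by apply: cvgD => //; apply: cvgMr.
Qed.

Lemma cvgC_normc (u : nat -> R[i]) l :
  cvgC u l -> (fun k => Normc.normc (u k)) @ \oo --> Normc.normc l.
Proof.
move=> /cvgCP h; apply/cvgrPdistC_lt => e /h[N NP].
exists N => // k /= /NP; apply: le_lt_trans.
have h1 := normcD (u k - l) l; have h2 := normcD (l - u k) (u k).
rewrite !subrK in h1 h2; rewrite [X in _ <= X + _]normcBC in h2.
by rewrite ler_norml; apply/andP; split; lra.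
Qed.

Lemma cvgC_Re (u : nat -> R[i]) l :
  cvgC u l -> (fun k => Re (u k)) @ \oo --> Re l.
Proof.
move=> /cvgCP h; apply/cvgrPdistC_lt => e /h[N NP].
exists N => // k /= /NP; apply: le_lt_trans.
by rewrite -ReB; apply: Re_le_normc.
Qed.

End Complex.

(** * Hilbert spaces and the double commutant *)

Section HilbertSpace.
Variables (R : realType) (H : hilbert R).
Implicit Types (u v w : H) (T : op H).

Definition hdot u v : R := complex.Re (inner H u v).

Lemma innerC u v : inner H u v = Num.conj (inner H v u).
Proof. by rewrite hermC expr0 mul1r. Qed.

Lemma innerDl u v w : inner H (u + v) w = inner H u w + inner H v w.
Proof. exact: linearDl. Qed.

Lemma innerZl a u v : inner H (a *: u) v = a * inner H u v.
Proof. exact: linearZl_LR. Qed.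

Lemma innerDr u v w : inner H u (v + w) = inner H u v + inner H u w.
Proof. exact: linearDr. Qed.

Lemma innerZr a u v : inner H u (a *: v) = Num.conj a * inner H u v.
Proof. by rewrite innerC innerZl rmorphM [in RHS]innerC. Qed.

Lemma innerBr u v w : inner H u (v - w) = inner H u v - inner H u w.
Proof. by rewrite -scaleN1r innerDr innerZr rmorphN1 mulN1r. Qed.

(** Recovers the complex inner product from its real part, so that representing functionals over the
    reals is enough. *)
Lemma inner_Im u v : complex.Im (inner H u v) = hdot u ('i%C *: v).
Proof.
rewrite /hdot innerZr conjCE; case: (inner H u v) => a b /=; ring.
Qed.

Lemma hdot_preform : preform [set: H] hdot.
Proof.
split=> //.
- by move=> u v w _ _ _; rewrite /hdot innerDl ReD.
- by move=> r u w _ _; rewrite /hdot innerZl ReZ.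
- by move=> u v _ _; rewrite /hdot innerC Re_conjC.
- move=> u _; have : 0 <= inner H u u.
    have [->|un0] := eqVneq u 0; first by rewrite linear0l.
    by apply: ltW; rewrite dnorm_gt0.
  by rewrite lecE => /andP[].
Qed.

Lemma hnormE u : hnorm u = Num.sqrt (hdot u u).
Proof. by []. Qed.

Lemma hnorm_ge0 u : 0 <= hnorm u.
Proof. exact: sqrtr_ge0. Qed.

Lemma hnormD u v : hnorm (u + v) <= hnorm u + hnorm v.
Proof. exact: (preform_triangle hdot_preform). Qed.

Lemma hnormN u : hnorm (- u) = hnorm u.
Proof. exact: (preform_nrmN hdot_preform). Qed.

Lemma hnormBC u v : hnorm (u - v) = hnorm (v - u).
Proof. by rewrite -hnormN opprB. Qed.

Lemma hnorm_sqr u : hnorm u ^+ 2 = hdot u u.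
Proof. exact: (preform_nrm_sqr hdot_preform). Qed.

Lemma hdot_eq0 u : hdot u u = 0 -> u = 0.
Proof.
move=> h; apply/eqP; rewrite -(dnorm_eq0 (inner H)).
have : inner H u u = Num.conj (inner H u u) by rewrite -innerC.
move: h; rewrite /hdot conjCE; case: (inner H u u) => a b /= -> [] /eqP.
by rewrite eq_sym eqNr => /eqP ->.
Qed.

Lemma hnorm_eq0 u : hnorm u = 0 -> u = 0.
Proof. by move=> h; apply: hdot_eq0; rewrite -hnorm_sqr h expr0n. Qed.

Lemma hnorm0 : hnorm (0 : H) = 0.
Proof. by rewrite hnormE /hdot linear0l sqrtr0. Qed.

Lemma hnormZ a u : hnorm (a *: u) = Normc.normc a * hnorm u.
Proof.
rewrite hnormE /hdot innerZl innerZr mulrA.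
have -> : a * Num.conj a = (Normc.normc a ^+ 2)%:C.
  rewrite conjCE; case: a => a b; apply/eqP; rewrite eq_complex /=.
  by rewrite sqr_sqrtr ?addr_ge0 ?sqr_ge0 //; apply/andP; split; apply/eqP; ring.
by rewrite ReZ sqrtrM ?sqr_ge0 // sqrtr_sqr ger0_norm // normc_ge0.
Qed.

Lemma inner_ext u v : (forall w, hdot w u = hdot w v) -> u = v.
Proof.
move=> h; apply/eqP; rewrite -subr_eq0; apply/eqP; apply: hdot_eq0.
by rewrite /hdot innerBr ReB -!/(hdot _ _) h subrr.
Qed.

Lemma hdot_eq_inner u v u' v' :
  hdot u v = hdot u' v' -> hdot u ('i%C *: v) = hdot u' ('i%C *: v') ->
  inner H u v = inner H u' v'.
Proof.
rewrite -!inner_Im /hdot.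
by case: (inner H u v) => a b; case: (inner H u' v') => c d /= -> ->.
Qed.

Lemma hcvg_dot (x : nat -> H) u v :
  (fun k => hnorm (x k - u)) @ \oo --> (0 : R) ->
  (fun k => hdot (x k) v) @ \oo --> hdot u v.
Proof.
move=> xu; apply/cvgrPdistC_lt => e e0.
have v0 : 0 < hnorm v + 1 by rewrite ltr_wpDl ?hnorm_ge0.
have /cvg0P/(_ (e / (hnorm v + 1))) := xu.
rewrite divr_gt0 // => /(_ isT)[N NP]; exists N => // k /= /NP.
rewrite ger0_norm ?hnorm_ge0 // ltr_pdivlMr //; apply: le_lt_trans.
rewrite -(preformBl hdot_preform) //.
rewrite (le_trans (preform_CS hdot_preform _ _)) // -!hnormE.
by rewrite ler_wpM2l ?hnorm_ge0 // lerDl.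
Qed.

(** Approximate representers form a Cauchy sequence, and completeness of H supplies the exact one.
    Linearity of f over the reals suffices. *)
Lemma hilbert_riesz (f : H -> R) (B : R) :
  (forall (r : R) u v, f (r%:C *: u + v) = r * f u + f v) ->
  (forall v, `|f v| <= B * hnorm v) -> exists w, forall v, f v = hdot v w.
Proof.
move=> flin fB.
have [x [_ xP]] : exists x : nat -> H, (forall k, [set: H] (x k)) /\
    forall k v, [set: H] v -> `|hdot (x k) v - f v| <= k.+1%:R^-1 * hnorm v.
  apply: (preform_riesz hdot_preform (B := B)) => //; by exists 0.
have xC := preform_riesz_cauchy hdot_preform (fun _ _ => I)
  (fun _ _ _ _ => I) (fun _ => I) xP.
have [w xw] := hcomplete xC.
exists w => v.
have h1 := hcvg_dot (v := v) xw.
have h2 : (fun k => hdot (x k) v) @ \oo --> f v.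
  apply/cvgrPdistC_lt => e e0.
  have v0 : 0 < hnorm v + 1 by rewrite ltr_wpDl ?hnorm_ge0.
  have ev0 : 0 < e / (hnorm v + 1) by rewrite divr_gt0.
  have [N _ NP] := near_infty_natSinv_lt (PosNum ev0).
  exists N => // k /= /NP /=; rewrite ltr_pdivlMr //; apply: le_lt_trans.
  rewrite (le_trans (xP k v I)) // ler_wpM2l ?invr_ge0 //.
  by rewrite lerDl.
rewrite (preformC hdot_preform) //.
exact: (cvg_unique (@norm_hausdorff _ R) h2 h1).
Qed.

Lemma bounded_nonneg T : bounded_op T ->
  exists2 c, 0 <= c & forall u, hnorm (T u) <= c * hnorm u.
Proof.
move=> [_ [c cP]]; exists `|c| => // u.
by rewrite (le_trans (cP u)) // ler_wpM2r ?hnorm_ge0 // ler_norm.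
Qed.

Lemma linearfunD T u v : linear T -> T (u + v) = T u + T v.
Proof. by move=> lT; rewrite -(scale1r u) lT !scale1r. Qed.

Lemma linearfun0 T : linear T -> T 0 = 0.
Proof.
move=> lT; apply: (@addIr _ (T 0)); rewrite add0r -linearfunD //.
by rewrite addr0.
Qed.

Lemma linearfunZ T a u : linear T -> T (a *: u) = a *: T u.
Proof. by move=> lT; rewrite -(addr0 (a *: u)) lT linearfun0 // addr0. Qed.

Lemma linearfunB T u v : linear T -> T (u - v) = T u - T v.
Proof. by move=> lT; rewrite addrC -scaleN1r lT scaleN1r addrC. Qed.

Lemma adjoint_exists T : bounded_op T ->
  exists T', bounded_op T' /\ is_adjoint T T'.
Proof.
move=> bT; have [lT _] := bT; have [c c0 cP] := bounded_nonneg bT.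
have ex u : exists w, forall v, hdot (T v) u = hdot v w.
  apply: (@hilbert_riesz _ (c * hnorm u)).
    move=> r v w; rewrite lT (preformD hdot_preform) //.
    by rewrite (preformZ hdot_preform).
  move=> v; rewrite (le_trans (preform_CS hdot_preform _ _)) // -!hnormE.
  by rewrite mulrAC ler_wpM2r ?hnorm_ge0.
have [T' T'P] := boolp.choice ex.
have adjT : is_adjoint T T'.
  move=> u v; apply: hdot_eq_inner => //.
  (* T' was obtained from the real form only; that it commutes with multiplication by i follows from
     the complex linearity of T. *)
  rewrite T'P; congr (hdot _ _); apply: inner_ext => w.
  rewrite -T'P {1}/hdot innerZr conjCE.
  have -> : hdot w ('i%C *: T' v) = complex.Re (conjc 'i%C * inner H w (T' v)).
    by rewrite /hdot innerZr.
  have := T'P v w; have := T'P v ('i%C *: w).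
  rewrite linearfunZ // /hdot !innerZl.
  case: (inner H (T w) v) => a b; case: (inner H w (T' v)) => a' b' /=.
  by rewrite !mul0r !sub0r !mul1r => /oppr_inj -> _.
exists T'; split=> //; split.
  move=> a u v; apply: inner_ext => w; rewrite {2}/hdot innerDr innerZr.
  by rewrite -!adjT {1}/hdot -adjT innerDr innerZr.
exists c => u; have [->|n0] := eqVneq (hnorm (T' u)) 0.
  by rewrite mulr_ge0 ?hnorm_ge0.
have np : 0 < hnorm (T' u) by rewrite lt_def n0 hnorm_ge0.
rewrite -(ler_pM2r np) -expr2 hnorm_sqr -T'P.
rewrite (le_trans (ler_norm _)) // (le_trans (preform_CS hdot_preform _ _)) //.
rewrite -!hnormE mulrAC ler_wpM2r ?hnorm_ge0 //; exact: cP.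
Qed.

Lemma adjoint_unique T T1 T2 : is_adjoint T T1 -> is_adjoint T T2 -> T1 = T2.
Proof.
move=> h1 h2; apply/funext => v; apply: inner_ext => w.
by rewrite /hdot -h1 -h2.
Qed.

Lemma adjP T T' : is_adjoint T T' -> adj T = T'.
Proof.
move=> h; apply: (@adjoint_unique T) => //; rewrite /adj.
by case: xgetP => [S _ //|/(_ T')].
Qed.

Lemma is_adjoint_sym T T' : is_adjoint T T' -> is_adjoint T' T.
Proof. by move=> h u v; rewrite innerC -h -innerC. Qed.

Lemma is_adjoint_comp S S' T T' : is_adjoint S S' -> is_adjoint T T' ->
  is_adjoint (S \o T) (T' \o S').
Proof. by move=> hS hT u v; rewrite /= hS hT. Qed.

Lemma is_adjoint_lin a S S' T T' : is_adjoint S S' -> is_adjoint T T' ->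
  is_adjoint (a *: S + T) (Num.conj a *: S' + T').
Proof.
move=> hS hT u v.
rewrite ![(_ *: _ + _) _]/(_ *: _ + _) innerDl innerZl hS hT.
by rewrite innerDr innerZr conjCK.
Qed.

Lemma is_adjoint_id : is_adjoint (idfun : op H) idfun.
Proof. by []. Qed.

Lemma bounded_id : bounded_op (idfun : op H).
Proof. by split=> //; exists 1 => u; rewrite mul1r. Qed.

Lemma bounded_lin a S T : bounded_op S -> bounded_op T ->
  bounded_op (a *: S + T).
Proof.
move=> bS bT; have [lS _] := bS; have [lT _] := bT.
have [c c0 cP] := bounded_nonneg bS; have [d d0 dP] := bounded_nonneg bT.
split.
  move=> r u v; rewrite ![(_ *: _ + _) _]/(_ *: _ + _) lS lT.
  by rewrite !scalerDr !scalerA addrACA [a * r]mulrC.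
exists (Normc.normc a * c + d) => u; rewrite (le_trans (hnormD _ _)) // mulrDl.
by rewrite lerD // hnormZ -mulrA ler_wpM2l ?normc_ge0.
Qed.

Lemma bounded_comp S T : bounded_op S -> bounded_op T -> bounded_op (S \o T).
Proof.
move=> bS bT; have [lS _] := bS; have [lT _] := bT.
have [c c0 cP] := bounded_nonneg bS; have [d d0 dP] := bounded_nonneg bT.
split; first by move=> r u v; rewrite /= lT lS.
exists (c * d) => u; rewrite (le_trans (cP _)) // -mulrA.
by rewrite ler_wpM2l.
Qed.

End HilbertSpace.

(** * The Hilbert space l2(H) of square-summable sequences *)

Section SquareSummable.
Variables (R : realType) (H : hilbert R).
Implicit Types (x y z : nat -> H) (T : op H).

Definition l2 : set (nat -> H) := @square_summable R H.
Definition ldot x y : R := limn (series (fun k => hdot (x k) (y k))).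
Local Notation lnorm x := (Num.sqrt (ldot x x)).

Let subfE x y k : (x - y) k = x k - y k.
Proof. by []. Qed.

Let sq x k := hnorm (x k) ^+ 2.

Lemma sq_series_nd x : nondecreasing_seq (series (sq x)).
Proof. by apply: nondecreasing_series => n _ _; rewrite sqr_ge0. Qed.

Lemma ldotxx x : ldot x x = limn (series (sq x)).
Proof.
rewrite /ldot; congr (limn (series _)).
by apply/funext => k; rewrite /sq hnorm_sqr.
Qed.

Lemma l2_le x n : l2 x -> series (sq x) n <= ldot x x.
Proof. by move=> lx; rewrite ldotxx; apply: nondecreasing_cvgn_le => //; apply: sq_series_nd. Qed.

Lemma l2_bound x (c : R) : (forall n, series (sq x) n <= c) ->
  l2 x /\ ldot x x <= c.
Proof.
move=> xc; have cx : l2 x.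
  apply: nondecreasing_is_cvgn; first exact: sq_series_nd.
  by exists c => _ [n _ <-].
by split=> //; rewrite ldotxx; apply: limr_le => //; apply: nearW.
Qed.

Lemma l2_coord x j : l2 x -> hnorm (x j) <= lnorm x.
Proof.
move=> lx; rewrite -[leLHS]ger0_norm ?hnorm_ge0 // -sqrtr_sqr ler_wsqrtr //.
apply: le_trans (l2_le j.+1 lx).
rewrite /series /= big_nat_recr //= lerDr.
by apply: sumr_ge0 => i _; rewrite sqr_ge0.
Qed.

Lemma l2_lin (a : R[i]) x y : l2 x -> l2 y -> l2 (a *: x + y).
Proof.
move=> lx ly.
have [|//] := @l2_bound (a *: x + y)
  (2 * Normc.normc a ^+ 2 * ldot x x + 2 * ldot y y).
move=> n; apply: (@le_trans _ _ (2 * Normc.normc a ^+ 2 * series (sq x) n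
    + 2 * series (sq y) n)).
  rewrite /series /= !mulr_sumr -big_split /=; apply: ler_sum => k _.
  rewrite /sq ![(_ *: _ + _) k]/(_ *: _ + _).
  have := hnormD (a *: x k) (y k); rewrite hnormZ.
  have := normc_ge0 a; have := hnorm_ge0 (x k); have := hnorm_ge0 (y k).
  have := hnorm_ge0 (a *: x k + y k).
  set A := Normc.normc a; set X := hnorm (x k); set Y := hnorm (y k).
  set Z := hnorm _ => Z0 Y0 X0 A0 h.
  apply: (@le_trans _ _ ((A * X + Y) ^+ 2)).
    by rewrite ler_pXn2r // nnegrE addr_ge0 // mulr_ge0.
  by have := sqr_ge0 (A * X - Y); nra.
rewrite lerD // ler_wpM2l //; try exact: l2_le.
by rewrite mulr_ge0 // sqr_ge0.
Qed.

Lemma l2_dot_cvg x y : l2 x -> l2 y ->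
  cvgn (series (fun k => hdot (x k) (y k))).
Proof.
move=> lx ly; apply: normed_cvg.
apply: (@series_le_cvg _ _ (sq x + sq y)).
- by move=> n; rewrite normr_ge0.
- by move=> n; rewrite -[(sq x + sq y) n]/(sq x n + sq y n) addr_ge0 // sqr_ge0.
- move=> n; rewrite -[(sq x + sq y) n]/(sq x n + sq y n) /sq.
  rewrite (le_trans (preform_CS (hdot_preform H) _ _)) // -!hnormE.
  have := hnorm_ge0 (x n); have := hnorm_ge0 (y n).
  set X := hnorm (x n); set Y := hnorm (y n) => X0 Y0.
  by have := sqr_ge0 (X - Y); have := mulr_ge0 X0 Y0; rewrite sqrrB mulr2n; lra.
- exact: is_cvg_seriesD.
Qed.

Lemma ldot_preform : preform l2 ldot.
Proof.
split.
- exact: l2_lin.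
- move=> x y z lx ly lz; rewrite /ldot -lim_seriesD; try exact: l2_dot_cvg.
  congr (limn (series _)); apply/funext => k.
  by rewrite [LHS](preformD (hdot_preform H)).
- move=> r x z lx lz; rewrite /ldot.
  rewrite -[RHS]/(r *: _) -lim_seriesZ; last exact: l2_dot_cvg.
  congr (limn (series _)); apply/funext => k.
  by rewrite [LHS](preformZ (hdot_preform H)).
- move=> x y lx ly; rewrite /ldot; congr (limn (series _)); apply/funext => k.
  by rewrite (preformC (hdot_preform H)).
- move=> x lx; apply: le_trans (l2_le 0 lx).
  by rewrite /series /= big_geq.
Qed.

Lemma ldot_adjoint T T' x y : is_adjoint T T' -> ldot (T \o x) y = ldot x (T' \o y).
Proof.
move=> h; rewrite /ldot; congr (limn (series _)); apply/funext => k.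
by rewrite /hdot /= h.
Qed.

Lemma l2_map T (c : R) x : 0 <= c -> (forall u, hnorm (T u) <= c * hnorm u) ->
  l2 x -> l2 (T \o x) /\ lnorm (T \o x) <= c * lnorm x.
Proof.
move=> c0 cP lx; have [] := @l2_bound (T \o x) (c ^+ 2 * ldot x x).
  move=> n; apply: (@le_trans _ _ (c ^+ 2 * series (sq x) n)).
    rewrite /series /= mulr_sumr; apply: ler_sum => k _.
    by rewrite /sq /= -exprMn ler_pXn2r ?nnegrE ?mulr_ge0 ?hnorm_ge0.
  by rewrite ler_wpM2l ?sqr_ge0 // l2_le.
move=> lT dT; split=> //; rewrite -[c]ger0_norm // -sqrtr_sqr -sqrtrM ?sqr_ge0 //.
exact: ler_wsqrtr.
Qed.

Lemma lnorm_eq0 x : l2 x -> lnorm x = 0 -> x = 0.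
Proof.
move=> lx x0; apply/funext => j; apply: hnorm_eq0; apply/eqP.
by rewrite eq_le hnorm_ge0 andbT -x0 l2_coord.
Qed.

(** Limits exist in each coordinate since H is complete. A bound on the partial sums of |x k - x
    l|^2 survives l going to infinity, as these are finite sums, and so bounds the norm of x k -
    y. *)
Lemma l2_complete (x : nat -> nat -> H) : (forall m, l2 (x m)) ->
  (forall e : R, 0 < e -> exists N : nat, forall k l : nat,
     (N <= k)%N -> (N <= l)%N -> lnorm (x k - x l) < e) ->
  exists2 y, l2 y & forall e : R, 0 < e -> exists N : nat, forall k : nat,
     (N <= k)%N -> lnorm (x k - y) <= e.
Proof.
move=> lx cx.
have lsub k l : l2 (x k - x l) by apply: (preform_sub ldot_preform).
have ex j : exists v, (fun m => hnorm (x m j - v)) @ \oo --> (0 : R).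
  apply: hcomplete => e /cx[N NP]; exists N => k l Nk Nl.
  by apply: le_lt_trans (NP k l Nk Nl); apply: (l2_coord j (lsub k l)).
have [y yP] := boolp.choice ex.
have key (e : R) : 0 < e -> exists N : nat, forall k : nat,
    (N <= k)%N -> l2 (x k - y) /\ lnorm (x k - y) <= e.
  move=> e0; have [N NP] := cx e e0; exists N => k Nk.
  have [|? h] := @l2_bound (x k - y) (e ^+ 2); last first.
    by split=> //; rewrite -[e]ger0_norm ?(ltW e0) // -sqrtr_sqr ler_wsqrtr.
  move=> n.
  have cv : (fun l => series (sq (x k - x l)) n) @ \oo --> series (sq (x k - y)) n.
    rewrite /series /=; apply: cvg_big => [|j _]; first exact: add_continuous.
    apply: (cvg_comp (fun l => hnorm ((x k - x l) j)) (fun t : R => t ^+ 2));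
      last exact: exprn_continuous.
    apply/cvgrPdistC_lt => d d0; have /cvg0P/(_ d d0)[M MP] := yP j.
    exists M => // l /= /MP; rewrite ger0_norm ?hnorm_ge0 //.
    apply: le_lt_trans.
    rewrite (le_trans (preform_nrm_dist (hdot_preform H) _ _)) // -hnormE.
    rewrite ![(_ - _) j]/(_ - _) opprB addrC addrA subrK.
    by rewrite hnormBC.
  rewrite -(cvg_lim (@norm_hausdorff _ R) cv).
  apply: limr_le; first exact: (cvgP _ cv).
  exists N => // l /= Nl; rewrite (le_trans (l2_le n (lsub k l))) //.
  rewrite -(preform_nrm_sqr ldot_preform) //.
  by rewrite ler_pXn2r ?nnegrE ?sqrtr_ge0 ?(ltW e0) // ltW // NP.
exists y.
  have [N /(_ N (leqnn N))[h _]] := key 1 ltr01.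
  rewrite -(subKr (x N) y); exact: (preform_sub ldot_preform).
by move=> e /key[N NP]; exists N => k /NP[].
Qed.

Definition ltrunc n x : nat -> H := fun k => if (k < n)%N then x k else 0.

Lemma ltrunc_cvg x : l2 x ->
  (forall n, l2 (ltrunc n x)) /\
  forall e : R, 0 < e -> exists n, lnorm (x - ltrunc n x) <= e.
Proof.
move=> lx; have lt n : l2 (ltrunc n x).
  have [|//] := @l2_bound (ltrunc n x) (ldot x x).
  move=> m; apply: le_trans (l2_le m lx).
  apply: ler_sum => k _; rewrite /sq /ltrunc; case: ifP => // _.
  by rewrite hnorm0 expr0n sqr_ge0.
split=> // e e0.
have e20 : 0 < e ^+ 2 by rewrite exprn_gt0.
have : series (sq x) @ \oo --> ldot x x by rewrite ldotxx; exact: lx.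
move=> /cvgrPdistC_lt/(_ _ e20)[N _ NP].
exists N; have [|_ h] := @l2_bound (x - ltrunc N x) (e ^+ 2); last first.
  by rewrite -[e]ger0_norm ?(ltW e0) // -sqrtr_sqr ler_wsqrtr.
move=> n; apply: (@le_trans _ _ (series (sq x) (maxn n N) - series (sq x) N)).
  rewrite (le_trans (sq_series_nd (x - ltrunc N x) (leq_maxl n N))) //.
  rewrite lerBrDr /series /=.
  rewrite (big_cat_nat (n := N) (leq0n _) (leq_maxr n N)) /=.
  rewrite [X in _ <= X](big_cat_nat (n := N) (leq0n _) (leq_maxr n N)) /=.
  rewrite big_nat big1 => [|k /= kN]; last first.
    by rewrite /sq subfE /ltrunc kN subrr hnorm0 expr0n.
  rewrite add0r [leLHS]addrC lerD2l le_eqVlt; apply/orP; left; apply/eqP.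
  apply: eq_big_nat => k /andP[Nk _].
  by rewrite /sq subfE /ltrunc ltnNge Nk subr0.
have h1 := l2_le (maxn n N) lx; have /= h2 := NP N (leqnn N).
move: h2; rewrite ltr_norml => /andP[h2 _]; lra.
Qed.

End SquareSummable.

(** * Orthogonal projection onto the closure of a subspace of l2(H) *)

Section Projection.
Variables (R : realType) (H : hilbert R) (D : set (nat -> H)).
Hypothesis D_l2 : D `<=` @l2 R H.
Hypothesis D0 : D !=set0.
Hypothesis D_lin : forall (a : R[i]) x y, D x -> D y -> D (a *: x + y).
Local Notation lnorm x := (Num.sqrt (ldot x x)).
Let pre := @ldot_preform R H.
Implicit Types (x y p q v w : nat -> H) (T : op H).

Definition lclosure : set (nat -> H) :=
  [set p | l2 p /\ forall e : R, 0 < e -> exists2 v, D v & lnorm (p - v) <= e].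

(** Orthogonality is stated for the real form; as D is stable under multiplication by i, this
    amounts to complex orthogonality. *)
Definition lproj (x p : nat -> H) : Prop :=
  lclosure p /\ forall v, D v -> ldot x v = ldot p v.

Let D_sub x y : D x -> D y -> D (x - y).
Proof. by move=> Dx Dy; rewrite addrC -scaleN1r; apply: D_lin. Qed.

Let D_scale a x : D x -> D (a *: x).
Proof.
move=> Dx; rewrite -(addr0 (_ *: _)); apply: D_lin => //.
by rewrite -(subrr x); apply: D_sub.
Qed.

Let ladd x y : l2 x -> l2 y -> l2 (x + y).
Proof. exact: (preform_add pre). Qed.
Let lsub x y : l2 x -> l2 y -> l2 (x - y).
Proof. exact: (preform_sub pre). Qed.
Let lscale a x : l2 x -> l2 (a *: x).
Proof. exact: (preform_scale pre). Qed.

Lemma lnormZ (a : R[i]) (x : nat -> H) : l2 x ->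
  lnorm (a *: x) <= Normc.normc a * lnorm x.
Proof.
move=> lx.
have hZ (u : H) : hnorm (a *: u) <= Normc.normc a * hnorm u by rewrite hnormZ.
exact: (@l2_map _ H (fun u => a *: u) _ x (normc_ge0 a) hZ lx).2.
Qed.

Lemma ldot_closure_eq0 q p : l2 q -> (forall v, D v -> ldot q v = 0) ->
  lclosure p -> ldot q p = 0.
Proof.
move=> lq qD [lp pD]; apply/eqP; rewrite -normr_le0; apply/ler_addgt0Pr => e e0; rewrite add0r.
have n0 : 0 < lnorm q + 1 by rewrite ltr_wpDl ?sqrtr_ge0.
have [v Dv pv] := pD _ (divr_gt0 e0 n0).
have lv := D_l2 Dv.
have -> : ldot q p = ldot q (p - v).
  rewrite (preformC pre lq (lsub lp lv)) (preformBl pre) //.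
  by rewrite (preformC pre lp) // (preformC pre lv) // (qD v Dv) subr0.
rewrite (le_trans (preform_CS pre lq (lsub lp lv))) //.
apply: (@le_trans _ _ ((lnorm q + 1) * (e / (lnorm q + 1)))).
  by rewrite ler_pM ?sqrtr_ge0 // lerDl.
by rewrite mulrC divfK // gt_eqF.
Qed.

Lemma lclosure_lin a p q : lclosure p -> lclosure q -> lclosure (a *: p + q).
Proof.
move=> [lp pD] [lq qD]; split; first by apply: (preform_lin pre).
move=> e e0; set c := Normc.normc a + 1.
have c0 : 0 < c by rewrite ltr_wpDl ?normc_ge0.
have e20 : 0 < e / 2 by rewrite divr_gt0.
have [v Dv pv] := pD _ (divr_gt0 e20 c0); have [w Dw qw] := qD _ e20.
have [lv lw] := (D_l2 Dv, D_l2 Dw).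
exists (a *: v + w); first exact: D_lin.
rewrite opprD addrACA -scalerBr.
rewrite (le_trans (preform_triangle pre (@lscale a _ (lsub lp lv)) (lsub lq lw))) //.
rewrite [leRHS]splitr lerD //.
rewrite (le_trans (lnormZ _ (lsub lp lv))) //.
apply: (@le_trans _ _ (c * (e / 2 / c))).
  by rewrite ler_pM ?sqrtr_ge0 ?normc_ge0 // lerDl.
by rewrite mulrC divfK // gt_eqF.
Qed.

Lemma lproj_exists x : l2 x -> exists p, lproj x p.
Proof.
move=> lx.
have [u [Du uP]] : exists u : nat -> nat -> H, (forall k, D (u k)) /\
    forall k v, D v -> `|ldot (u k) v - ldot x v| <= k.+1%:R^-1 * lnorm v.
  apply: (preform_riesz pre (B := lnorm x)) => //.
  - by move=> r v w; apply: D_lin.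
  - move=> r v w Dv Dw; have [lv lw] := (D_l2 Dv, D_l2 Dw).
    rewrite (preformC pre lx) ?(preformD pre) ?(preformZ pre) //.
    + by rewrite !(preformC pre lx).
    + exact: lscale.
    + by apply: ladd => //; apply: lscale.
  - by move=> v /D_l2 lv; apply: (preform_CS pre).
have lu k : l2 (u k) by apply: D_l2.
have [p lp uc] := l2_complete lu (preform_riesz_cauchy pre D_l2 D_sub Du uP).
exists p; split.
  split=> // e /uc[N /(_ N (leqnn N)) h]; exists (u N) => //.
  by rewrite -opprB (preform_nrmN pre) //; apply: lsub.
move=> v Dv; have lv := D_l2 Dv.
apply/eqP; rewrite -subr_eq0 -normr_le0; apply/ler_addgt0Pr => e e0; rewrite add0r.
have n0 : 0 < lnorm v + 1 by rewrite ltr_wpDl ?sqrtr_ge0.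
have d0 : 0 < e / 2 / (lnorm v + 1) by rewrite !divr_gt0.
have [N NP] := uc _ d0.
have [M _ MP] := near_infty_natSinv_lt (PosNum d0).
set k := maxn N M.
have h1 := NP k (leq_maxl _ _).
have h2 : k.+1%:R^-1 < e / 2 / (lnorm v + 1) := MP k (leq_maxr _ _).
have -> : ldot x v - ldot p v = - (ldot (u k) v - ldot x v) + ldot (u k - p) v.
  by rewrite (preformBl pre) //; ring.
rewrite (le_trans (ler_normD _ _)) // normrN.
have g1 := uP k v Dv; have g2 := preform_CS pre (lsub (lu k) lp) lv.
have vv : lnorm v <= lnorm v + 1 by rewrite lerDl.
have E : e = e / 2 / (lnorm v + 1) * (lnorm v + 1) + e / 2 / (lnorm v + 1) * (lnorm v + 1).
  by rewrite divfK ?gt_eqF // -splitr.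
rewrite E lerD //.
  by rewrite (le_trans g1) // ler_pM ?sqrtr_ge0 ?invr_ge0 // ltW.
by rewrite (le_trans g2) // ler_pM ?sqrtr_ge0.
Qed.

Lemma lproj_unique x p q : l2 x -> lproj x p -> lproj x q -> p = q.
Proof.
move=> lx [cp hp] [cq hq]; have [lp _] := cp; have [lq _] := cq.
have cpq : lclosure (p - q) by rewrite addrC -scaleN1r; apply: lclosure_lin.
apply/eqP; rewrite -subr_eq0; apply/eqP; apply: lnorm_eq0; first exact: lsub.
rewrite (ldot_closure_eq0 _ _ cpq) ?sqrtr0 //; first exact: lsub.
move=> v Dv; rewrite (preformBl pre) //; last exact: D_l2.
by rewrite -hp // -hq // subrr.
Qed.

Lemma lproj_lin a x y p q : l2 x -> l2 y -> lproj x p -> lproj y q ->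
  lproj (a *: x + y) (a *: p + q).
Proof.
move=> lx ly [cp hp] [cq hq]; have [lp _] := cp; have [lq _] := cq.
split; first exact: lclosure_lin.
move=> v Dv; have lv := D_l2 Dv.
rewrite !(preformD pre) //; try exact: lscale.
rewrite hq //; congr (_ + _).
have is_adj : is_adjoint (fun u : H => a *: u) (fun u => Num.conj a *: u).
  by move=> u w; rewrite innerZl innerZr conjCK.
by rewrite !(@ldot_adjoint _ _ _ _ _ _ is_adj) hp //; apply: D_scale.
Qed.

Lemma lproj_contract x p : l2 x -> lproj x p -> lnorm p <= lnorm x.
Proof.
move=> lx [cp hp]; have [lp _] := cp.
have h : ldot p p = ldot x p.
  apply/eqP; rewrite eq_sym -subr_eq0 -(preformBl pre) //; apply/eqP.
  apply: (ldot_closure_eq0 _ _ cp); first exact: lsub.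
  by move=> v Dv; rewrite (preformBl pre) ?hp ?subrr //; apply: D_l2.
have [n0|n0] := eqVneq (lnorm p) 0; first by rewrite n0 sqrtr_ge0.
have np : 0 < lnorm p by rewrite lt_def n0 sqrtr_ge0.
rewrite -(ler_pM2r np) -expr2 (preform_nrm_sqr pre) // {1}h.
exact: le_trans (ler_norm _) (preform_CS pre lx lp).
Qed.

(** T maps the closure of D into itself because it preserves D, and it preserves orthogonality to D
    because its adjoint preserves D. *)
Lemma lproj_map T T' x p : bounded_op T -> is_adjoint T T' ->
  (forall v, D v -> D (T \o v)) -> (forall v, D v -> D (T' \o v)) ->
  lproj x p -> lproj (T \o x) (T \o p).
Proof.
move=> bT TT' TD T'D [[lp pD] hp]; have [c c0 cP] := bounded_nonneg bT.
have [lT _] := bT.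
split; last by move=> v Dv; rewrite !(ldot_adjoint _ _ TT') hp //; apply: T'D.
split; first by have [] := l2_map c0 cP lp.
move=> e e0; have c10 : 0 < c + 1 by rewrite ltr_wpDl.
have [v Dv pv] := pD _ (divr_gt0 e0 c10).
exists (T \o v); first exact: TD.
have -> : (T \o p) - (T \o v) = T \o (p - v).
  by apply/funext => k; symmetry; exact: (linearfunB (p k) (v k) lT).
have [_ h] := l2_map c0 cP (lsub lp (D_l2 Dv)).
rewrite (le_trans h) //; apply: (@le_trans _ _ ((c + 1) * (e / (c + 1)))).
  by rewrite ler_pM ?sqrtr_ge0 // lerDl.
by rewrite mulrC divfK // gt_eqF.
Qed.

Lemma lproj_id x : D x -> lproj x x.
Proof.
move=> Dx; have lx := D_l2 Dx; split=> //; split=> // e e0.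
exists x => //; rewrite subrr -(scale0r x) (le_trans (lnormZ _ lx)) //.
by rewrite Normc.normc0 mul0r ltW.
Qed.

End Projection.

(** * Density of a selfadjoint algebra in its double commutant *)

Section Density.
Variables (R : realType) (H : hilbert R) (A : set (op H)).
Hypothesis A_alg : unital_subalgebra A.
Hypothesis A_bnd : A `<=` @bounded_op R H.
Hypothesis A_adj : forall T, A T -> exists2 T', A T' & is_adjoint T T'.
Local Notation lnorm x := (Num.sqrt (ldot x x)).
Implicit Types (T : op H) (x y z : nat -> H).

Let single (j : nat) (u : H) : nat -> H := fun k => if k == j then u else 0.

Let single_l2 j u : l2 (single j u) /\ lnorm (single j u) <= hnorm u.
Proof.
have [|l d] := @l2_bound _ _ (single j u) (hnorm u ^+ 2).
  move=> n; rewrite /series /= (big_mkcond xpredT).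
  have [jn|nj] := ltnP j n.
    rewrite (bigD1_seq j) ?mem_index_iota ?iota_uniq //= big1 => [|k kj].
      by rewrite addr0 /single eqxx.
    by rewrite /single (negbTE kj) hnorm0 expr0n.
  rewrite big_nat big1 ?sqr_ge0 // => k /= kn.
  by rewrite /single ltn_eqF ?hnorm0 ?expr0n // (leq_trans kn).
split=> //; rewrite -[leRHS]ger0_norm ?hnorm_ge0 // -sqrtr_sqr.
exact: ler_wsqrtr.
Qed.

Let single_lin j (a : R[i]) u v :
  single j (a *: u + v) = a *: single j u + single j v.
Proof.
apply/funext => k.
rewrite [RHS](_ : _ = a *: single j u k + single j v k) // /single.
by case: eqP => //; rewrite scaler0 addr0.
Qed.

Let single_map j T u : linear T -> single j (T u) = T \o single j u.
Proof.
move=> lT; apply/funext => k; rewrite /single /=; case: eqP => // _.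
by rewrite linearfun0.
Qed.

(* The matrix entries of the projection of l2(H) onto the closure of A z
   commute with A, hence with T. *)
Theorem double_commutant_density T z (e : R) :
  commutant (commutant A) T -> l2 z -> 0 < e ->
  exists2 B, A B & lnorm ((T \o z) - (B \o z)) <= e.
Proof.
move=> [bT TC] lz e0; have [A1 Alin Amul] := A_alg.
pose D : set (nat -> H) := [set B \o z | B in A].
have D_l2 : D `<=` @l2 R H.
  move=> _ [B AB <-]; have [c c0 cP] := bounded_nonneg (A_bnd AB).
  by have [] := l2_map c0 cP lz.
have D0 : D !=set0 by exists z, idfun.
have D_lin (a : R[i]) x y : D x -> D y -> D (a *: x + y).
  move=> [B AB <-] [C AC <-]; exists (a *: B + C) => //.
  exact: Alin.
have D_inv B x : A B -> D x -> D (B \o x).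
  by move=> AB [C AC <-]; exists (B \o C) => //; apply: Amul.
pose pr := @lproj _ _ D.
have ex x : exists p, l2 x -> pr x p.
  have [lx|nlx] := pselect (l2 x); last by exists 0.
  by have [p pP] := lproj_exists D_l2 D0 D_lin lx; exists p.
have [P PP] := boolp.choice ex.
have Puniq x p : l2 x -> pr x p -> P x = p.
  by move=> lx; apply: (lproj_unique D_l2 D_lin lx); apply: PP.
have Pl x : l2 x -> l2 (P x) by move=> /PP[[]].
have Plin a x y : l2 x -> l2 y -> P (a *: x + y) = a *: P x + P y.
  move=> lx ly; apply: Puniq; first exact: l2_lin.
  by apply: (lproj_lin D_l2 D_lin) => //; apply: PP.
have Pc x : l2 x -> lnorm (P x) <= lnorm x.
  by move=> lx; apply: (lproj_contract D_l2 lx (PP x lx)).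
have PA B x : A B -> l2 x -> P (B \o x) = B \o P x.
  move=> AB lx; have [B' AB' BB'] := A_adj AB.
  apply: Puniq.
    have [c c0 cP] := bounded_nonneg (A_bnd AB); exact: (l2_map c0 cP lx).1.
  apply: (lproj_map D_l2 (A_bnd AB) BB'); last exact: PP.
  - by move=> v; apply: D_inv.
  - by move=> v; apply: D_inv.
pose E j k : op H := fun u => P (single k u) j.
have EC j k : commutant A (E j k).
  split.
    split.
      move=> a u v; rewrite /E single_lin Plin //; try exact: (single_l2 _ _).1.
    exists 1 => u; rewrite mul1r; have [l n] := single_l2 k u.
    by rewrite (le_trans (l2_coord j (Pl _ l))) // (le_trans (Pc _ l)).
  move=> B AB; apply/funext => u; rewrite /E /=.
  have [lB _] := A_bnd AB.
  by rewrite single_map // PA //; exact: (single_l2 _ _).1.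
have [lT _] := bT; have [c c0 cP] := bounded_nonneg bT.
have TE j k u : T (E j k u) = E j k (T u).
  by have := TC _ (EC j k) => /(congr1 (@^~ u)).
have l2T x : l2 x -> l2 (T \o x) by move=> lx; exact: (l2_map c0 cP lx).1.
have [lt tc] := ltrunc_cvg lz.
(* A finitely supported sequence is a sum of one-entry sequences, on which commutation of T with the
   matrix entries says that T commutes with P. Truncation then extends this to z. *)
have Ttrunc n : P (T \o ltrunc n z) = T \o P (ltrunc n z).
  elim: n => [|n IH].
    have -> : ltrunc 0 z = 0 by apply/funext.
    have -> : T \o (0 : nat -> H) = 0.
      by apply/funext => k /=; rewrite [LHS]linearfun0.
    have P0 : P 0 = 0.
      by have := Plin (-1) z z lz lz; rewrite !scaleN1r !addNr.
    by rewrite P0; apply/funext => k /=; rewrite [RHS]linearfun0.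
  have -> : ltrunc n.+1 z = 1 *: single n (z n) + ltrunc n z.
    apply/funext => k; rewrite scale1r.
    rewrite [RHS](_ : _ = single n (z n) k + ltrunc n z k) // /ltrunc /single ltnS.
    by case: ltngtP => [||->]; rewrite ?add0r ?addr0.
  have [ls _] := single_l2 n (z n).
  have -> : T \o (1 *: single n (z n) + ltrunc n z) =
      1 *: single n (T (z n)) + (T \o ltrunc n z).
    by rewrite single_map //; apply/funext => k; exact: lT.
  rewrite (Plin 1 _ _ (single_l2 n (T (z n))).1 (l2T _ (lt n))).
  rewrite (Plin 1 _ _ ls (lt n)) IH; apply/funext => j.
  transitivity (1 *: P (single n (T (z n))) j + T (P (ltrunc n z) j)) => //.
  rewrite -[P (single n (T _)) j]/(E j n (T (z n))) -TE -lT.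
  by [].
(* As A is unital, z lies in A z. Hence P (T z) = T (P z) = T z, so T z is in the closure of A z,
   which is the assertion. *)
have Pz : P z = z.
  by apply: Puniq => //; apply: (lproj_id D_l2); exists idfun.
have PTz : P (T \o z) = T \o z.
  apply/funext => j; apply/eqP; rewrite -subr_eq0; apply/eqP; apply: hnorm_eq0.
  apply/eqP; rewrite eq_le hnorm_ge0 andbT; apply/ler_addgt0Pr => d d0.
  (* Two error terms, P (T w) and T (P w), are each at most c |w|; the added 1 keeps the divisor
     positive when c = 0. *)
  have c20 : 0 < c *+ 2 + 1 by rewrite ltr_wpDl // mulrn_wge0.
  have [n zn] := tc _ (divr_gt0 d0 c20).
  set w := z - ltrunc n z in zn; have lw : l2 w by apply: (preform_sub (@ldot_preform R H)).
  have zE : z = 1 *: w + ltrunc n z by rewrite scale1r subrK.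
  have TzE : T \o z = 1 *: (T \o w) + (T \o ltrunc n z).
    by rewrite {1}zE; apply/funext => k; exact: lT.
  have -> : (T \o z) j = T (P z j) by rewrite Pz.
  have PzE : P z = 1 *: P w + P (ltrunc n z) by rewrite {1}zE (Plin 1 _ _ lw (lt n)).
  rewrite TzE PzE (Plin 1 _ _ (l2T _ lw) (l2T _ (lt n))) Ttrunc.
  have -> : (1 *: P (T \o w) + (T \o P (ltrunc n z))) j -
      T ((1 *: P w + P (ltrunc n z)) j) = P (T \o w) j - T (P w j).
    rewrite [T _](_ : _ = 1 *: T (P w j) + T (P (ltrunc n z) j)); last exact: lT.
    rewrite !scale1r; rewrite [X in X - _](_ : _ = P (T \o w) j + T (P (ltrunc n z) j)) //.
    by rewrite opprD addrACA subrr addr0.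
  rewrite add0r (le_trans (hnormD _ _)) // hnormN.
  have h1 := le_trans (l2_coord j (Pl _ (l2T _ lw))) (Pc _ (l2T _ lw)).
  have [_ h2] := l2_map c0 cP lw.
  have h3 := le_trans (cP (P w j)) (ler_wpM2l c0 (le_trans (l2_coord j (Pl _ lw)) (Pc _ lw))).
  apply: (@le_trans _ _ ((c *+ 2 + 1) * (d / (c *+ 2 + 1)))); last first.
    by rewrite mulrC divfK // gt_eqF.
  apply: (@le_trans _ _ ((c *+ 2) * lnorm w)).
    by rewrite mulr2n mulrDl lerD // (le_trans h1).
  by rewrite ler_pM ?sqrtr_ge0 ?mulrn_wge0 // lerDl.
have [[_ h] _] := PP _ (l2T _ lz).
rewrite PTz in h; have [_ [B AB <-] Be] := h e e0.
by exists B.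
Qed.

End Density.

(** * Commutants and generated algebras *)

Section Commutant.
Variables (R : realType) (H : hilbert R).
Implicit Types (A B : set (op H)) (S T : op H).

Definition adjoint_closed A : Prop :=
  forall T, A T -> exists2 T', A T' & is_adjoint T T'.

Lemma commutantS A B : A `<=` B -> commutant B `<=` commutant A.
Proof. by move=> AB T [bT h]; split=> // S /AB; apply: h. Qed.

Lemma commutant2_sub A : A `<=` @bounded_op R H -> A `<=` commutant (commutant A).
Proof. by move=> bA T AT; split; [exact: bA | move=> S [_ /(_ T AT)]]. Qed.

Lemma commutant_bounded A : commutant A `<=` @bounded_op R H.
Proof. by move=> T []. Qed.

Lemma commutant3 A : A `<=` @bounded_op R H ->
  commutant (commutant (commutant A)) = commutant A.
Proof.
move=> bA; apply/seteqP; split.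
  exact/commutantS/commutant2_sub.
exact/commutant2_sub/commutant_bounded.
Qed.

Lemma commutant_alg A : A `<=` @bounded_op R H -> unital_subalgebra (commutant A).
Proof.
move=> bA; split.
- by split=> //; exact: bounded_id.
- move=> a S T [bS hS] [bT hT]; split; first exact: bounded_lin.
  move=> U AU; have [lU _] := bA _ AU; apply/funext => u.
  transitivity (a *: S (U u) + T (U u)) => //.
  have /= -> := congr1 (@^~ u) (hS U AU); have /= -> := congr1 (@^~ u) (hT U AU).
  by rewrite -lU.
- move=> S T [bS hS] [bT hT]; split; first exact: bounded_comp.
  move=> U AU; apply/funext => u /=.
  have /= -> := congr1 (@^~ u) (hT U AU).
  by have /= -> := congr1 (@^~ (T u)) (hS U AU).
Qed.

Lemma commutant_adj A : A `<=` @bounded_op R H -> adjoint_closed A ->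
  adjoint_closed (commutant A).
Proof.
move=> bA aA T [bT hT]; have [T' [bT' TT']] := adjoint_exists bT.
exists T' => //; split=> // S AS; have [S' AS' SS'] := aA S AS.
have h1 := is_adjoint_comp (is_adjoint_sym SS') TT'.
have h2 := is_adjoint_comp TT' (is_adjoint_sym SS').
by apply: (adjoint_unique h1); rewrite -(hT S' AS').
Qed.

Lemma commutant2_vna A : A `<=` @bounded_op R H -> adjoint_closed A ->
  is_vna (commutant (commutant A)).
Proof.
move=> bA aA; split.
- exact: commutant_bounded.
- by apply: commutant_adj; [exact: commutant_bounded | exact: commutant_adj].
- by rewrite commutant3 //; exact: commutant_bounded.
Qed.

Lemma vna_gen_commutant2 A : A `<=` @bounded_op R H -> adjoint_closed A ->
  vna_gen A `<=` commutant (commutant A).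
Proof.
move=> bA aA; apply: smallest_sub; first exact: commutant2_vna.
exact: commutant2_sub.
Qed.

Lemma vna_alg A : is_vna A -> unital_subalgebra A.
Proof. by move=> [bA _ <-]; apply: commutant_alg; exact: commutant_bounded. Qed.

Lemma alg_genP A : unital_subalgebra (alg_gen A).
Proof.
split.
- by move=> B [[B1 _ _] _].
- by move=> a S T hS hT B [Balg AB]; have [_ h _] := Balg; apply: h; [apply: hS|apply: hT].
- by move=> S T hS hT B [Balg AB]; have [_ _ h] := Balg; apply: h; [apply: hS|apply: hT].
Qed.

Lemma alg_gen_sub A B : unital_subalgebra B -> A `<=` B -> alg_gen A `<=` B.
Proof. by move=> hB AB; apply: smallest_sub. Qed.

Lemma sub_alg_gen A : A `<=` alg_gen A.
Proof. exact: sub_smallest. Qed.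

Lemma sub_vna_gen A : A `<=` vna_gen A.
Proof. exact: sub_smallest. Qed.

Lemma alg_gen_adj A : adjoint_closed A -> adjoint_closed (alg_gen A).
Proof.
move=> aA; have [g1 glin gmul] := alg_genP A.
apply: (@alg_gen_sub A [set T | exists2 T', alg_gen A T' & is_adjoint T T']).
  split.
  - by exists idfun => //; exact: is_adjoint_id.
  - move=> a S T [S' AS' SS'] [T' AT' TT'].
    by exists (Num.conj a *: S' + T'); [exact: glin | exact: is_adjoint_lin].
  - move=> S T [S' AS' SS'] [T' AT' TT'].
    by exists (T' \o S'); [exact: gmul | exact: is_adjoint_comp].
by move=> T /aA[T' AT' TT']; exists T' => //; apply: sub_alg_gen.
Qed.

End Commutant.

(** * The trace as an inner product *)

Section TraceForm.
Variables (R : realType) (M : tracial_vna R).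
Implicit Types S T : op M.

Lemma M_alg : unital_subalgebra (vna M).
Proof. exact: vna_alg (vnaP M). Qed.

Lemma M_id : vna M idfun.
Proof. by have [] := M_alg. Qed.

Lemma M_lin a S T : vna M S -> vna M T -> vna M (a *: S + T).
Proof. by have [_ h _] := M_alg; apply: h. Qed.

Lemma M_comp S T : vna M S -> vna M T -> vna M (S \o T).
Proof. by have [_ _ h] := M_alg; apply: h. Qed.

Lemma M_bounded T : vna M T -> bounded_op T.
Proof. by have [h _ _] := vnaP M; apply: h. Qed.

Lemma M_linear T : vna M T -> linear T.
Proof. by move=> /M_bounded[]. Qed.

Lemma M_zero : vna M 0.
Proof. by rewrite -(addNr idfun) -scaleN1r; apply: M_lin; exact: M_id. Qed.

Lemma M_add S T : vna M S -> vna M T -> vna M (S + T).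
Proof. by move=> hS hT; rewrite -(scale1r S); apply: M_lin. Qed.

Lemma M_scale a T : vna M T -> vna M (a *: T).
Proof. by move=> hT; rewrite -(addr0 (a *: T)); apply: M_lin => //; exact: M_zero. Qed.

Lemma M_sub S T : vna M S -> vna M T -> vna M (S - T).
Proof. by move=> hS hT; rewrite addrC -scaleN1r; apply: M_lin. Qed.

Lemma adjE T : vna M T -> is_adjoint T (adj T).
Proof. by move=> MT; have [_ h _] := vnaP M; have [T' _ TT'] := h _ MT; rewrite (adjP TT'). Qed.

Lemma M_adj T : vna M T -> vna M (adj T).
Proof. by move=> MT; have [_ h _] := vnaP M; have [T' MT' TT'] := h _ MT; rewrite (adjP TT'). Qed.

Lemma adjK T : vna M T -> adj (adj T) = T.
Proof. by move=> MT; apply/adjP/is_adjoint_sym/adjE. Qed.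

Lemma adjM S T : vna M S -> vna M T -> adj (S \o T) = adj T \o adj S.
Proof. by move=> MS MT; apply/adjP/is_adjoint_comp; exact: adjE. Qed.

Lemma adj_lin a S T : vna M S -> vna M T ->
  adj (a *: S + T) = Num.conj a *: adj S + adj T.
Proof. by move=> MS MT; apply/adjP/is_adjoint_lin; exact: adjE. Qed.

Lemma adj_selfadjoint T : selfadjoint T -> adj T = T.
Proof. exact: adjP. Qed.

Lemma trace_lin a S T : vna M S -> vna M T ->
  trace M (a *: S + T) = a * trace M S + trace M T.
Proof. exact: (state_linear (traceP M)). Qed.

Lemma trace0 : trace M 0 = 0.
Proof.
have := trace_lin 1 M_zero M_zero; rewrite scale1r addr0 mul1r => /eqP.
by rewrite -subr_eq subrr eq_sym => /eqP.
Qed.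

Lemma traceD S T : vna M S -> vna M T -> trace M (S + T) = trace M S + trace M T.
Proof. by move=> MS MT; rewrite -{1}(scale1r S) trace_lin // mul1r. Qed.

Lemma traceZ a T : vna M T -> trace M (a *: T) = a * trace M T.
Proof. by move=> MT; rewrite -(addr0 (a *: T)) trace_lin ?trace0 ?addr0 //; exact: M_zero. Qed.

(** Positivity at conj(a) + T forces a phi(T) + conj(a) phi(adj T) to be real. The values a = 1 and
    a = i settle the imaginary and the real parts. *)
Lemma trace_adj T : vna M T -> trace M (adj T) = Num.conj (trace M T).
Proof.
move=> MT; have MT' := M_adj MT; have MI := M_id.
have real a : complex.Im (a * trace M T + Num.conj a * trace M (adj T)) = 0.
  have := state_pos (traceP M) (M_lin (Num.conj a) MI MT).
  have h1 := state_pos (traceP M) MT.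
  rewrite adj_lin // (adjP (@is_adjoint_id _ M)).
  rewrite (_ : _ \o _ = (Num.conj a * Num.conj (Num.conj a)) *: idfun +
     (Num.conj (Num.conj a) *: T + (Num.conj a *: adj T + (adj T \o T)))); last first.
    apply/funext => u /=; rewrite [LHS](_ : _ = Num.conj (Num.conj a) *: (Num.conj a *: u + T u)
      + adj T (Num.conj a *: u + T u)) //.
    rewrite (M_linear MT') scalerDr scalerA -!addrA.
    by rewrite [X in X *: u]mulrC.
  have M2 := M_comp MT' MT; have M3 := M_lin (Num.conj a) MT' M2.
  have M4 := M_lin (Num.conj (Num.conj a)) MT M3.
  rewrite (trace_lin _ MI M4) (trace_lin _ MT M3) (trace_lin _ MT' M2).
  rewrite (state_unit (traceP M)).
  move: h1; case: a {M2 M3 M4} => a1 a2; case: (trace M T) => c d; case: (trace M (adj T)) => c' d'.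
  case: (trace M (adj T \o T)) => e1 e2; rewrite !conjCE !lecE /=.
  move=> /andP[/eqP -> _] /andP[/eqP h _]; move: h; lra.
have := real 1; have := real 'i%C; rewrite rmorph1 !mul1r !conjCE.
case: (trace M T) => c d; case: (trace M (adj T)) => c' d' /= h1 h2.
apply/eqP; rewrite eq_complex /=; apply/andP; split; apply/eqP; lra.
Qed.

Definition tform S T : R := complex.Re (trace M (adj T \o S)).

Lemma norm2E T : norm2 T = Num.sqrt (tform T T).
Proof. by []. Qed.

Lemma comp_addr S T U : vna M S -> S \o (T + U) = (S \o T) + (S \o U).
Proof.
by move=> MS; apply/funext => u; exact: (linearfunD (T u) (U u) (M_linear MS)).
Qed.

Lemma comp_scaler a S T : vna M S -> S \o (a *: T) = a *: (S \o T).
Proof.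
by move=> MS; apply/funext => u; exact: (linearfunZ a (T u) (M_linear MS)).
Qed.

Lemma tform_preform : preform (vna M) tform.
Proof.
split.
- exact: M_lin.
- move=> S T U MS MT MU; have MU' := M_adj MU.
  by rewrite /tform comp_addr // traceD ?ReD //; exact: M_comp.
- move=> r S U MS MU; have MU' := M_adj MU.
  by rewrite /tform comp_scaler // traceZ ?ReZ //; exact: M_comp.
- move=> S T MS MT; rewrite /tform -Re_conjC -trace_adj; last first.
    by apply: M_comp => //; exact: M_adj.
  by rewrite adjM ?adjK //; exact: M_adj.
- move=> T MT; have := state_pos (traceP M) MT.
  by rewrite lecE => /andP[].
Qed.

Lemma norm2_ge0 T : 0 <= norm2 T.
Proof. exact: sqrtr_ge0. Qed.

Lemma norm2D S T : vna M S -> vna M T -> norm2 (S + T) <= norm2 S + norm2 T.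
Proof. exact: (preform_triangle tform_preform). Qed.

Lemma norm2_dist S T : vna M S -> vna M T -> `|norm2 S - norm2 T| <= norm2 (S - T).
Proof. exact: (preform_nrm_dist tform_preform). Qed.

Lemma norm2_sqr T : vna M T -> norm2 T ^+ 2 = tform T T.
Proof. exact: (preform_nrm_sqr tform_preform). Qed.

Lemma norm2Z a T : vna M T -> norm2 (a *: T) = Normc.normc a * norm2 T.
Proof.
move=> MT; rewrite norm2E /tform -[a *: T]addr0 adj_lin //; last exact: M_zero.
have -> : adj (0 : op M) = 0.
  by apply/adjP => u v; rewrite linear0l linear0r.
rewrite !addr0 [_ \o _](_ : _ = (Num.conj a * a) *: (adj T \o T)); last first.
  apply/funext => u /=; rewrite [LHS](_ : _ = Num.conj a *: adj T (a *: T u)) //.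
  by rewrite (linearfunZ _ _ (M_linear (M_adj MT))) scalerA.
rewrite traceZ; last by apply: M_comp => //; exact: M_adj.
have -> : Num.conj a * a = (Normc.normc a ^+ 2)%:C.
  rewrite conjCE; case: a => a b; apply/eqP; rewrite eq_complex /=.
  by rewrite sqr_sqrtr ?addr_ge0 ?sqr_ge0 //; apply/andP; split; apply/eqP; ring.
by rewrite ReZ sqrtrM ?sqr_ge0 // sqrtr_sqr ger0_norm // normc_ge0.
Qed.

Lemma trace_CS S T : vna M S -> vna M T ->
  Normc.normc (trace M (S \o T)) <= norm2 S * norm2 T.
Proof.
move=> MS MT; have MS' := M_adj MS.
have [c c1 cE] := normc_phase (trace M (S \o T)).
rewrite -cE -traceZ; last exact: M_comp.
rewrite (_ : c *: (S \o T) = adj (adj S) \o (c *: T)); last first.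
  by rewrite adjK // comp_scaler.
rewrite (le_trans (ler_norm _)) // (le_trans (preform_CS tform_preform _ _)) //.
  exact: M_scale.
have -> : Num.sqrt (tform (adj S) (adj S)) = norm2 S.
  by rewrite norm2E /tform adjK // (state_tracial (traceP M)).
by rewrite mulrC -norm2E norm2Z // c1 mul1r.
Qed.

Local Notation lnorm x := (Num.sqrt (ldot x x)).

(** Normality writes phi(adj T T) as the pairing of T xi with T eta, and the real part of <a, b> is
    at most |a + b|^2. Thus one vector z of l2(H) controls [norm2] on all of M, and density in l2(H)
    becomes density in [norm2]. *)
Lemma norm2_le_l2 : exists2 z, l2 z &
  forall T, vna M T -> norm2 T <= lnorm (T \o z).
Proof.
have [xi [eta [lxi leta normal]]] := state_normal (traceP M).
have pre := @ldot_preform R M.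
exists (xi + eta); first exact: (preform_add pre).
move=> T MT; rewrite norm2E; apply: ler_wsqrtr.
have [c c0 cP] := bounded_nonneg (M_bounded MT); have lT := M_linear MT.
have lx := (l2_map c0 cP lxi).1; have ly := (l2_map c0 cP leta).1.
have MTT : vna M (adj T \o T) by apply: M_comp => //; exact: M_adj.
have -> : tform T T = ldot (T \o xi) (T \o eta).
  have /cvgC_Re h := normal _ MTT.
  rewrite /tform -(cvg_lim (@norm_hausdorff _ R) h) /ldot.
  congr (limn _); apply/funext => n; rewrite /series /= -/(complex.Re _).
  elim: n => [|n IH]; first by rewrite !big_geq.
  rewrite !big_nat_recr //= ReD IH; congr (_ + _).
  by rewrite /hdot -(is_adjoint_sym (adjE MT)).
have -> : T \o (xi + eta) = (T \o xi) + (T \o eta).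
  by apply/funext => k; exact: (linearfunD (xi k) (eta k) lT).
have := preform_ge0 pre (preform_add pre lx ly).
have := preform_sqrD pre 1 lx ly; rewrite rmorph1 scale1r => ->.
have := preform_ge0 pre lx; have := preform_ge0 pre ly.
rewrite expr1n !mul1r !mulr2n; lra.
Qed.

Lemma vna_gen_density (A : set (op M)) T (e : R) :
  unital_subalgebra A -> A `<=` vna M -> adjoint_closed A ->
  vna_gen A T -> 0 < e ->
  vna M T /\ exists2 B, A B & norm2 (T - B) <= e.
Proof.
move=> Aalg AM Aadj WT e0.
have Abnd : A `<=` @bounded_op R M by move=> S /AM; exact: M_bounded.
have MT : vna M T by have : is_vna (vna M) := vnaP M; move=> h; apply: WT.
split=> //; have [z lz zP] := norm2_le_l2.
have [B AB h] := double_commutant_density Aalg Abnd Aadj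
  (vna_gen_commutant2 Abnd Aadj WT) lz e0.
exists B => //; rewrite (le_trans (zP _ (M_sub MT (AM _ AB)))) //.
Qed.

End TraceForm.

(** * Schwinger-Dyson equations and freeness *)

Section Words.
Variables (C : comNzRingType) (A : algType C) (tau : {scalar A}).
Variables (L : Type) (ev : L -> A) (hit : pred L).
Implicit Types (u v : A) (w : seq L) (a : C).

Definition wev w : A := \prod_(x <- w) ev x.

Lemma wev_nil : wev [::] = 1.
Proof. exact: big_nil. Qed.

Lemma wev_cons x w : wev (x :: w) = ev x * wev w.
Proof. exact: big_cons. Qed.

Lemma wev_cat w1 w2 : wev (w1 ++ w2) = wev w1 * wev w2.
Proof. exact: big_cat. Qed.

Lemma wev_rcons w x : wev (rcons w x) = wev w * ev x.
Proof. by rewrite -cats1 wev_cat wev_cons wev_nil mulr1. Qed.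

(* The value of (tau (x) tau) at (u (x) 1) d(w) (1 (x) v), where d is the free
   difference quotient with d(x) = 1 (x) 1 at the letters x in [hit] and
   d(x) = 0 at the others. *)
Fixpoint dword w u v : C :=
  if w is x :: w' then
    (if hit x then tau u * tau (wev w' * v) else 0) + dword w' (u * ev x) v
  else 0.

Lemma tau_lin a u v : tau (a *: u + v) = a * tau u + tau v.
Proof. by rewrite linearP. Qed.

Lemma dword_linl w a u u' v :
  dword w (a *: u + u') v = a * dword w u v + dword w u' v.
Proof.
elim: w u u' => [|x w IH] u u' /=; first by rewrite mulr0 addr0.
rewrite mulrDl -scalerAl IH tau_lin; case: (hit x); ring.
Qed.

Lemma dword_linr w a u v v' :
  dword w u (a *: v + v') = a * dword w u v + dword w u v'.
Proof.
elim: w u => [|x w IH] u /=; first by rewrite mulr0 addr0.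
rewrite mulrDr -scalerAr IH tau_lin; case: (hit x); ring.
Qed.

Lemma dword_cat w1 w2 u v :
  dword (w1 ++ w2) u v = dword w1 u (wev w2 * v) + dword w2 (u * wev w1) v.
Proof.
elim: w1 u => [|x w IH] u /=; first by rewrite wev_nil mulr1 add0r.
by rewrite IH wev_cat wev_cons !mulrA addrA.
Qed.

Lemma dword_rcons w x u v :
  dword (rcons w x) u v = dword w u (ev x * v) +
    (if hit x then tau (u * wev w) * tau v else 0).
Proof.
by rewrite -cats1 dword_cat /= wev_cons wev_nil mulr1 mul1r addr0.
Qed.

Lemma dword_nohit w u v : all (predC hit) w -> dword w u v = 0.
Proof.
elim: w u => [//|x w IH] u /= /andP[/negbTE-> h].
by rewrite add0r IH.
Qed.

End Words.

(** * Extending Schwinger-Dyson equations by freeness *)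

Section FreeExtension.
Variables (C : comNzRingType) (A : algType C) (tau : {scalar A}).
Variables (L : Type) (ev : L -> A) (hit : pred L).
Variables (I : eqType) (col : L -> I) (c0 : I) (alg : I -> A -> Prop) (s : A).
Local Notation wev := (wev ev).
Local Notation dword := (dword tau ev hit).
Hypothesis tau1 : tau 1 = 1.
Hypothesis alg1 : forall c, alg c 1.
Hypothesis alg_lin : forall c a u v, alg c u -> alg c v -> alg c (a *: u + v).
Hypothesis algM : forall c u v, alg c u -> alg c v -> alg c (u * v).
Hypothesis alg_ev : forall x, alg (col x) (ev x).

(** The products on which freeness makes tau vanish. Colours name the free subalgebras. They are
    used twice: with one colour per semicircular element, then with one colour for all semicirculars
    and another for Y. *)
Definition centred_alt (l : seq (I * A)) : bool :=
  sorted (fun c d => c != d) (unzip1 l) &&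
  all (fun ca => `[< alg ca.1 ca.2 >] && (tau ca.2 == 0)) l.
Definition lev (l : seq (I * A)) : A := \prod_(ca <- l) ca.2.

Hypothesis free : forall l, centred_alt l -> l != [::] -> tau (lev l) = 0.
Hypothesis alg_s : alg c0 s.
Hypothesis tau_s : tau s = 0.
Hypothesis hit_col : forall x, hit x -> col x = c0.
Hypothesis base : forall w, all (fun x => col x == c0) w ->
  tau (s * wev w) = dword w 1 1.

Let lev_cons c a l : lev ((c, a) :: l) = a * lev l.
Proof. exact: big_cons. Qed.

Let lev_rcons l c a : lev (rcons l (c, a)) = lev l * a.
Proof. by rewrite /lev -cats1 big_cat big_seq1. Qed.

Let centre u := - tau u *: 1 + u.

Let tau_centre u : tau (centre u) = 0.
Proof. by rewrite tau_lin tau1 mulr1 addNr. Qed.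

Let alg_centre c u : alg c u -> alg c (centre u).
Proof. by move=> h; apply: alg_lin. Qed.

Let centreK u : u = tau u *: 1 + centre u.
Proof. by rewrite /centre scaleNr addNKr. Qed.

(** Split a into its trace and its centred part: the first leaves an alternating centred product,
    the second prolongs it by one factor. *)
Lemma centred_vanishl k K : centred_alt (k :: K) ->
  last k.1 (unzip1 K) != c0 ->
  forall a, alg c0 a -> tau (lev (k :: K) * a) = 0.
Proof.
move=> /andP[sK aK] lK a alg_a.
have kK : tau (lev (k :: K)) = 0 by apply: free; rewrite // /centred_alt sK aK.
rewrite [a]centreK mulrDr -scalerAr mulr1 tau_lin kK mulr0 add0r.
rewrite -(lev_rcons _ c0) free //.
apply/andP; split.
  by rewrite [unzip1 _]map_rcons /= rcons_path lK andbT.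
rewrite all_rcons aK andbT /= tau_centre eqxx andbT.
by apply/asboolP; exact: alg_centre.
Qed.

Lemma centred_vanishr k K : centred_alt (k :: K) -> c0 != k.1 ->
  forall a, alg c0 a -> tau (a * lev (k :: K)) = 0.
Proof.
move=> /andP[sK aK] lK a alg_a.
have kK : tau (lev (k :: K)) = 0 by apply: free; rewrite // /centred_alt sK aK.
rewrite [a]centreK mulrDl -scalerAl mul1r tau_lin kK mulr0 add0r.
rewrite -(lev_cons c0) free //; apply/andP; split.
  by rewrite /= lK.
rewrite -cat1s all_cat aK andbT /= tau_centre eqxx !andbT.
by apply/asboolP; exact: alg_centre.
Qed.

(** The difference quotient acts on expressions and not on the elements they denote, since the
    letters may satisfy relations. Hence the formal combinations of words. *)
Definition fev (p : seq (C * seq L)) : A := \sum_(cw <- p) cw.1 *: wev cw.2.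
Definition fdiff (p : seq (C * seq L)) u v : C :=
  \sum_(cw <- p) cw.1 * dword cw.2 u v.
Definition fcol c (p : seq (C * seq L)) : bool :=
  all (fun cw => all (fun x => col x == c) cw.2) p.

Let alg_word c w : all (fun x => col x == c) w -> alg c (wev w).
Proof.
elim: w => [|x w IH] /=; first by rewrite wev_nil.
by move=> /andP[/eqP cx hw]; rewrite wev_cons; apply: algM; [rewrite -cx | exact: IH].
Qed.

Let alg_fev c p : fcol c p -> alg c (fev p).
Proof.
elim: p => [|[a w] p IH] /=.
  by rewrite /fev big_nil -(addNr 1) -scaleN1r => _; apply: alg_lin.
move=> /andP[hw hp]; rewrite /fev big_cons; apply: alg_lin; first exact: alg_word.
exact: IH.
Qed.

Let fdiff_vanishl p u v : fcol c0 p ->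
  (forall a, alg c0 a -> tau (u * a) = 0) -> fdiff p u v = 0.
Proof.
move=> + hu; elim: p => [|[a w] p IH] /=; first by rewrite /fdiff big_nil.
move=> /andP[hw hp]; rewrite /fdiff big_cons -/(fdiff p u v) IH // addr0.
suff -> : dword w u v = 0 by rewrite mulr0.
elim: w u hu hw {IH} => [//|x w IH] u hu /= /andP[/eqP cx hw].
rewrite IH // ?addr0; last first.
  by move=> b hb; rewrite -mulrA hu //; apply: algM => //; rewrite -cx.
by have := hu 1 (alg1 _); rewrite mulr1 => ->; rewrite mul0r if_same.
Qed.

Let fdiff_vanishr p u v : fcol c0 p ->
  (forall a, alg c0 a -> tau (a * v) = 0) -> fdiff p u v = 0.
Proof.
move=> + hv; elim: p => [|[a w] p IH] /=; first by rewrite /fdiff big_nil.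
move=> /andP[hw hp]; rewrite /fdiff big_cons -/(fdiff p u v) IH // addr0.
suff -> : dword w u v = 0 by rewrite mulr0.
elim: w u hw {IH} => [//|x w IH] u /= /andP[/eqP cx hw].
by rewrite IH // addr0 hv ?mulr0 ?if_same //; apply: alg_word.
Qed.

Let fdiff_other c p u v : fcol c p -> c != c0 -> fdiff p u v = 0.
Proof.
move=> + cc; elim: p => [|[a w] p IH] /=; first by rewrite /fdiff big_nil.
move=> /andP[hw hp]; rewrite /fdiff big_cons -/(fdiff p u v) IH // addr0.
rewrite dword_nohit ?mulr0 //; apply: sub_all hw => x /eqP cx /=.
by apply/negP => /hit_col; rewrite cx => /eqP; rewrite (negbTE cc).
Qed.

Let fcons x (p : seq (C * seq L)) := [seq (cw.1, x :: cw.2) | cw <- p].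

Let fev_cons x p : fev (fcons x p) = ev x * fev p.
Proof.
rewrite /fev big_map mulr_sumr; apply: eq_bigr => cw _.
by rewrite wev_cons -scalerAr.
Qed.

Let fdiff_cons x p u v : fdiff (fcons x p) u v =
  (if hit x then tau u * tau (fev p * v) else 0) + fdiff p (u * ev x) v.
Proof.
rewrite /fdiff big_map /=; case: (hit x); last first.
  by rewrite add0r; apply: eq_bigr => cw _; rewrite add0r.
under eq_bigr do rewrite mulrDr; rewrite big_split /=; congr (_ + _).
rewrite /fev mulr_suml linear_sum mulr_sumr; apply: eq_bigr => cw _.
by rewrite -scalerAl linearZ /= mulrCA.
Qed.

Let fcentre p := (- tau (fev p), [::]) :: p.

Let fev_centre p : fev (fcentre p) = centre (fev p).
Proof. by rewrite /fev big_cons /= wev_nil. Qed.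

Let fdiff_centre p u v : fdiff (fcentre p) u v = fdiff p u v.
Proof. by rewrite /fdiff big_cons /= mulr0 add0r. Qed.

Let bl_alt (l : seq (I * seq (C * seq L))) :=
  sorted (fun c d => c != d) (unzip1 l) &&
  all (fun cp => fcol cp.1 cp.2 && (tau (fev cp.2) == 0)) l.

Let bl_list (l : seq (I * seq (C * seq L))) := [seq (cp.1, fev cp.2) | cp <- l].

Let bl_altP l : bl_alt l -> centred_alt (bl_list l).
Proof.
move=> /andP[sl al]; rewrite /centred_alt /bl_list /unzip1 -map_comp sl /=.
rewrite all_map; apply: sub_all al => cp /= /andP[h ->]; rewrite andbT.
by apply/asboolP; exact: alg_fev.
Qed.

Let bev l := lev (bl_list l).

(** The Leibniz rule over a product of blocks, with u on the left and v on the right as in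
    [dword]. *)
Fixpoint bdiff (l : seq (I * seq (C * seq L))) u v : C :=
  if l is cp :: l' then fdiff cp.2 u (bev l' * v) + bdiff l' (u * fev cp.2) v
  else 0.

Let bev_cons cp l : bev (cp :: l) = fev cp.2 * bev l.
Proof. exact: lev_cons. Qed.

Let bdiff_lin l a u u' v :
  bdiff l (a *: u + u') v = a * bdiff l u v + bdiff l u' v.
Proof.
elim: l u u' => [|[c p] l IH] u u' /=; first by rewrite mulr0 addr0.
rewrite mulrDl -scalerAl IH mulrDr addrACA; congr (_ + _).
rewrite /fdiff mulr_sumr -big_split; apply: eq_bigr => cw _ /=.
by rewrite dword_linl; ring.
Qed.

(* Every term of the derivative of an alternating centred product has a factor
   annihilated by freeness, as soon as something stands on its left. *)
Let bdiff_vanish k K l : centred_alt ((k :: K) ++ bl_list l) -> bl_alt l ->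
  bdiff l (lev (k :: K)) 1 = 0.
Proof.
elim: l k K => [//|[c p] l IH] k K /= hK hl.
have hp : fcol c p by move: hl => /andP[_ /= /andP[/andP[]]].
have tp : tau (fev p) == 0 by move: hl => /andP[_ /= /andP[/andP[]]].
have hl' : bl_alt l.
  by move: hl => /andP[/= /path_sorted sl /andP[_ al]]; rewrite /bl_alt sl.
have -> : lev (k :: K) * fev p = lev (k :: rcons K (c, fev p)).
  by rewrite -rcons_cons lev_rcons.
rewrite IH ?addr0 //; last by rewrite -rcons_cons cat_rcons.
have [cc|cc] := eqVneq c c0; last exact: fdiff_other hp cc.
subst c; move: hK => /andP[]; rewrite -cat_cons all_cat.
rewrite [unzip1 _](_ : _ = k.1 :: (unzip1 K ++ c0 :: unzip1 (bl_list l))); last first.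
  by rewrite /unzip1 map_cat.
rewrite /= cat_path /= => /andP[sK /andP[lK _]] /andP[aK _].
apply: fdiff_vanishl => //; apply: centred_vanishl => //.
by apply/andP; split; [exact: sK | exact: aK].
Qed.

Let base_fev p : fcol c0 p -> tau (s * fev p) = fdiff p 1 1.
Proof.
elim: p => [|[a w] p IH] /=; first by rewrite /fev /fdiff !big_nil mulr0 linear0.
move=> /andP[hw hp]; rewrite /fev /fdiff !big_cons -/(fev p) -/(fdiff p 1 1).
by rewrite mulrDr -scalerAr tau_lin base // IH.
Qed.

(** If the first block has a colour other than c0, putting s in front gives an alternating centred
    product. If it has colour c0 and another block follows, s merges with it and the rest is
    annihilated. A single block of colour c0 is the hypothesis [base]. *)
Let SD_blocks l : bl_alt l -> tau (s * bev l) = bdiff l 1 1.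
Proof.
case: l => [|[c p] l] hl; first by rewrite /bev /lev big_nil mulr1.
have hp : fcol c p by move: hl => /andP[_ /= /andP[/andP[]]].
have tp : tau (fev p) == 0 by move: hl => /andP[_ /= /andP[/andP[]]].
have hl' : bl_alt l.
  by move: hl => /andP[/= /path_sorted sl /andP[_ al]]; rewrite /bl_alt sl.
have cl := bl_altP hl.
have lp : lev [:: (c, fev p)] = fev p by rewrite lev_cons /lev big_nil mulr1.
rewrite /= mul1r mulr1 -lp bdiff_vanish // addr0 bev_cons /=.
have [cc|cc] := eqVneq c c0; last first.
  rewrite (fdiff_other _ _ hp cc) -(bev_cons (c, p)) -(lev_cons c0) free //.
  move: cl; rewrite /centred_alt /= => /andP[-> ->] /=.
  by rewrite eq_sym cc tau_s eqxx !andbT /=; apply/asboolP.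
subst c; case: l hl hl' cl => [|[d q] l] hl hl' cl.
  by rewrite /bev /lev big_nil mulr1 base_fev.
have dc : c0 != d by move: hl => /andP[/= /andP[]].
have v := centred_vanishr (bl_altP hl') dc.
rewrite mulrA v; last by apply: algM => //; exact: alg_fev.
by rewrite fdiff_vanishr.
Qed.

Let SD_words_blocks w l : bl_alt l ->
  tau (s * (wev w * bev l)) = dword w 1 (bev l) + bdiff l (wev w) 1.
Proof.
elim/last_ind: w l => [|w x IH] l hl.
  by rewrite wev_nil mul1r SD_blocks //= add0r.
rewrite wev_rcons dword_rcons mul1r -mulrA.
(* The last letter x of the word joins the first block if it has the same colour, and otherwise
   forms a block of its own. The result p need not be centred, so [fcentre p] takes its place in the
   alternating list. *)
have [c [p [l' [hl' hnew E1 E2]]]] : exists c p l', [/\ bl_alt l',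
    bl_alt ((c, fcentre p) :: l'),
    ev x * bev l = fev p * bev l' &
    (if hit x then tau (wev w) * tau (bev l) else 0) + bdiff l (wev w * ev x) 1 =
      fdiff p (wev w) (bev l') + bdiff l' (wev w * fev p) 1 ].
  have new : bl_alt l -> (forall c q l'', l = (c, q) :: l'' -> col x != c) ->
      exists c p l', [/\ bl_alt l', bl_alt ((c, fcentre p) :: l'),
    ev x * bev l = fev p * bev l' &
    (if hit x then tau (wev w) * tau (bev l) else 0) + bdiff l (wev w * ev x) 1 =
      fdiff p (wev w) (bev l') + bdiff l' (wev w * fev p) 1 ].
    move=> _ hx; exists (col x), [:: (1, [:: x])], l.
    have fx : fev [:: (1, [:: x])] = ev x.
      by rewrite /fev big_seq1 scale1r wev_cons wev_nil mulr1.
    rewrite fx; split=> //.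
      rewrite /bl_alt /= fev_centre tau_centre !eqxx /=.
      case: l hl hx => [//|[d q] l] /andP[/= -> ->] hx.
      by rewrite (hx d q l).
    by rewrite /fdiff big_seq1 /= wev_nil !mul1r addr0.
  case: l hl new => [|[d q] l] hl new; first exact: new.
  have [cx|cx] := eqVneq (col x) d; last by apply: new => // c' q' l' [<-].
  exists d, (fcons x q), l; split.
  - by move: hl => /andP[/= /path_sorted sl /andP[_ al]]; rewrite /bl_alt sl.
  - move: hl; rewrite /bl_alt /= fev_centre tau_centre eqxx andbT.
    move=> /andP[-> /andP[/andP[hq _] ->]]; rewrite andbT /=.
    rewrite /fcol all_map; apply: sub_all hq => cw /= ->.
    by rewrite cx eqxx.
  - by rewrite fev_cons bev_cons mulrA.
  - by rewrite /= mulr1 fdiff_cons fev_cons bev_cons mulrA addrA.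
rewrite E1 -addrA [X in _ = _ + X]E2.
(* Splitting p into its trace and its centred part leaves two alternating lists, l' and the one
   headed by [fcentre p]. The induction hypothesis for the shorter word applies to each. *)
have pE u : fev p * u = tau (fev p) *: u + fev (fcentre p) * u.
  by rewrite fev_centre [in LHS](centreK (fev p)) mulrDl -scalerAl mul1r.
rewrite pE -(bev_cons (c, fcentre p)) mulrDr mulrDr -!scalerAr tau_lin.
rewrite !IH // dword_linr.
have -> : wev w * fev p = tau (fev p) *: wev w + wev w * fev (fcentre p).
  by rewrite -[fev p in LHS]mulr1 pE mulr1 mulrDr -scalerAr mulr1.
rewrite bdiff_lin /= mulr1 fdiff_centre; ring.
Qed.

(* Multiplying an alternating centred product on the left by a letter gives a
   combination of such products: this reduces words to the latter, where both
   sides vanish by freeness unless there is a single block of colour c0. *)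
Theorem free_extension w : tau (s * wev w) = dword w 1 1.
Proof.
have := @SD_words_blocks w [::] isT.
by rewrite /bev /lev big_nil mulr1 addr0.
Qed.

End FreeExtension.

(** * Polynomials determined by their values or by their derivative *)

Section PolyAux.
Variable C : numDomainType.

Lemma poly_horner_inj (p q : {poly C}) : (forall x, p.[x] = q.[x]) -> p = q.
Proof.
move=> h; apply/eqP; rewrite -subr_eq0; apply/negPn/negP => n0.
pose s := [seq (k%:R : C) | k <- iota 0 (size (p - q))].
have : (size s < size (p - q)%R)%N.
  apply: max_poly_roots => //.
    by apply/allP => x _; rewrite rootE !hornerE h subrr.
  rewrite map_inj_uniq ?iota_uniq // => a b /eqP.
  by rewrite eqr_nat => /eqP.
by rewrite size_map size_iota ltnn.
Qed.

Lemma poly_deriv_inj (p q : {poly C}) :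
  p^`() = q^`() -> p.[0] = q.[0] -> p = q.
Proof.
move=> hd h0; apply/polyP => -[|i]; first by rewrite -!horner_coef0.
have /(congr1 (fun r : {poly C} => r`_i)) := hd.
by rewrite !coef_deriv => /eqP; rewrite eqrMn2r //= => /eqP.
Qed.
End PolyAux.

Lemma poly_primitive (C : numFieldType) (g : {poly C}) :
  exists2 h : {poly C}, h^`() = g & h.[0] = 0.
Proof.
exists (\poly_(i < (size g).+1) (if i is j.+1 then g`_j / j.+1%:R else 0)).
  apply/polyP => i; rewrite coef_deriv coef_poly ltnS.
  case: ifPn => h; first by rewrite -[LHS]mulr_natr divfK // pnatr_eq0.
  by rewrite mul0rn nth_default // leqNgt.
by rewrite horner_coef0 coef_poly.
Qed.

(** * Evolution of the moments under a semicircular perturbation *)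

Section LawFunctionals.
Variable T : eqType.
Implicit Types (i x : T) (w v pre : seq T).

(* The sum of mu a * mu b over the factorisations a i b of [pre ++ w] whose
   marked letter i lies in [w]. *)
Fixpoint ell (K : pzSemiRingType) (mu : seq T -> K) i pre w : K :=
  if w is x :: w' then
    (if x == i then mu pre * mu w' else 0) + ell mu i (rcons pre x) w'
  else 0.

(** For empty [pre]: over all ordered pairs of distinct positions of w with equal letters, the sum
    of the products of mu on the two arcs into which the pair cuts w, read cyclically. Half of it
    will be the derivative of a moment in r^2. The recursion keeps in [pre] the letters already
    passed. *)
Fixpoint dlaw (K : pzSemiRingType) (mu : seq T -> K) pre w : K :=
  if w is x :: w' then
    ell mu x [::] (w' ++ pre) + dlaw mu (rcons pre x) w'
  else 0.

Lemma ell_ext (K : pzSemiRingType) (mu nu : seq T -> K) i pre w :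
  (forall v, (size v < size pre + size w)%N -> mu v = nu v) ->
  ell mu i pre w = ell nu i pre w.
Proof.
elim: w pre => [//|x w IH] pre h /=; rewrite IH => [|v]; last first.
  by rewrite size_rcons addSnnS; exact: h.
by rewrite !h // -[X in (X < _)%N]addn0 ?ltn_add2l // addn0 /= addnS ltnS leq_addl.
Qed.

(** Only shorter words enter, so the differential equation for the moments can be solved by
    induction on the length. *)
Lemma dlaw_ext (K : pzSemiRingType) (mu nu : seq T -> K) pre w :
  (forall v, (size v < size pre + size w)%N -> mu v = nu v) ->
  dlaw mu pre w = dlaw nu pre w.
Proof.
elim: w pre => [//|x w IH] pre h /=; rewrite IH => [|v]; last first.
  by rewrite size_rcons addSnnS; exact: h.
congr (_ + _); apply: ell_ext => v; rewrite add0n size_cat addnC => hv.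
by apply: h; rewrite /= addnS ltnS ltnW.
Qed.

Lemma ell_morph (K K' : pzSemiRingType) (f : {rmorphism K -> K'}) mu i pre w :
  f (ell mu i pre w) = ell (fun v => f (mu v)) i pre w.
Proof.
elim: w pre => [|x w IH] pre /=; first by rewrite rmorph0.
by rewrite rmorphD IH; case: eqP; rewrite ?rmorphM ?rmorph0.
Qed.

Lemma dlaw_morph (K K' : pzSemiRingType) (f : {rmorphism K -> K'}) mu pre w :
  f (dlaw mu pre w) = dlaw (fun v => f (mu v)) pre w.
Proof.
elim: w pre => [|x w IH] pre /=; first by rewrite rmorph0.
by rewrite rmorphD IH ell_morph.
Qed.

Lemma ell_nohit (K : pzSemiRingType) (mu : seq T -> K) i pre w :
  all (fun x => x != i) w -> ell mu i pre w = 0.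
Proof.
by elim: w pre => [//|x w IH] pre /= /andP[/negbTE-> /IH->]; rewrite add0r.
Qed.

End LawFunctionals.

Section SemicircularSystem.
Variables (C : numClosedFieldType) (A : algType C) (tau : {scalar A}).
Variables (T : eqType) (Y S : T -> A).
Implicit Types (w : seq T) (r : C).

Definition mixed (x : T + T) : A :=
  match x with inl i => S i | inr i => Y i end.
Definition mixed_hit (i : T) (x : T + T) : bool :=
  if x is inl j then j == i else false.

Definition schwinger_dyson : Prop := forall i (w : seq (T + T)),
  tau (S i * wev mixed w) = dword tau mixed (mixed_hit i) w 1 1.

Definition pert r i : A := Y i + r *: S i.
Definition law r w : C := tau (wev (pert r) w).

Hypothesis SD : schwinger_dyson.
Hypothesis tauC : forall a b, tau (a * b) = tau (b * a).

Lemma pert0 : pert 0 = Y.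
Proof. by apply/funext => i; rewrite /pert scale0r addr0. Qed.

Let dpert i r := dword tau (pert r) (pred1 i).

Lemma ell_dword i r pre w :
  dpert i r w (wev (pert r) pre) 1 = ell (law r) i pre w.
Proof.
rewrite /dpert; elim: w pre => [//|x w IH] pre /=.
by rewrite mulr1 -wev_rcons IH.
Qed.

(** The perturbed letters are expanded one at a time into Y and r S and moved to the prefix u; each
    S that is hit contributes its factor r. *)
Let score_mixed i r u w :
  tau (S i * (wev mixed u * wev (pert r) w)) =
  dword tau mixed (mixed_hit i) u 1 (wev (pert r) w) +
  r * dpert i r w (wev mixed u) 1.
Proof.
elim: w u => [|x w IH] u; first by rewrite wev_nil mulr1 SD mulr0 addr0.
rewrite wev_cons; set W := wev (pert r) w.
have Ey := IH (rcons u (inr x)); have Es := IH (rcons u (inl x)).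
rewrite !wev_rcons !dword_rcons /= -/W -!mulrA !mul1r in Ey Es.
have -> : S i * (wev mixed u * (pert r x * W)) =
    r *: (S i * (wev mixed u * (S x * W))) + S i * (wev mixed u * (Y x * W)).
  by rewrite /pert mulrDl -scalerAl !mulrDr -!scalerAr addrC.
rewrite tau_lin Ey Es /dpert /= -/W mulr1.
have -> : pert r x * W = r *: (S x * W) + Y x * W.
  by rewrite /pert mulrDl -scalerAl addrC.
have -> : wev mixed u * pert r x = r *: (wev mixed u * S x) + wev mixed u * Y x.
  by rewrite /pert mulrDr -scalerAr addrC.
rewrite dword_linr dword_linl; case: (x == i); ring.
Qed.

Lemma score i r w : tau (S i * wev (pert r) w) = r * ell (law r) i [::] w.
Proof.
have := score_mixed i r [::] w; rewrite wev_nil mul1r /= add0r => ->.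
by rewrite -ell_dword wev_nil.
Qed.

(** The product rule in r: each perturbed letter in turn is replaced by its derivative S. *)
Let dtau r := fix dtau u w : C :=
  if w is x :: w' then
    tau (u * (S x * wev (pert r) w')) + dtau (u * pert r x) w'
  else 0.

Let dtau_lin r a u u' w : dtau r (a *: u + u') w = a * dtau r u w + dtau r u' w.
Proof.
elim: w u u' => [|x w IH] u u' /=; first by rewrite mulr0 addr0.
by rewrite !mulrDl -!scalerAl IH tau_lin; ring.
Qed.

Let law_prefix_poly u w : exists p : {poly C}, forall r,
  p.[r] = tau (u * wev (pert r) w) /\ p^`().[r] = dtau r u w.
Proof.
elim: w u => [|x w IH] u.
  exists (tau u)%:P => r.
  by rewrite derivC !hornerE wev_nil mulr1.
have [p pP] := IH (u * Y x); have [q qP] := IH (u * S x).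
exists (p + 'X * q) => r; have [p1 p2] := pP r; have [q1 q2] := qP r.
rewrite derivD derivM derivX mul1r !hornerE p1 p2 q1 q2 /=.
have E : u * pert r x = r *: (u * S x) + u * Y x.
  by rewrite /pert mulrDr -scalerAr addrC.
rewrite wev_cons; split.
  by rewrite mulrA E mulrDl -scalerAl tau_lin addrC.
by rewrite E dtau_lin mulrA; ring.
Qed.

(** Traciality brings S x to the front of the rotated word, where [score] evaluates it. *)
Let dtau_dlaw r pre w :
  dtau r (wev (pert r) pre) w = r * dlaw (law r) pre w.
Proof.
elim: w pre => [|x w IH] pre /=; first by rewrite mulr0.
by rewrite -wev_rcons IH tauC -mulrA -wev_cat score; ring.
Qed.

Lemma law_poly w : exists p : {poly C}, forall r,
  p.[r] = law r w /\ p^`().[r] = r * dlaw (law r) [::] w.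
Proof.
have [p pP] := law_prefix_poly 1 w; exists p => r; have [-> ->] := pP r.
by rewrite mul1r -dtau_dlaw wev_nil.
Qed.

(** By induction on the length, the derivative in r is r times a polynomial in r^2, so the moment is
    itself a polynomial in r^2. In this variable perturbations compose by addition. *)
Lemma law_evolution : exists Q : seq T -> {poly C},
  (forall w r, (Q w).[r ^+ 2] = law r w) /\
  (forall w, (Q w)^`() *+ 2 = dlaw Q [::] w).
Proof.
have ex w : exists q : {poly C}, forall r, q.[r ^+ 2] = law r w.
  have [n] := ubnP (size w); elim: n w => [//|n IHn] w hw.
  have {}IHn v : exists q : {poly C}, (size v < n)%N -> forall r, q.[r ^+ 2] = law r v.
    by have [/IHn[q hq]|hv] := ltnP (size v) n; [exists q | exists 0].
  have [Q QP] := boolp.choice IHn.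
  have [p pP] := law_poly w.
  set g := dlaw Q [::] w.
  have dp : p^`() = 'X * (g \Po 'X^2).
    apply: poly_horner_inj => r; rewrite (pP r).2 !hornerE horner_comp !hornerE.
    congr (_ * _); rewrite -[RHS]/(horner_eval (r ^+ 2) _) dlaw_morph.
    apply: dlaw_ext => v; rewrite add0n => hv; rewrite /= horner_evalE QP //.
    exact: leq_trans hv hw.
  (* The derivative of h(r^2) is 2 r h'(r^2), whence the factor 1/2; the constant of integration is
     the moment at r = 0. *)
  have [h hd h0] := poly_primitive (2^-1 *: g).
  exists (h + p.[0]%:P) => r; rewrite -(pP r).1.
  transitivity (((h + p.[0]%:P) \Po 'X^2).[r]).
    by rewrite horner_comp hornerXn.
  congr (_.[_]); apply: poly_deriv_inj.
    rewrite deriv_comp derivD derivC addr0 hd dp derivXn /= expr1 comp_polyZ.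
    rewrite -scalerAl mulrnAr -scalerMnr scalerMnl -mulr_natr mulVf ?pnatr_eq0 //.
    by rewrite scale1r mulrC.
  by rewrite horner_comp !hornerE expr0n h0 add0r.
have [Q QP] := boolp.choice ex; exists Q; split=> // w.
have [p pP] := law_poly w.
have pQ : p = Q w \Po 'X^2.
  by apply: poly_horner_inj => r; rewrite (pP r).1 horner_comp hornerXn QP.
have E : ((Q w)^`() *+ 2) \Po 'X^2 = dlaw Q [::] w \Po 'X^2.
  apply: (mulfI (negbT (polyX_eq0 C))); apply: poly_horner_inj => r.
  transitivity (r * dlaw (law r) [::] w).
    rewrite -(pP r).2 pQ deriv_comp derivXn /= expr1 !hornerE !horner_comp.
    rewrite !hornerE; ring.
  rewrite hornerM hornerX horner_comp hornerXn.
  congr (_ * _); rewrite -[RHS]/(horner_eval (r ^+ 2) _) dlaw_morph.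
  by apply: dlaw_ext => v _; rewrite /= horner_evalE QP.
(* The substitution of X^2 can be undone because every t is a square. *)
apply: poly_horner_inj => t; rewrite -(sqrtCK t).
by have := congr1 (horner^~ (sqrtC t)) E; rewrite /= !horner_comp hornerXn.
Qed.

End SemicircularSystem.

Lemma dlaw_unique (C : numFieldType) (T : eqType) (P Q : seq T -> {poly C}) :
  (forall w, (P w)^`() *+ 2 = dlaw P [::] w) ->
  (forall w, (Q w)^`() *+ 2 = dlaw Q [::] w) ->
  (forall w, (P w).[0] = (Q w).[0]) -> P =1 Q.
Proof.
move=> hP hQ h0 w; have [n] := ubnP (size w); elim: n w => [//|n IHn] w hw.
apply: poly_deriv_inj => //.
have two_neq0 : (2 : C) != 0 by rewrite pnatr_eq0.
apply: (scalerI two_neq0); rewrite !scaler_nat hP hQ.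
by apply: dlaw_ext => v; rewrite add0n => hv; apply: IHn; apply: leq_trans hv hw.
Qed.

(** The equation does not involve the time r^2 explicitly, so the translate by e^2 of a solution is
    a solution, and equal initial moments give equal moments throughout. The case e = 0 compares
    perturbations living in two different algebras. *)
Theorem law_shift (C : numClosedFieldType) (T : eqType)
    (A1 A2 : algType C) (tau1 : {scalar A1}) (tau2 : {scalar A2})
    (Y1 S1 : T -> A1) (Y2 S2 : T -> A2) (e : C) :
  schwinger_dyson tau1 Y1 S1 -> schwinger_dyson tau2 Y2 S2 ->
  (forall a b, tau1 (a * b) = tau1 (b * a)) ->
  (forall a b, tau2 (a * b) = tau2 (b * a)) ->
  (forall w, law tau1 Y1 S1 0 w = law tau2 Y2 S2 e w) ->
  forall r1 r2, r2 ^+ 2 = e ^+ 2 + r1 ^+ 2 ->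
  forall w, law tau1 Y1 S1 r1 w = law tau2 Y2 S2 r2 w.
Proof.
move=> SD1 SD2 C1 C2 h0 r1 r2 hr w.
have [Q1 [Q1E dQ1]] := law_evolution SD1 C1.
have [Q2 [Q2E dQ2]] := law_evolution SD2 C2.
pose P2 w := Q2 w \Po ('X + (e ^+ 2)%:P).
have -> : law tau1 Y1 S1 r1 w = (Q1 w).[r1 ^+ 2] by rewrite Q1E.
have -> : law tau2 Y2 S2 r2 w = (P2 w).[r1 ^+ 2].
  by rewrite /P2 horner_comp !hornerE addrC -hr Q2E.
congr (_.[_]); apply: dlaw_unique => // {}w.
  rewrite /P2 deriv_comp derivD derivX derivC addr0 mulr1.
  rewrite -[LHS](raddfMn (comp_poly ('X + (e ^+ 2)%:P))) dQ2.
  exact: dlaw_morph.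
by rewrite /P2 horner_comp !hornerE Q2E -h0 -Q1E expr0n.
Qed.

(** * Semicircular moments *)

Section Catalan.
Variables (K : numFieldType) (m : nat -> K).
Hypothesis m0 : m 0%N = 1.
Hypothesis mrec : forall j, j.+3%:R * m j.+1 = 4 * j%:R * m j.-1.

Let conv n := \sum_(i < n.+1) m i * m (n - i)%N.

(** Average the sum with its reversal, i going to n - i. *)
Let weighted_conv (c : K) n :
  \sum_(i < n.+1) (i%:R + c) * (m i * m (n - i)%N) *+ 2 =
  (n%:R + c *+ 2) * conv n.
Proof.
set W := \sum_(i < n.+1) _.
have WE : W = \sum_(i < n.+1) ((n - i)%N%:R + c) * (m i * m (n - i)%N) *+ 2.
  rewrite /W (reindex_inj rev_ord_inj) /=; apply: eq_bigr => i _.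
  rewrite subSS subKn; last by rewrite -ltnS.
  by rewrite [m i * _]mulrC.
have two_neq0 : (2 : K) != 0 by rewrite pnatr_eq0.
apply: (mulfI two_neq0); rewrite mulr_natl mulr2n {2}WE -big_split /= mulr_sumr mulr_sumr.
apply: eq_bigr => i _; rewrite -!mulrnDl -mulrDl natrB; last by rewrite -ltnS.
ring.
Qed.

(** Weight the convolution at n + 2 by i + 2. By symmetry the sum is a multiple of that convolution;
    by the recurrence it reduces to m (n + 2) and the convolution at n, which agree by induction.
    The recurrence then identifies the outcome with m (n + 4). *)
Lemma catalan_conv n : m n.+1 = \sum_(j < n) m j * m (n.-1 - j)%N.
Proof.
have m1 : m 1%N = 0.
  have /eqP := mrec 0; rewrite mulr0 mul0r mulf_eq0 pnatr_eq0 /=.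
  by move=> /eqP.
case: n => [|n]; first by rewrite big_ord0.
rewrite -[RHS]/(conv n) /=.
have [k] := ubnP n; elim: k n => [//|k IHk] [|[|n]] hn.
- rewrite /conv big_ord1 m0 mulr1; have := mrec 1; rewrite m0 mulr1 mulr1.
  move=> h; apply: (@mulfI _ 4%:R); first by rewrite pnatr_eq0.
  by rewrite h mulr1.
- rewrite /conv !big_ord_recl big_ord0 /= m0 m1.
  have := mrec 2; rewrite m1 mulr0 => /eqP; rewrite mulf_eq0 pnatr_eq0 /=.
  by move=> /eqP ->; ring.
have IH : m n.+2 = conv n by apply: IHk; rewrite -ltnS ltnW.
have E1 := weighted_conv 1 n; have E2 := weighted_conv 2 n.+2.
(* The recurrence lowers the index of m i by two. The term i = 0 is left over, and i = 1 vanishes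
   with m 1. *)
have E3 : \sum_(i < n.+3) (i%:R + 2) * (m i * m (n.+2 - i)%N) *+ 2 =
  4 * m n.+2 + 4 * \sum_(i < n.+1) (i%:R + 1) * (m i * m (n - i)%N) *+ 2.
  rewrite big_ord_recl big_ord_recl /= m0 /bump /= m1 subn0 mul0r mulr0 mul0rn !add0r.
  congr (_ + _); first by ring.
  rewrite mulr_sumr; apply: eq_bigr => i _ /=.
  rewrite /bump /= !add1n !subSS.
  have -> : (i.+2%:R + 2 : K) = i.+4%:R by rewrite -natrD addn2.
  
  rewrite mulrA.
  rewrite mrec /= -natr1; ring.
rewrite E1 E2 -IH in E3.
have n6E : n.+2%:R + 2 *+ 2 = n.+3.+3%:R :> K.
  by rewrite -(addn4 n.+2) natrD; ring.
rewrite n6E in E3.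
have n6 : (n.+3.+3%:R : K) != 0 by rewrite pnatr_eq0.
apply: (mulfI n6); rewrite E3 mrec /=; rewrite -!natr1; ring.
Qed.

End Catalan.

Section SemicircleMoments.
Variable R : realType.
Local Notation mu := (@lebesgue_measure R).

Let sc (t : R) : R := Num.sqrt (4 - t ^+ 2) / (2 * pi).

Definition semicircle_moment k : R :=
  \int[mu]_(t in `[(-2), 2]) (t ^+ k * (Num.sqrt (4 - t ^+ 2) / (2 * pi))).

Let cont_sqrt : continuous (fun t : R => Num.sqrt (4 - t ^+ 2)).
Proof.
move=> t; apply: continuous_comp; last exact: sqrt_continuous.
apply: cvgB => /=; first exact: cvg_cst.
exact: exprn_continuous.
Qed.

Let cont_sc : continuous sc.
Proof.
by move=> t; apply: cvgM; [exact: cont_sqrt | exact: cvg_cst].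
Qed.

Let cont_mom k : continuous (fun t : R => t ^+ k * sc t).
Proof.
by move=> t; apply: cvgM; [exact: exprn_continuous | exact: cont_sc].
Qed.

Let int_cont (g : R -> R) : continuous g -> mu.-integrable `[(-2), 2] (EFin \o g).
Proof.
move=> cg; apply: continuous_compact_integrable; first exact: segment_compact.
exact: continuous_subspaceT.
Qed.

(* Integrate the derivative of t^j (4 - t^2)^(3/2), which vanishes at both
   endpoints. *)
Lemma semicircle_moment_rec j :
  j.+3%:R * semicircle_moment j.+1 = 4 * j%:R * semicircle_moment j.-1.
Proof.
pose F (t : R) := t ^+ j * (4 - t ^+ 2) * sc t.
pose f (t : R) := (4 * j%:R) * (t ^+ j.-1 * sc t) - j.+3%:R * (t ^+ j.+1 * sc t).
have cF : continuous F.
  move=> t; apply: cvgM; last exact: cont_sc.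
  apply: cvgM; first exact: exprn_continuous.
  by apply: cvgB; [exact: cvg_cst | exact: exprn_continuous].
have cf : continuous f.
  move=> t; apply: cvgB;
  by apply: cvgM; [exact: cvg_cst | exact: cont_mom].
have dF (x : R) : x \in `](-2), 2[ -> is_derive x 1 F (f x).
  rewrite in_itv /= => /andP[x1 x2].
  have x0 : 0 < 4 - x ^+ 2.
    by rewrite (_ : 4 - x ^+ 2 = (2 - x) * (2 + x)); [rewrite mulr_gt0; lra | ring].
  have dX n : is_derive x 1 (fun t : R => t ^+ n) (n%:R * x ^+ n.-1).
    rewrite (_ : (fun t : R => t ^+ n) = id ^+ n).
      by apply: (is_derive_eq (is_deriveX n (is_derive_id x 1))); rewrite [LHS]mulr1.
    by apply/funext => t; rewrite exprfctE.
  have dB := is_deriveB (is_derive_cst (4 : R^o) x 1) (dX 2%N).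
  have dS := @is_derive1_comp R Num.sqrt (fun t => 4 - t ^+ 2) _ _ _ (is_derive1_sqrt x0) dB.
  have d := is_deriveM (is_deriveM (dX j) dB) (is_deriveM dS (is_derive_cst ((2 * pi)^-1 : R^o) x 1)).
  apply: (is_derive_eq d); rewrite /f /sc; set p := 2 * pi.
  have s0 : 0 < Num.sqrt (4 - x ^+ 2) by rewrite sqrtr_gt0.
  have sE : 4 - x ^+ 2 = Num.sqrt (4 - x ^+ 2) ^+ 2 by rewrite sqr_sqrtr // ltW.
  have p0 : p != 0 by rewrite mulf_neq0 ?pnatr_eq0 // gt_eqF // pi_gt0.
  transitivity (x ^+ j * (4 - x ^+ 2) * (Num.sqrt (4 - x ^+ 2) * 0 + p^-1 *
      ((2 * Num.sqrt (4 - x ^+ 2))^-1 * (0 - 2 * x))) +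
    Num.sqrt (4 - x ^+ 2) * p^-1 *
      (x ^+ j * (0 - 2 * x) + (4 - x ^+ 2) * (j%:R * x ^+ j.-1))) => //.
  move: s0 sE; set s := Num.sqrt _ => s0 sE; rewrite {1}sE.
  have sn0 : s != 0 by rewrite gt_eqF.
  (* For j = 0 the exponent j.-1 is 0 instead of -1, but the factor j vanishes. *)
  have xj : j%:R * x ^+ j.+1 = j%:R * x ^+ j.-1 * x ^+ 2.
    by case: (j) => [|k]; rewrite ?mul0r //= -mulrA -exprD addn2.
  have -> : 4 * j%:R * (x ^+ j.-1 * (s / p)) - j.+3%:R * (x ^+ j.+1 * (s / p)) =
     (4 * (j%:R * x ^+ j.-1) - j%:R * x ^+ j.+1 - 3 * (x * x ^+ j)) * (s / p).
    by rewrite -(addn3 j) natrD exprS; ring.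
  by rewrite xj; field; rewrite p0.
have : (\int[mu]_(x in `[(- 2)%R, 2%R]) (f x)%:E = (F 2)%:E - (F (-2))%:E)%E.
  apply: continuous_FTC2.
  - by lra.
  - exact: continuous_subspaceT.
  - split.
    + by move=> x /dF[].
    + by apply: cvg_at_right_filter; exact: cF.
    + by apply: cvg_at_left_filter; exact: cF.
  - by move=> x /dF[_ h]; rewrite derive1E.
have -> : F 2 = 0 by rewrite /F (_ : 4 - 2 ^+ 2 = 0) ?mulr0 ?mul0r //; ring.
have -> : F (-2) = 0 by rewrite /F (_ : 4 - (-2) ^+ 2 = 0) ?mulr0 ?mul0r //; ring.
rewrite sube0 => /(congr1 fine) /=.
rewrite -[LHS]/(Rintegral mu `[(- 2)%R, 2%R] f) /f RintegralB //; last 2 first.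
- by apply: int_cont => t; apply: cvgM; [exact: cvg_cst | exact: cont_mom].
- by apply: int_cont => t; apply: cvgM; [exact: cvg_cst | exact: cont_mom].
rewrite !RintegralZl //; try exact/int_cont/cont_mom.
by move=> /eqP; rewrite subr_eq0 => /eqP ->.
Qed.

End SemicircleMoments.

(** * The von Neumann algebra as an algebra with a trace *)

Section TracialAlgebra.
Variables (R : realType) (M : tracial_vna R).

(** Functions on H form no ring under composition, which is distributive on both sides only for
    additive maps. The elements of M do, so the word calculus above applies to them. *)
Record malg := Malg { mval : op M; mvalP : `[< vna M mval >] }.

HB.instance Definition _ := [isSub for mval].
HB.instance Definition _ := [Choice of malg by <:].

Lemma mval_vna a : vna M (mval a).
Proof. exact: asboolW (mvalP a). Qed.

Definition mk (T : op M) (h : vna M T) : malg := Malg (asboolT h).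

Lemma malg_inj a b : mval a = mval b -> a = b.
Proof. exact: val_inj. Qed.

Let madd a b := mk (M_add (mval_vna a) (mval_vna b)).
Let mzero := mk (M_zero M).
Let mopp a := mk (M_scale (-1) (mval_vna a)).
Let mone := mk (M_id M).
Let mmul a b := mk (M_comp (mval_vna a) (mval_vna b)).
Let mscale c a := mk (M_scale c (mval_vna a)).

Let maddA : associative madd.
Proof. by move=> a b c; apply: malg_inj; rewrite /= addrA. Qed.
Let maddC : commutative madd.
Proof. by move=> a b; apply: malg_inj; rewrite /= addrC. Qed.
Let madd0 : left_id mzero madd.
Proof. by move=> a; apply: malg_inj; rewrite /= add0r. Qed.
Let maddN : left_inverse mzero mopp madd.
Proof. by move=> a; apply: malg_inj; rewrite /= scaleN1r addNr. Qed.

HB.instance Definition _ := GRing.isZmodule.Build malg maddA maddC madd0 maddN.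

Let mmulA : associative mmul.
Proof. by move=> a b c; apply: malg_inj. Qed.
Let mmul1 : left_id mone mmul.
Proof. by move=> a; apply: malg_inj. Qed.
Let mmulr1 : right_id mone mmul.
Proof. by move=> a; apply: malg_inj. Qed.
Let mmulDl : left_distributive mmul madd.
Proof. by move=> a b c; apply: malg_inj. Qed.
Let mmulDr : right_distributive mmul madd.
Proof.
move=> a b c; apply: malg_inj; exact: comp_addr (mval_vna a).
Qed.
Let mone_neq0 : mone != mzero.
Proof.
apply/eqP => /(congr1 mval) /= h.
have /eqP := state_unit (traceP M); rewrite h trace0 eq_sym oner_eq0.
by [].
Qed.

HB.instance Definition _ :=
  GRing.Zmodule_isNzRing.Build malg mmulA mmul1 mmulr1 mmulDl mmulDr mone_neq0.

Let mscaleA a b v : mscale a (mscale b v) = mscale (a * b) v.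
Proof. by apply: malg_inj; rewrite /= scalerA. Qed.
Let mscale1 : left_id 1 mscale.
Proof. by move=> a; apply: malg_inj; rewrite /= scale1r. Qed.
Let mscaleDr : right_distributive mscale +%R.
Proof. by move=> a b c; apply: malg_inj; rewrite /= scalerDr. Qed.
Let mscaleDl v : {morph mscale^~ v : a b / a + b}.
Proof. by move=> a b; apply: malg_inj; rewrite /= scalerDl. Qed.

HB.instance Definition _ :=
  GRing.Zmodule_isLmodule.Build R[i] malg mscaleA mscale1 mscaleDr mscaleDl.

Let mscaleAl (a : R[i]) (u v : malg) : a *: (u * v) = (a *: u) * v.
Proof. by apply: malg_inj. Qed.

HB.instance Definition _ := GRing.Lmodule_isLalgebra.Build R[i] malg mscaleAl.

Let mscaleAr (a : R[i]) (u v : malg) : a *: (u * v) = u * (a *: v).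
Proof.
apply: malg_inj; symmetry; exact: comp_scaler (mval_vna u).
Qed.

HB.instance Definition _ := GRing.Lalgebra_isAlgebra.Build R[i] malg mscaleAr.

Definition mtr (a : malg) : R[i] := trace M (mval a).

Let mtr_scalar : scalar mtr.
Proof.
move=> a u v; exact: trace_lin (mval_vna u) (mval_vna v).
Qed.

HB.instance Definition _ := GRing.isLinear.Build R[i] malg R[i] *%R mtr mtr_scalar.

Lemma mtr1 : mtr 1 = 1.
Proof. exact: state_unit (traceP M). Qed.

Lemma mtrC a b : mtr (a * b) = mtr (b * a).
Proof. exact: (state_tracial (traceP M) (mval_vna a) (mval_vna b)). Qed.

Lemma mvalM a b : mval (a * b) = mval a \o mval b.
Proof. by []. Qed.

Lemma mvalD a b : mval (a + b) = mval a + mval b.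
Proof. by []. Qed.

Lemma mvalZ c a : mval (c *: a) = c *: mval a.
Proof. by []. Qed.

Lemma mval1 : mval 1 = idfun.
Proof. by []. Qed.

End TracialAlgebra.

(** * Schwinger-Dyson equations for semicircular families *)

Section Freeness.
Variables (R : realType) (M : tracial_vna R).

Lemma free_algebrasP (I : eqType) (A : I -> set (op M)) :
  free_algebras A ->
  forall l : seq (I * malg M),
    centred_alt (@mtr R M) (fun c a => A c (mval a)) l -> l != [::] ->
    mtr (lev l) = 0.
Proof.
move=> fA [//|[c0 a0] l'] + _; set l := _ :: l' => /andP[sl al].
have := fA (size l') (fun j => nth c0 (unzip1 l) j)
  (fun j => mval (nth (c0, a0) l j).2).
rewrite -[(size l').+1]/(size l).
rewrite -(big_morph (@mval R M) (@mvalM R M) (@mval1 R M)).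
rewrite -(big_nth (c0, a0) xpredT (fun ca : I * malg M => ca.2)).
apply.
- move=> j jl; have jl' : (j < size l)%N by [].
  have /allP/(_ _ (mem_nth (c0, a0) jl')) := al.
  by rewrite (nth_map (c0, a0)) // => /andP[/asboolP ? /eqP].
- move=> j jl; have /(sortedP c0)/(_ j) := sl.
  by rewrite size_map => /(_ jl)/eqP.
Qed.

Lemma mval_expr (a : malg M) k :
  mval (a ^+ k) = iter k (fun T => mval a \o T) idfun.
Proof. by elim: k => [|k IH]; [|rewrite exprS mvalM IH]. Qed.

Section OneVariable.
Variable s : malg M.
Hypothesis s_sc : semicircular (mval s).

Let mE k : mtr (s ^+ k) = (semicircle_moment R k)%:C.
Proof. by have [_ _ h] := s_sc; rewrite /mtr mval_expr h. Qed.

Let m_rec j : j.+3%:R * mtr (s ^+ j.+1) = 4 * j%:R * mtr (s ^+ j.-1).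
Proof.
rewrite !mE -[j.+3%:R](rmorph_nat (real_complex R)) -rmorphM /=.
rewrite semicircle_moment_rec !rmorphM /=.
by rewrite !rmorph_nat.
Qed.

Lemma semicircular_mean : mtr s = 0.
Proof.
have := m_rec 0; rewrite mulr0 mul0r expr1 => /eqP.
by rewrite mulf_eq0 pnatr_eq0 => /eqP.
Qed.

Lemma semicircular_catalan k :
  mtr (s * s ^+ k) = \sum_(j < k) mtr (s ^+ j) * mtr (s ^+ (k.-1 - j)%N).
Proof.
by rewrite -exprS; exact: (@catalan_conv _ (fun k => mtr (s ^+ k)) (mtr1 M) m_rec).
Qed.

End OneVariable.

Lemma wev_nseq (L : eqType) (ev : L -> malg M) i k :
  wev ev (nseq k i) = ev i ^+ k.
Proof. by elim: k => [|k IH]; rewrite ?wev_nil // /= wev_cons IH exprS. Qed.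

Lemma dword_nseq (L : eqType) (ev : L -> malg M) i k u v :
  dword (@mtr R M) ev (pred1 i) (nseq k i) u v =
  \sum_(j < k) mtr (u * ev i ^+ j) * mtr (ev i ^+ (k.-1 - j)%N * v).
Proof.
elim: k u => [|k IH] u /=; first by rewrite big_ord0.
rewrite eqxx big_ord_recl IH wev_nseq subn0 mulr1; congr (_ + _).
apply: eq_bigr => j _; rewrite lift0 exprS mulrA /=.
by rewrite subnS predn_sub.
Qed.

Variables (N : nat) (Sc : 'I_N -> malg M) (Y : 'I_N -> malg M).
Hypothesis sc : forall i, semicircular (mval (Sc i)).
Hypothesis freeS : free_elements (fun i => mval (Sc i)).
Hypothesis freeY : free_sets (range (fun i => mval (Sc i))) (range (fun i => mval (Y i))).

Let alg_closed (G : set (op M)) :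
  [/\ alg_gen G (mval (1 : malg M)),
   (forall (a : R[i]) (u v : malg M), alg_gen G (mval u) -> alg_gen G (mval v) ->
      alg_gen G (mval (a *: u + v))) &
   (forall u v : malg M, alg_gen G (mval u) -> alg_gen G (mval v) ->
      alg_gen G (mval (u * v)))].
Proof.
have [h1 h2 h3] := alg_genP G; split => //.
- by move=> a u v; apply: h2.
- by move=> u v; apply: h3.
Qed.

(** For words in a single semicircular this is the Catalan recursion of its moments; freeness within
    the family does the rest. *)
Let SD_semicirculars i (w : seq 'I_N) :
  mtr (Sc i * wev Sc w) = dword (@mtr R M) Sc (pred1 i) w 1 1.
Proof.
apply: (@free_extension _ _ (@mtr R M) _ Sc (pred1 i) _ id i
  (fun c a => alg_gen [set mval (Sc c)] (mval a))).
- exact: mtr1.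
- by move=> c; have [] := alg_closed [set mval (Sc c)].
- by move=> c; have [] := alg_closed [set mval (Sc c)].
- by move=> c; have [] := alg_closed [set mval (Sc c)].
- by move=> x; exact: sub_alg_gen.
- exact: (free_algebrasP freeS).
- exact: sub_alg_gen.
- exact: semicircular_mean.
- by move=> x /eqP.
- move=> v vi; have [k ->] : exists k, v = nseq k i.
    by exists (size v); apply/all_pred1P.
  rewrite [RHS]dword_nseq wev_nseq [LHS](semicircular_catalan (sc i)).
  by apply: eq_bigr => j _; rewrite mul1r mulr1.
Qed.

(** A second use of freeness, now between the semicirculars and Y. Words in the semicirculars alone
    are the base case. *)
Lemma semicircular_schwinger_dyson : schwinger_dyson (@mtr R M) Y Sc.
Proof.
move=> i w; pose G (b : bool) :=
  if b then range (fun i => mval (Sc i)) else range (fun i => mval (Y i)).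
apply: (@free_extension _ _ (@mtr R M) _ _ _ _ (fun x : 'I_N + 'I_N => is_inl x) true
  (fun b a => alg_gen (G b) (mval a))).
- exact: mtr1.
- by move=> b; case: (alg_closed (G b)).
- by move=> b; case: (alg_closed (G b)).
- by move=> b; case: (alg_closed (G b)).
- by move=> [j|j]; apply: sub_alg_gen; exists j.
- exact: (free_algebrasP freeY).
- by apply: sub_alg_gen; exists i.
- exact: semicircular_mean.
- by case.
- move=> v vi; have [v' ->] : exists v', v = [seq inl x | x <- v'].
    elim: v vi => [|[x|x] v IH] //=; first by exists [::].
    by move=> /IH[v' ->]; exists (x :: v').
  have dE u u' : dword (@mtr R M) (mixed Y Sc) (mixed_hit i) [seq inl x | x <- v'] u u' =
      dword (@mtr R M) Sc (pred1 i) v' u u'.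
    by elim: (v') u => [//|x z IH] u /=; rewrite IH /wev big_map.
  by rewrite dE -SD_semicirculars /wev big_map.
Qed.

End Freeness.

(** * Noncommutative polynomials as formal combinations of words *)

Section WordCombinations.
Variables (R : realType) (M : tracial_vna R) (L : Type) (ev : L -> malg M).
Local Notation combo := (seq (R[i] * seq L)).
Local Notation fev := (fev ev).

Lemma fev_nil : fev [::] = 0.
Proof. exact: big_nil. Qed.

Lemma fev_cons c w p : fev ((c, w) :: p) = c *: wev ev w + fev p.
Proof. exact: big_cons. Qed.

Lemma fev_cat p q : fev (p ++ q) = fev p + fev q.
Proof. exact: big_cat. Qed.

Definition fscale c (p : combo) : combo := [seq (c * cw.1, cw.2) | cw <- p].

Lemma fev_scale c p : fev (fscale c p) = c *: fev p.
Proof.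
rewrite /fev big_map scaler_sumr; apply: eq_bigr => cw _.
by rewrite scalerA.
Qed.

Definition fmul (p q : combo) : combo :=
  [seq (cw.1 * dv.1, cw.2 ++ dv.2) | cw <- p, dv <- q].

Lemma fev_mul p q : fev (fmul p q) = fev p * fev q.
Proof.
rewrite /fev /fmul big_allpairs_dep /= mulr_suml; apply: eq_bigr => cw _.
rewrite mulr_sumr; apply: eq_bigr => dv _ /=.
by rewrite wev_cat -scalerAl -scalerAr scalerA.
Qed.

Definition fin (P : pred L) (p : combo) : bool := all (fun cw => all P cw.2) p.

Lemma alg_gen_combo (P : pred L) T :
  alg_gen [set mval (ev x) | x in [set x | P x]] T ->
  exists2 p, fin P p & T = mval (fev p).
Proof.
apply: (@alg_gen_sub _ _ _ [set T | exists2 p, fin P p & T = mval (fev p)]).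
  split.
  - by exists [:: (1, [::])] => //; rewrite fev_cons fev_nil wev_nil scale1r addr0.
  - move=> a S U [p hp ->] [q hq ->]; exists (fscale a p ++ q).
      rewrite /fin all_cat; apply/andP; split => //.
      by rewrite all_map; apply: sub_all hp.
    by rewrite fev_cat fev_scale.
  - move=> S U [p hp ->] [q hq ->]; exists (fmul p q); last by rewrite fev_mul.
    elim: p hp => [//|cw p IH] /= /andP[hw hp].
    rewrite /fin /fmul /= all_cat; apply/andP; split; last exact: IH.
    by rewrite all_map; apply: sub_all hq => dv /= hd; rewrite all_cat hw.
by move=> _ [x Px <-]; exists [:: (1, [:: x])];
  rewrite ?fev_cons ?fev_nil ?wev_cons ?wev_nil ?scale1r ?addr0 ?mulr1 //= /fin /= Px.
Qed.

Lemma alg_gen_word (G : set (op M)) w :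
  (forall x, G (mval (ev x))) -> alg_gen G (mval (wev ev w)).
Proof.
move=> hG; have [h1 _ h3] := alg_genP G.
elim: w => [|x w IH]; first by rewrite wev_nil.
by rewrite wev_cons mvalM; apply: h3 => //; apply: sub_alg_gen.
Qed.

Lemma combo_alg_gen (G : set (op M)) p :
  (forall x, G (mval (ev x))) -> alg_gen G (mval (fev p)).
Proof.
move=> hG; have [h1 h2 h3] := alg_genP G.
elim: p => [|[c w] p IH].
  rewrite fev_nil (_ : mval 0 = -1 *: idfun + idfun :> op M); first exact: h2.
  by rewrite scaleN1r addNr.
by rewrite fev_cons mvalD mvalZ; apply: h2 => //; apply: alg_gen_word.
Qed.

Lemma cvg_combo (P : pred L) (F : nat -> malg M -> R[i]) (G : malg M -> R[i]) :
  (forall k a u v, F k (a *: u + v) = a * F k u + F k v) ->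
  (forall a u v, G (a *: u + v) = a * G u + G v) ->
  (forall w, all P w -> cvgC (F^~ (wev ev w)) (G (wev ev w))) ->
  forall p, fin P p -> cvgC (F^~ (fev p)) (G (fev p)).
Proof.
move=> Fl Gl Fw; elim=> [|[c w] p IH] /=.
  have F0 k : F k 0 = 0.
    by rewrite -(addNr 1) -scaleN1r Fl mulN1r addNr.
  have G0 : G 0 = 0 by rewrite -(addNr 1) -scaleN1r Gl mulN1r addNr.
  by rewrite fev_nil G0 => _; under eq_fun do rewrite F0; exact: cvgC_cst.
move=> /andP[hw hp]; rewrite fev_cons Gl.
under eq_fun do rewrite Fl.
by apply: cvgC_lin; [exact: Fw | exact: IH].
Qed.

End WordCombinations.

(** * Conjugate variables and free Fisher information *)

Section ConjugateVariable.
Variables (R : realType) (M : tracial_vna R) (N : nat) (Z : 'I_N -> malg M).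
Hypothesis Z_sa : forall i, selfadjoint (mval (Z i)).
Local Notation zop := (fun i => mval (Z i)).
Local Notation tau := (@mtr R M).
Local Notation mu := (fun w => mtr (wev Z w)).
Local Notation combo := (seq (R[i] * seq 'I_N)).

Definition zalg : set (op M) := alg_gen (range zop).

Lemma zalg_vna : zalg `<=` vna M.
Proof.
apply: alg_gen_sub; first exact: M_alg.
by move=> _ [i _ <-]; exact: mval_vna.
Qed.

Lemma zalg_comboP T : zalg T <-> exists p, T = mval (fev Z p).
Proof.
split=> [|[p ->]]; last by apply: combo_alg_gen => i; exists i.
have -> : zalg = alg_gen [set mval (Z x) | x in [set x | xpredT x]].
  by congr alg_gen; apply/seteqP; split => _ [i _ <-]; exists i.
by move=> /alg_gen_combo[p _ ->]; exists p.
Qed.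

Lemma zalg_adj : adjoint_closed zalg.
Proof.
apply: alg_gen_adj => _ [i _ <-]; exists (zop i); first by exists i.
exact: Z_sa.
Qed.

Lemma zalg_full i : alg_gen (alg_others zop i `|` [set zop i]) = zalg.
Proof.
apply/seteqP; split.
  apply: alg_gen_sub; first exact: alg_genP.
  move=> T [|->]; last by apply: sub_alg_gen; exists i.
  apply: alg_gen_sub; first exact: alg_genP.
  by move=> _ [j _ <-]; apply: sub_alg_gen; exists j.
apply: alg_gen_sub; first exact: alg_genP.
move=> _ [j _ <-]; apply: sub_alg_gen.
have [->|ji] := eqVneq j i; [by right | left].
by apply: sub_alg_gen; exists j.
Qed.

Fixpoint altm (z : malg M) (b : nat -> malg M) (i k : nat) : malg M :=
  if k is k'.+1 then b i * z * altm z b i.+1 k' else b i.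

Lemma altm_val z b i k :
  mval (altm z b i k) = altword (mval z) (fun j => mval (b j)) i k.
Proof.
by elim: k i => [//|k IH] i; rewrite [altm _ _ _ _]/(_ * _) !mvalM IH.
Qed.

Let altw (i0 : 'I_N) (b : nat -> seq 'I_N) : nat -> nat -> seq 'I_N :=
  fix altw i k := if k is k'.+1 then b i ++ i0 :: altw i.+1 k' else b i.

Let altw_wev i0 b i k :
  wev Z (altw i0 b i k) = altm (Z i0) (fun j => wev Z (b j)) i k.
Proof.
elim: k i => [//|k IH] i /=.
by rewrite wev_cat wev_cons IH mulrA.
Qed.

Let altw_shift i0 b b' i i' k : (forall j, b (i + j)%N = b' (i' + j)%N) ->
  altw i0 b i k = altw i0 b' i' k.
Proof.
elim: k i i' => [|k IH] i i' h /=; first by have := h 0%N; rewrite !addn0.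
rewrite (IH i.+1 i'.+1) => [|j]; last by rewrite !addSnnS.
by have := h 0%N; rewrite !addn0 => ->.
Qed.

(** Cut w at its occurrences of i0; each occurrence gives one term of the defining relation of a
    conjugate variable. With j counted from 0, the right factor starts at b (j + 1) and still
    contains m - 1 - j letters i0. *)
Let word_split i0 w : exists m b, [/\ forall k, all (fun x => x != i0) (b k),
  w = altw i0 b 0 m &
  forall pre, ell mu i0 pre w =
    \sum_(j < m) mu (pre ++ altw i0 b 0 j) * mu (altw i0 b j.+1 (m.-1 - j))].
Proof.
elim: w => [|x w [m [b [hb wE lE]]]].
  by exists 0%N, (fun=> [::]); split=> // pre; rewrite big_ord0.
have [xi|xi] := eqVneq x i0.
  exists m.+1, (fun k => if k is k'.+1 then b k' else [::]); split.
  - by case.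
  - by rewrite /= xi wE; congr (_ :: _); apply: altw_shift => j; rewrite add1n add0n.
  - move=> pre; rewrite [LHS]/= xi eqxx big_ord_recl /= cats0 subn0 lE wE.
    congr (_ + _).
      by congr (_ * mu _); apply: altw_shift => j; rewrite add1n add0n.
    apply: eq_bigr => j _; rewrite -cats1 -catA /bump leq0n add1n /=; congr (mu (_ ++ _ :: _) * mu _).
      by apply: altw_shift => k; rewrite add1n add0n.
    rewrite subnS predn_sub; apply: altw_shift => k.
    by rewrite addSn.
exists m, (fun k => if k is 0%N then x :: b 0%N else b k); split.
- by case=> [|k] /=; rewrite ?xi ?hb.
- by case: m wE lE => [|m] wE lE; rewrite wE //=; congr (_ :: _ ++ _ :: _);
    apply: altw_shift => j; rewrite add1n.
- move=> pre; rewrite [LHS]/= (negbTE xi) add0r lE; apply: eq_bigr => j _.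
  congr (mu _ * mu _); last by apply: altw_shift => k; rewrite addSn.
  rewrite cat_rcons; congr (_ ++ _).
  by case: (val j) => [//|k] /=; congr (_ :: _ ++ _ :: _);
    apply: altw_shift => l; rewrite add1n.
Qed.

Let score_target i (b : nat -> malg M) m : R[i] :=
  \sum_(1 <= j < m.+1) tau (altm (Z i) b 0 j.-1) * tau (altm (Z i) b j (m - j)).

Let score_targetE i b m : score_target i b m =
  \sum_(j < m) tau (altm (Z i) b 0 j) * tau (altm (Z i) b j.+1 (m.-1 - j)).
Proof.
rewrite /score_target big_add1 big_mkord; apply: eq_bigr => j _ /=.
by rewrite subnS predn_sub.
Qed.

(** Reduces the relation for arbitrary coefficients in the algebra of the other variables to a
    relation on words, hence on moments. *)
Lemma conj_relation_words (x : nat -> malg M) i :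
  (forall m (b : nat -> op M), (forall k, alg_others zop i (b k)) ->
    cvgC (fun k => trace M (mval (x k) \o altword (zop i) b 0 m))
      (\sum_(1 <= j < m.+1)
         trace M (altword (zop i) b 0 j.-1) *
         trace M (altword (zop i) b j (m - j)))) <->
  (forall w, cvgC (fun k => tau (x k * wev Z w)) (ell mu i [::] w)).
Proof.
split=> h.
  move=> w; have [m [b [hb wE lE]]] := word_split i w.
  have := h m (fun k => mval (wev Z (b k))).
  have alg_b k : alg_others zop i (mval (wev Z (b k))).
    elim: (b k) (hb k) => [|y v IH] /=.
      by rewrite wev_nil; have [] := alg_genP [set zop j | j in [set j | j != i]].
    move=> /andP[yi /IH hv]; rewrite wev_cons mvalM.
    have [_ _ hM] := alg_genP [set zop j | j in [set j | j != i]].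
    by apply: hM => //; apply: sub_alg_gen; exists y.
  move=> /(_ alg_b); rewrite -altm_val -altw_wev -wE.
  congr (cvgC _ _); rewrite lE.
  transitivity (score_target i (fun k => wev Z (b k)) m).
    by apply: eq_bigr => j _; rewrite -!altm_val.
  rewrite score_targetE; apply: eq_bigr => j _.
  by rewrite -!altw_wev.
move=> m b hb.
have ex k : exists q : combo, fin (predC1 i) q /\ b k = mval (fev Z q).
  by have [q hq bq] := alg_gen_combo (hb k); exists q.
have [p pP] := boolp.choice ex.
pose bm k := fev Z (p k).
have -> : b = fun k => mval (bm k) by apply/funext => k; rewrite (pP k).2.
have -> : \sum_(1 <= j < m.+1)
         trace M (altword (zop i) (fun k => mval (bm k)) 0 j.-1) *
         trace M (altword (zop i) (fun k => mval (bm k)) j (m - j)) =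
     score_target i bm m.
  by apply: eq_bigr => j _; rewrite -!altm_val.
rewrite -altm_val score_targetE.
pose dw := dword tau Z (pred1 i).
(* The coefficients b are expanded into words one after the other: [pre] is the part already
   expanded, whose occurrences of i are counted by [dw], and the sum counts those in the tail. *)
suff key k i0 pre : cvgC (fun n => tau (x n * (wev Z pre * altm (Z i) bm i0 k)))
    (dw pre 1 (altm (Z i) bm i0 k) +
     \sum_(j < k) tau (wev Z pre * altm (Z i) bm i0 j) *
        tau (altm (Z i) bm (i0 + j).+1 (k.-1 - j))).
  have := key m 0%N [::]; rewrite wev_nil mul1r /= add0r.
  by under [X in cvgC _ X]eq_bigr do rewrite mul1r add0n.
have hw w : cvgC (fun n => tau (x n * wev Z w)) (dw w 1 1).
  have := h w; rewrite /dw; congr (cvgC _ _).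
  suff g v pr : ell mu i pr v = dw v (wev Z pr) 1 by rewrite g wev_nil.
  elim: v pr => [//|y v IH] pr /=.
  by rewrite /dw /= mulr1 IH wev_rcons.
have dw_lin w a u v : dw w 1 (a *: u + v) = a * dw w 1 u + dw w 1 v.
  exact: dword_linr.
elim: k i0 pre => [|k IHk] i0 pre.
  rewrite big_ord0 addr0 /=.
  apply: (cvg_combo (F := fun n a => tau (x n * (wev Z pre * a)))
      (G := fun a => dw pre 1 a) (P := predC1 i)) => [n a u v|a u v|w wi|].
  - by rewrite mulrDr -scalerAr mulrDr -scalerAr tau_lin.
  - exact: dw_lin.
  - have := hw (pre ++ w); rewrite wev_cat; congr (cvgC _ _).
    rewrite /dw dword_cat mulr1 [X in _ + X]dword_nohit ?addr0 //.
  - exact: (pP i0).1.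
set A := altm (Z i) bm i0.+1 k.
rewrite big_ord_recl /= addn0 subn0 -/A.
pose G (a : malg M) := dw pre 1 (a * Z i * A) + (tau (wev Z pre * a) * tau A +
  \sum_(j < k) tau (wev Z pre * (a * Z i * altm (Z i) bm i0.+1 j)) *
        tau (altm (Z i) bm (i0.+1 + j).+1 (k.-1 - j))).
have -> : dw pre 1 (bm i0 * Z i * A) + (tau (wev Z pre * bm i0) * tau A +
   \sum_(j < k) tau (wev Z pre * altm (Z i) bm i0 (bump 0 j)) *
        tau (altm (Z i) bm (i0 + bump 0 j).+1 (k - bump 0 j))) = G (bm i0).
  rewrite /G; congr (_ + (_ + _)); apply: eq_bigr => j _.
  rewrite /bump leq0n add1n /= addnS addSn.
  by rewrite subnS predn_sub.
apply: (cvg_combo (F := fun n a => tau (x n * (wev Z pre * (a * Z i * A))))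
      (G := G) (P := predC1 i)) => [n a u v|a u v|w wi|].
- by rewrite !mulrDl mulrDr mulrDr -!scalerAl -!scalerAr tau_lin.
- rewrite /G !mulrDl !mulrDr -!scalerAl -!scalerAr dw_lin tau_lin.
  rewrite (eq_bigr (fun j : 'I_k => a * (tau (wev Z pre * (u * Z i * altm (Z i) bm i0.+1 j)) *
        tau (altm (Z i) bm (i0.+1 + j).+1 (k.-1 - j))) +
     tau (wev Z pre * (v * Z i * altm (Z i) bm i0.+1 j)) *
        tau (altm (Z i) bm (i0.+1 + j).+1 (k.-1 - j)))); last first.
    move=> j _; rewrite !mulrDl mulrDr -!scalerAl -scalerAr tau_lin; ring.
  by rewrite big_split /= -mulr_sumr; ring.
- have := IHk i0.+1 (pre ++ rcons w i); rewrite wev_cat wev_rcons.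
  congr (cvgC _ _).
  rewrite /G /dw dword_cat dword_rcons /= eqxx wev_rcons.
  rewrite [X in _ + (X + _) + _]dword_nohit // add0r mul1r.
  by rewrite -addrA; congr (_ + (_ + _)).
- exact: (pP i0).1.
Qed.

End ConjugateVariable.

Lemma traceB (R : realType) (M : tracial_vna R) (S T : op M) :
  vna M S -> vna M T -> trace M (S - T) = trace M S - trace M T.
Proof. by move=> MS MT; rewrite addrC -scaleN1r trace_lin // mulN1r addrC. Qed.

(** * Scores and the norm of the conjugate variable *)

Section Scores.
Variables (R : realType) (M : tracial_vna R) (N : nat) (Z : 'I_N -> malg M).
Hypothesis Z_sa : forall i, selfadjoint (mval (Z i)).
Local Notation zop := (fun i => mval (Z i)).
Local Notation tau := (@mtr R M).
Local Notation mu := (fun w => mtr (wev Z w)).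
Local Notation combo := (seq (R[i] * seq 'I_N)).
Local Notation zalg := (zalg Z).
Local Notation W := (vna_gen zalg).

(** S0 may lie outside W^*(Z), as a multiple of a semicircular element does; the conjugate variable
    is then its projection. *)
Definition is_score i (S0 : malg M) : Prop :=
  forall w, tau (S0 * wev Z w) = ell mu i [::] w.

(* For a score S of the i-th variable, the norm of the conjugate variable is
   the norm of the functional tau(S .) on C[Z]. *)
Definition least_bound (S0 : malg M) (l : R) : Prop :=
  [/\ 0 <= l,
      forall p : combo, Normc.normc (tau (S0 * fev Z p)) <= l * norm2 (mval (fev Z p)) &
      forall B, (forall p : combo,
        Normc.normc (tau (S0 * fev Z p)) <= B * norm2 (mval (fev Z p))) -> l <= B].

Lemma least_bound_unique S0 l l' : least_bound S0 l -> least_bound S0 l' -> l = l'.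
Proof.
move=> [_ b1 l1] [_ b2 l2]; apply/eqP; rewrite eq_le.
by apply/andP; split; [exact: l1 | exact: l2].
Qed.

Lemma zalg_alg : unital_subalgebra zalg.
Proof. exact: alg_genP. Qed.

Lemma zalg_approx T (e : R) : W T -> 0 < e ->
  vna M T /\ exists2 B, zalg B & norm2 (T - B) <= e.
Proof.
apply: vna_gen_density; [exact: zalg_alg | exact: zalg_vna | exact: zalg_adj].
Qed.

Lemma norm2_adj T : vna M T -> norm2 (adj T) = norm2 T.
Proof.
move=> MT; rewrite !norm2E /tform adjK //.
by rewrite (state_tracial (traceP M)) //; exact: M_adj.
Qed.

Lemma adj_zalg T : zalg T -> zalg (adj T).
Proof. by move=> /(zalg_adj Z_sa)[T' hT' /adjP ->]. Qed.

(** Approximate Riesz representation of tau(S0 .) inside C[Z] yields a Cauchy sequence representing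
    the projection of S0. *)
Lemma score_conj_exists i S0 : is_score i S0 ->
  exists xi, is_conjugate_variable (zop i) (alg_others zop i) xi.
Proof.
move=> hS; have pre := tform_preform M.
have D_M := @zalg_vna _ _ _ Z; have [D1 Dlin Dmul] := zalg_alg.
set T := mval S0; have MT : vna M T := mval_vna S0.
have [u [Du uP]] : exists u : nat -> op M, (forall k, zalg (u k)) /\
    forall k v, zalg v -> `|tform (u k) v - tform T v| <= k.+1%:R^-1 * norm2 v.
  apply: (preform_riesz pre (B := norm2 T)) => //.
  - by exists idfun.
  - by move=> r v w; exact: (Dlin r%:C).
  - move=> r v w /D_M Mv /D_M Mw.
    have Mrv : vna M (r%:C *: v) by apply: M_scale.
    rewrite (preformC pre MT (M_add Mrv Mw)) (preformD pre Mrv Mw MT) (preformZ pre r Mv MT).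
    by rewrite !(preformC pre MT).
  - by move=> v /D_M Mv; exact: (preform_CS pre MT Mv).
have Mu k : vna M (u k) by apply: D_M.
have Dsub v w : zalg v -> zalg w -> zalg (v - w).
  by move=> hv hw; rewrite addrC -scaleN1r; apply: Dlin.
have uC := preform_riesz_cauchy pre D_M Dsub Du uP.
exists u; split.
  rewrite zalg_full; split=> [k|]; first by apply: sub_vna_gen; apply: Du.
  exact: uC.
pose x k := mk (Mu k).
apply/(@conj_relation_words _ _ _ Z x i) => w; rewrite -hS.
have hw : zalg (mval (wev Z w)) by apply: alg_gen_word => j; exists j.
apply: (@cvgC_squeeze _ _ _ (fun k => k.+1%:R^-1 * norm2 (mval (wev Z w)))); last first.
  by rewrite -[X in _ --> X](mul0r (norm2 (mval (wev Z w)))); apply: cvgMl; exact: cvg_harmonic.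
(* The form [tform] sees only real parts, so the difference is first rotated onto the positive axis.
   The adjoint of P appears because [tform] takes the adjoint of its second argument. *)
move=> k; have [c c1 cE] := normc_phase (tau (x k * wev Z w) - tau (S0 * wev Z w)).
rewrite -cE.
set P := c *: mval (wev Z w).
have z0 : zalg 0 by rewrite -(addNr idfun) -scaleN1r; exact: Dlin.
have hP : zalg P by rewrite /P -[c *: _]addr0; exact: Dlin.
have MP := D_M _ hP; have hP' := adj_zalg hP.
have -> : complex.Re (c * (tau (x k * wev Z w) - tau (S0 * wev Z w))) =
    tform (u k) (adj P) - tform T (adj P).
  have trE U : vna M U -> tform U (adj P) = complex.Re (c * trace M (U \o mval (wev Z w))).
    move=> MU; rewrite /tform adjK // (state_tracial (traceP M)) //.
    by rewrite comp_scaler // traceZ //; apply: M_comp => //; exact: mval_vna.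
  by rewrite !trE // mulrBr ReB.
rewrite (le_trans (ler_norm _)) // (le_trans (uP k _ hP')) //.
by rewrite norm2_adj // norm2Z ?c1 ?mul1r //; exact: mval_vna.
Qed.

Section ConjugateNorm.
Variables (i : 'I_N) (S0 : malg M) (xi : nat -> op M).
Hypothesis S0_score : is_score i S0.
Hypothesis xi_conj : is_conjugate_variable (zop i) (alg_others zop i) xi.

Let xiW k : W (xi k).
Proof. by have [] := xi_conj; rewrite zalg_full => -[h _] _; apply: h. Qed.

Let Mxi k : vna M (xi k).
Proof. by have [] := zalg_approx (xiW k) ltr01. Qed.

Let xi_cauchy (e : R) : 0 < e -> exists n : nat, forall k l : nat,
  (n <= k)%N -> (n <= l)%N -> norm2 (xi k - xi l) < e.
Proof. by have [[_ h] _] := xi_conj; apply: h. Qed.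

Lemma conj_norm_cvg : (fun k => norm2 (xi k)) @ \oo --> L2_norm xi.
Proof.
apply/cauchy_cvgP/cauchy_exP => e e0; have [n nP] := xi_cauchy e0.
exists (norm2 (xi n)); exists n => // k /= nk.
by apply: le_lt_trans (nP n k (leqnn _) nk); apply: norm2_dist.
Qed.

Let xi_score p : cvgC (fun k => trace M (xi k \o mval (fev Z p))) (tau (S0 * fev Z p)).
Proof.
pose x k := mk (Mxi k).
apply: (cvg_combo (ev := Z) (F := fun k a => tau (x k * a)) (G := fun a => tau (S0 * a))
  (P := predT)) => [k a u v|a u v|w _|].
- by rewrite mulrDr -scalerAr tau_lin.
- by rewrite mulrDr -scalerAr tau_lin.
- rewrite S0_score.
  exact: (proj1 (@conj_relation_words _ _ _ Z x i) (proj2 xi_conj) w).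
- by apply/allP => cw _; exact: all_predT.
Qed.

(** Cauchy-Schwarz along the sequence gives the bound. For leastness, xi is approximated by a
    polynomial, against whose adjoint the functional nearly attains the norm. *)
Lemma conj_norm_least_bound : least_bound S0 (L2_norm xi).
Proof.
have nc := conj_norm_cvg.
have n0 : 0 <= L2_norm xi.
  by apply: limr_ge; [exact: (cvgP _ nc) | apply: nearW => k; exact: norm2_ge0].
split=> // [p|B hB].
  have h1 := cvgC_normc (xi_score p).
  have h2 : (fun k => norm2 (xi k) * norm2 (mval (fev Z p))) @ \oo -->
      L2_norm xi * norm2 (mval (fev Z p)) by apply: cvgMl.
  apply: (ler_cvg_to h1 h2); apply: nearW => k.
  exact: trace_CS (Mxi k) (mval_vna _).
have B_ge0 : 0 <= B.
  have := hB [:: (1, [::])]; rewrite fev_cons fev_nil wev_nil scale1r addr0.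
  have -> : norm2 (mval (1 : malg M)) = 1.
    by rewrite norm2E /tform mval1 (adjP (@is_adjoint_id _ M)) (state_unit (traceP M)) sqrtr1.
  by rewrite mulr1; apply: le_trans; exact: normc_ge0.
apply/ler_addgt0Pr => e e0; have e4 : 0 < e / 4 by rewrite divr_gt0.
have [n nP] := xi_cauchy e4.
have [_ [B0 hB0 hn]] := zalg_approx (xiW n) e4.
have MB0 := zalg_vna hB0; have MB0' := M_adj MB0.
(* The pairing of B0 with its adjoint is |B0|^2, while that of xi k is at most B |B0| in the limit.
   As xi k is within e / 2 of B0, this forces |B0| <= B + e / 2. *)
have /zalg_comboP[p pE] := adj_zalg hB0.
set P := fev Z p in pE; have nP0 : norm2 (mval P) = norm2 B0.
  by rewrite -pE norm2_adj.
have close k : (n <= k)%N -> norm2 (xi k - B0) <= e / 2.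
  move=> nk; rewrite (_ : xi k - B0 = (xi k - xi n) + (xi n - B0)); last by rewrite addrA subrK.
  rewrite (le_trans (norm2D (M_sub (Mxi _) (Mxi _)) (M_sub (Mxi _) MB0))) //.
  rewrite (_ : e / 2 = e / 4 + e / 4); last by field.
  by rewrite lerD // ltW // nP.
have B0P : norm2 B0 ^+ 2 = Normc.normc (trace M (B0 \o mval P)).
  rewrite norm2_sqr // -pE /tform (state_tracial (traceP M)) //.
  have := state_pos (traceP M) MB0'; rewrite adjK // lecE => /andP[/eqP h1 h2].
  move: h1 h2; case: (trace M _) => a b /= -> a0.
  by rewrite expr0n addr0 sqrtr_sqr ger0_norm.
have key : norm2 B0 ^+ 2 <= (B + e / 2) * norm2 B0.
  rewrite mulrDl.
  have h1 := cvgC_normc (xi_score p).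
  have h2 : (fun k => Normc.normc (trace M (xi k \o mval P)) + e / 2 * norm2 B0) @ \oo -->
      Normc.normc (tau (S0 * P)) + e / 2 * norm2 B0 by apply: cvgD => //; exact: cvg_cst.
  apply: (@le_trans _ _ (Normc.normc (tau (S0 * P)) + e / 2 * norm2 B0)); last first.
    by rewrite lerD2r -nP0 hB.
  rewrite -(cvg_lim (@norm_hausdorff _ R) h2).
  apply: limr_ge; first exact: (cvgP _ h2).
  exists n => // k /= nk; rewrite B0P.
  have -> : B0 \o mval P = (xi k \o mval P) - ((xi k - B0) \o mval P).
    apply/funext => u; rewrite /= [RHS](_ : _ = xi k (mval P u) - (xi k (mval P u) - B0 (mval P u))) //.
    by rewrite subKr.
  have MP := mval_vna P; have MD := M_sub (Mxi k) MB0.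
  rewrite (traceB (M_comp (Mxi k) MP) (M_comp MD MP)).
  rewrite (le_trans (normcD _ _)) // lerD2l normcNE.
  rewrite (le_trans (trace_CS MD MP)) // nP0.
  by rewrite ler_wpM2r ?norm2_ge0 // close.
have B0le : norm2 B0 <= B + e / 2.
  have [z0|z0] := eqVneq (norm2 B0) 0.
    by rewrite z0 addr_ge0 // divr_ge0 // ltW.
  have zp0 : 0 < norm2 B0 by rewrite lt_def z0 norm2_ge0.
  by move: key; rewrite expr2 ler_pM2r.
rewrite -(cvg_lim (@norm_hausdorff _ R) nc).
apply: limr_le; first exact: (cvgP _ nc).
exists n => // k /= nk.
rewrite -[xi k](subrK B0) (le_trans (norm2D (M_sub (Mxi _) MB0) MB0)) //.
rewrite [X in _ <= B + X]splitr addrCA lerD //.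
exact: close.
Qed.

End ConjugateNorm.

(** Whichever representative [conjugate_variable] selects, its norm is the least bound of the
    score. *)
Lemma fisher_least_bounds (S0 : 'I_N -> malg M) : (forall i, is_score i (S0 i)) ->
  exists2 l : 'I_N -> R, forall i, least_bound (S0 i) (l i) &
    fisher zop = (\sum_i l i ^+ 2)%:E.
Proof.
move=> hS.
have ex i := score_conj_exists (hS i).
exists (fun i => L2_norm (conjugate_variable (zop i) (alg_others zop i))).
  move=> i; apply: (@conj_norm_least_bound i) => //.
  rewrite /conjugate_variable; have [xi hxi] := ex i.
  by case: xgetP => [x _ //|/(_ xi)].
by rewrite /fisher asboolT.
Qed.

Lemma tau_fev p : tau (fev Z p) = \sum_(cw <- p) cw.1 * mu cw.2.
Proof.
elim: p => [|[c w] p IH]; first by rewrite fev_nil linear0 big_nil.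
by rewrite fev_cons big_cons -IH; exact: tau_lin.
Qed.

Lemma tau_score_fev i S0 p : is_score i S0 ->
  tau (S0 * fev Z p) = \sum_(cw <- p) cw.1 * ell mu i [::] cw.2.
Proof.
move=> hS; elim: p => [|[c w] p IH]; first by rewrite fev_nil mulr0 linear0 big_nil.
by rewrite fev_cons mulrDr -scalerAr big_cons -IH -hS; exact: tau_lin.
Qed.

Definition fadj (p : combo) : combo := [seq (Num.conj cw.1, rev cw.2) | cw <- p].

Lemma adj_wev w : adj (mval (wev Z w)) = mval (wev Z (rev w)).
Proof.
elim: w => [|x w IH]; first by rewrite wev_nil (adjP (@is_adjoint_id _ M)).
rewrite wev_cons mvalM adjM; try exact: mval_vna.
by rewrite IH (adj_selfadjoint (Z_sa x)) rev_cons wev_rcons.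
Qed.

Lemma adj_fev p : adj (mval (fev Z p)) = mval (fev Z (fadj p)).
Proof.
elim: p => [|[c w] p IH].
  by rewrite fev_nil; apply/adjP => u v; rewrite linear0l linear0r.
rewrite fev_cons mvalD mvalZ adj_lin; try exact: mval_vna.
by rewrite IH adj_wev /= fev_cons.
Qed.

(** The letters being selfadjoint, the adjoint of a word is its reversal, and the 2-norm of a
    polynomial becomes an expression in the moments of Z alone. *)
Lemma norm2_fev p : norm2 (mval (fev Z p)) =
  Num.sqrt (complex.Re (\sum_(cw <- fmul (fadj p) p) cw.1 * mu cw.2)).
Proof. by rewrite norm2E /tform adj_fev -tau_fev fev_mul. Qed.

End Scores.

Section LawInvariance.
Variables (R : realType) (M M' : tracial_vna R) (N : nat).
Variables (Z : 'I_N -> malg M) (Z' : 'I_N -> malg M').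
Hypothesis Z_sa : forall i, selfadjoint (mval (Z i)).
Hypothesis Z'_sa : forall i, selfadjoint (mval (Z' i)).
Hypothesis same_law : forall w, mtr (wev Z w) = mtr (wev Z' w).

Lemma least_bound_law i S0 S0' l : is_score Z i S0 -> is_score Z' i S0' ->
  least_bound Z S0 l -> least_bound Z' S0' l.
Proof.
move=> hS hS'.
have lawE : (fun w => mtr (wev Z w)) = (fun w => mtr (wev Z' w)) by apply/funext.
have nE p : norm2 (mval (fev Z p)) = norm2 (mval (fev Z' p)).
  rewrite !norm2_fev //; congr (Num.sqrt (complex.Re _)).
  by apply: eq_bigr => cw _; rewrite same_law.
have sE p : mtr (S0 * fev Z p) = mtr (S0' * fev Z' p).
  by rewrite (tau_score_fev p hS) (tau_score_fev p hS') lawE.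
move=> [l0 lb lmin]; split=> // [p|B hB]; first by rewrite -sE -nE.
by apply: lmin => p; rewrite sE nE.
Qed.

Lemma fisher_law S0 S0' : (forall i, is_score Z i (S0 i)) ->
  (forall i, is_score Z' i (S0' i)) ->
  fisher (fun i => mval (Z i)) = fisher (fun i => mval (Z' i)).
Proof.
move=> hS hS'; have [l hl ->] := fisher_least_bounds Z_sa hS.
have [l' hl' ->] := fisher_least_bounds Z'_sa hS'.
congr (_%:E); apply: eq_bigr => i _; congr (_ ^+ 2).
by apply: least_bound_unique (hl' i); apply: least_bound_law (hl i).
Qed.

End LawInvariance.

(** Polynomials in a subtuple are among those in the whole tuple, and fewer test vectors lower the
    least bound. *)
Lemma least_bound_sub (R : realType) (M : tracial_vna R) (n N : nat)
    (f : 'I_n -> 'I_N) (Z : 'I_N -> malg M) S0 l l' :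
  least_bound Z S0 l -> least_bound (Z \o f) S0 l' -> l' <= l.
Proof.
move=> [_ lb _] [_ _ l'min]; apply: l'min => p.
have -> : fev (Z \o f) p = fev Z [seq (cw.1, map f cw.2) | cw <- p].
  rewrite /fev big_map; apply: eq_bigr => cw _.
  by rewrite /wev big_map.
exact: lb.
Qed.

Lemma mtrZ (R : realType) (M : tracial_vna R) c (a : malg M) : mtr (c *: a) = c * mtr a.
Proof. exact: (traceZ c (mval_vna a)). Qed.

Lemma mtrD (R : realType) (M : tracial_vna R) (a b : malg M) :
  mtr (a + b) = mtr a + mtr b.
Proof. exact: (traceD (mval_vna a) (mval_vna b)). Qed.

(** * The perturbed tuple and bounds for its conjugate variables *)

Section Perturbation.
Variables (R : realType) (M : tracial_vna R) (N : nat) (Y : 'I_N -> op M).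
Hypothesis Y_in : forall i, vna M (Y i).
Hypothesis Y_sa : forall i, selfadjoint (Y i).
Variable E : semicircular_ext Y.
Local Notation tau := (@mtr R E).

Definition mvar i : malg M := mk (Y_in i).
Definition evar i : malg E := mk (emb_vna (ext_embP E) (Y_in i)).

Let sc_vna i : vna E (ext_sc E i).
Proof. by have [] := ext_scP E i. Qed.

Definition esc i : malg E := mk (sc_vna i).

Lemma ext_schwinger_dyson : schwinger_dyson tau evar esc.
Proof.
apply: semicircular_schwinger_dyson.
- exact: ext_scP.
- exact: ext_free.
- exact: ext_freeY.
Qed.

Definition epert (r : R) i : malg E := pert evar esc r%:C i.

Lemma evar_sa i : selfadjoint (mval (evar i)).
Proof.
have h := adjE (mval_vna (evar i)); move: h.
rewrite /= -(emb_adj (ext_embP E) (Y_in i)) (adj_selfadjoint (Y_sa i)).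
by [].
Qed.

Lemma esc_sa i : selfadjoint (mval (esc i)).
Proof. by have [] := ext_scP E i. Qed.

Lemma epert_sa r i : selfadjoint (mval (epert r i)).
Proof.
have := is_adjoint_lin r%:C (@esc_sa i) (@evar_sa i).
by rewrite conj_realC addrC.
Qed.

Lemma perturb_vna r i : vna E (perturb E r i).
Proof. exact: mval_vna (epert r i). Qed.

Lemma perturb_sa r i : selfadjoint (perturb E r i).
Proof. exact: epert_sa. Qed.

Lemma evar_law w : tau (wev evar w) = mtr (wev mvar w).
Proof.
have hE : mval (wev evar w) = ext_emb E (mval (wev mvar w)).
  elim: w => [|x w IH].
    by rewrite !wev_nil [RHS](emb_unit (ext_embP E)).
  rewrite !wev_cons !mvalM IH (emb_mul (ext_embP E)) //; exact: mval_vna.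
by rewrite /mtr hE (emb_trace (ext_embP E)) //; exact: mval_vna.
Qed.

Lemma epert_law r w : tau (wev (epert r) w) = law tau evar esc r%:C w.
Proof. by []. Qed.

Definition escore (r : R) i : malg E := (r^-1)%:C *: esc i.

Lemma escore_score r i : r != 0 -> is_score (epert r) i (escore r i).
Proof.
move=> r0 w; rewrite /escore -scalerAl.
rewrite mtrZ [X in _ * X](score ext_schwinger_dyson i r%:C w).
by rewrite mulrA -rmorphM /= mulVf // rmorph1 mul1r.
Qed.

Lemma tau_sc_sc i j : tau (esc i * esc j) = (i == j)%:R.
Proof.
have := ext_schwinger_dyson i [:: inl j]; rewrite /= !wev_cons wev_nil !mulr1.
rewrite -[LHS]/(mtr _) => ->; rewrite eq_sym -[GRing.Linear.sort _ 1]/(mtr 1) mtr1.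
by case: eqP; rewrite ?mulr1 addr0.
Qed.

Lemma tau_sc_Y i w : tau (esc i * wev evar w) = 0.
Proof.
have := ext_schwinger_dyson i [seq inr x | x <- w].
rewrite dword_nohit; last by elim: w.
by rewrite /wev big_map => ->.
Qed.

Lemma norm2_esc i : norm2 (mval (esc i)) = 1.
Proof.
rewrite norm2E /tform (adj_selfadjoint (@esc_sa i)) -[X in complex.Re X]/(mtr (esc i * esc i)).
by rewrite tau_sc_sc eqxx /= sqrtr1.
Qed.

Lemma norm2_epert r i :
  norm2 (mval (epert r i)) ^+ 2 = complex.Re (trace M (Y i \o Y i)) + r ^+ 2.
Proof.
rewrite norm2_sqr; last exact: mval_vna.
rewrite /tform (adj_selfadjoint (@epert_sa r i)).
have ys : tau (esc i * evar i) = 0.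
  by have := tau_sc_Y i [:: i]; rewrite wev_cons wev_nil mulr1.
have -> : trace E (mval (epert r i) \o mval (epert r i)) =
   r%:C * (r%:C * tau (esc i * esc i) + tau (esc i * evar i)) +
   (r%:C * tau (evar i * esc i) + tau (evar i * evar i)).
  transitivity (tau (epert r i * epert r i)) => //.
  have eE : epert r i = r%:C *: esc i + evar i by rewrite /epert /pert addrC.
  rewrite eE mulrDl -scalerAl !mulrDr -!scalerAr.
  by rewrite !(mtrD, mtrZ) mulrDr.
rewrite [tau (evar i * esc i)]mtrC ys tau_sc_sc eqxx !mulr0 addr0 add0r mulr1.
have -> : tau (evar i * evar i) = trace M (Y i \o Y i).
  by have := evar_law [:: i; i]; rewrite !wev_cons !wev_nil !mulr1.
by rewrite ReD addrC -rmorphM /= expr2.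
Qed.

Lemma norm2_var_ge0 i : 0 <= complex.Re (trace M (Y i \o Y i)).
Proof.
have := norm2_epert 0 i; rewrite expr0n addr0 => <-.
exact: sqr_ge0.
Qed.

Section FisherBounds.
Variable r : R.
Hypothesis r_gt0 : 0 < r.

Let r_neq0 : r != 0. Proof. by rewrite gt_eqF. Qed.

Lemma perturb_fisher : exists2 l : 'I_N -> R,
  forall i, least_bound (epert r) (escore r i) (l i) &
  fisher (perturb E r) = (\sum_i l i ^+ 2)%:E.
Proof.
exact: (@fisher_least_bounds _ _ _ (epert r) (epert_sa r) (escore r)
  (fun i => escore_score i r_neq0)).
Qed.

Lemma escore_bound_le i l : least_bound (epert r) (escore r i) l -> l <= r^-1.
Proof.
move=> [_ _ lmin]; apply: lmin => p.
rewrite (le_trans (trace_CS (mval_vna _) (mval_vna _))) //.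
rewrite /escore mvalZ norm2Z; last exact: mval_vna.
by rewrite norm2_esc mulr1 normc_real ger0_norm // invr_ge0 ltW.
Qed.

(* The Cramer-Rao bound: test the score against the variable itself. *)
Lemma escore_bound_ge i l : least_bound (epert r) (escore r i) l ->
  (complex.Re (trace M (Y i \o Y i)) + r ^+ 2)^-1 <= l ^+ 2.
Proof.
move=> [l0 lb _]; have := lb [:: (1, [:: i])].
rewrite fev_cons fev_nil wev_cons wev_nil scale1r addr0 mulr1.
have -> : tau (escore r i * epert r i) = 1.
  have := @escore_score r i r_neq0 [:: i]; rewrite wev_cons wev_nil mulr1 => ->.
  by rewrite /= eqxx wev_nil addr0 mtr1 mulr1.
rewrite Normc.normc1 => h; have n2 := norm2_epert r i.
have v0 := norm2_var_ge0 i.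
have d0 : 0 < complex.Re (trace M (Y i \o Y i)) + r ^+ 2.
  by rewrite ltr_wpDl // exprn_gt0.
rewrite -(ler_pM2r d0) mulVf ?gt_eqF // -n2 -exprMn.
by rewrite exprn_ege1.
Qed.

End FisherBounds.
End Perturbation.

Section LawIdentities.
Variable R : realType.

(* Y + e S + r1 S' has the law of Y + r2 S when r2^2 = e^2 + r1^2. *)
Lemma fisher_semigroup (M : tracial_vna R) (N : nat) (Y : 'I_N -> op M)
    (Y_in : forall i, vna M (Y i)) (Y_sa : forall i, selfadjoint (Y i))
    (E : semicircular_ext Y) (e r1 r2 : R) (F : semicircular_ext (perturb E e)) :
  0 < r1 -> 0 < r2 -> r2 ^+ 2 = e ^+ 2 + r1 ^+ 2 ->
  fisher (perturb F r1) = fisher (perturb E r2).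
Proof.
move=> r10 r20 hr.
have P_in := perturb_vna Y_in E e.
have P_sa := @perturb_sa _ _ _ _ Y_in Y_sa E e.
apply: (@fisher_law _ _ _ _ (epert P_in F r1) (epert Y_in E r2) _ _ _
  (escore F r1) (escore E r2)).
- exact: epert_sa.
- exact: epert_sa.
- move=> w; rewrite !epert_law.
  apply: (law_shift (e := e%:C)) w.
  + exact: ext_schwinger_dyson.
  + exact: ext_schwinger_dyson.
  + exact: mtrC.
  + exact: mtrC.
  + move=> w; rewrite /law pert0 [LHS]evar_law.
    by congr (mtr (wev _ w)); apply/funext => i; apply: malg_inj.
  + by rewrite -!rmorphXn -rmorphD hr.
- by move=> i; apply: escore_score; rewrite gt_eqF.
- by move=> i; apply: escore_score; rewrite gt_eqF.
Qed.

End LawIdentities.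

Lemma schwinger_dyson_sub (C : numClosedFieldType) (A : algType C)
    (tau : {scalar A}) (T T' : eqType) (f : T' -> T) (Y S : T -> A) :
  injective f -> schwinger_dyson tau Y S -> schwinger_dyson tau (Y \o f) (S \o f).
Proof.
move=> f_inj SD i w; pose g (x : T' + T') : T + T :=
  match x with inl j => inl (f j) | inr j => inr (f j) end.
have gE : mixed (Y \o f) (S \o f) =1 mixed Y S \o g by case.
have hE x : mixed_hit i x = mixed_hit (f i) (g x).
  by case: x => //= j; rewrite (inj_eq f_inj).
have wE v : wev (mixed (Y \o f) (S \o f)) v = wev (mixed Y S) (map g v).
  by rewrite /wev big_map; apply: eq_bigr => x _; rewrite gE.
rewrite wE [LHS](SD (f i)).
suff key u v : dword tau (mixed Y S) (mixed_hit (f i)) (map g w) u v =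
    dword tau (mixed (Y \o f) (S \o f)) (mixed_hit i) w u v by exact: key.
elim: w u => [//|x w IH] u /=.
by rewrite IH hE wE gE.
Qed.

(** * Adjoining a polynomial in the generators *)

Section PerturbedWords.
Variables (R : realType) (M : tracial_vna R) (T : eqType) (Y S : T -> malg M).
Local Notation nn a := (norm2 (mval a)).

Let nnD (a b : malg M) : nn (a + b) <= nn a + nn b.
Proof. exact: norm2D (mval_vna a) (mval_vna b). Qed.

Let nnZ (e : R) (a : malg M) : 0 <= e -> nn (e%:C *: a) = e * nn a.
Proof. by move=> e0; rewrite mvalZ norm2Z ?normc_real ?ger0_norm //; exact: mval_vna. Qed.

Let nn0 : nn (0 : malg M) = 0.
Proof. by have := nnZ (0 : malg M) (lexx 0); rewrite scaler0 mul0r. Qed.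

(** The left factor u carries the letters already treated, so the induction stays within the 2-norm
    and uses no operator norm. *)
Lemma pert_word_lipschitz w (u : malg M) : exists2 c : R, 0 <= c &
  forall e, 0 <= e -> e <= 1 ->
    nn (u * (wev (pert Y S e%:C) w - wev Y w)) <= c * e.
Proof.
elim: w u => [|x w IH] u.
  exists 0 => // e _ _; by rewrite !wev_nil subrr mulr0 mul0r nn0.
have [c1 c10 h1] := IH (u * Y x); have [c2 c20 h2] := IH (u * S x).
(* c1 bounds the error after a letter Y x. The letter S x comes with a factor e, so its error c2 e
   is used with e <= 1 and its leading term gives the last summand. *)
exists (c1 + c2 + nn (u * S x * wev Y w)).
  by rewrite !addr_ge0 // norm2_ge0.
move=> e e0 e1; rewrite !wev_cons; set V := wev (pert _ _ _) w.
have -> : u * (pert Y S e%:C x * V - Y x * wev Y w) =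
    u * Y x * (V - wev Y w) +
    e%:C *: (u * S x * (V - wev Y w) + u * S x * wev Y w).
  rewrite -mulrDr subrK /pert mulrDl -scalerAl !mulrBr !mulrDr -!scalerAr !mulrA.
  by rewrite addrAC.
rewrite (le_trans (nnD _ _)) // nnZ // -addrA mulrDl lerD ?h1 //.
rewrite mulrC ler_wpM2r // (le_trans (nnD _ _)) // lerD2r.
rewrite (le_trans (h2 e e0 e1)) //; exact: ler_piMr.
Qed.

Lemma pert_combo_lipschitz (q : seq (R[i] * seq T)) : exists2 c : R, 0 <= c &
  forall e, 0 <= e -> e <= 1 ->
    nn (fev (pert Y S e%:C) q - fev Y q) <= c * e.
Proof.
elim: q => [|[a w] q [c c0 hc]].
  exists 0 => // e _ _; by rewrite !fev_nil subrr mul0r nn0.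
have [d d0 hd] := pert_word_lipschitz w (a *: 1).
exists (d + c); first exact: addr_ge0.
move=> e e0 e1; rewrite !fev_cons opprD addrACA -scalerBr.
rewrite (le_trans (nnD _ _)) // mulrDl lerD ?hc //.
by have := hd e e0 e1; rewrite -scalerAl mul1r.
Qed.

End PerturbedWords.

Section Adjoin.
Variables (R : realType) (M : tracial_vna R) (n : nat) (X : 'I_n -> op M) (y : op M).
Hypothesis X_in : forall i, vna M (X i).
Hypothesis X_sa : forall i, selfadjoint (X i).
Hypothesis y_sa : selfadjoint y.
Hypothesis y_alg : alg_gen (range X) y.

Lemma adjoin_lift j : adjoin X y (lift ord_max j) = X j.
Proof. by rewrite /adjoin liftK. Qed.

Lemma adjoin_max : adjoin X y ord_max = y.
Proof. by rewrite /adjoin unlift_none. Qed.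

Lemma y_in : vna M y.
Proof.
move: y_alg; apply: alg_gen_sub; first exact: M_alg.
by move=> _ [i _ <-].
Qed.

Lemma adjoin_in i : vna M (adjoin X y i).
Proof. by rewrite /adjoin; case: unliftP => [j _|_] //; exact: y_in. Qed.

Lemma adjoin_sa i : selfadjoint (adjoin X y i).
Proof. by rewrite /adjoin; case: unliftP. Qed.

Variables (E : semicircular_ext (adjoin X y)) (E0 : semicircular_ext X).
Local Notation f := (lift (@ord_max n)).
Local Notation evarE := (evar adjoin_in E).
Local Notation tau := (@mtr R E).

(** Inside [E] and inside [E0] the moments agree at r = 0 with those of X, and both families obey
    the Schwinger-Dyson equations; this is the law comparison with e = 0. *)
Lemma sub_law (r : R) w :
  mtr (wev (epert X_in E0 r) w) = tau (wev (epert adjoin_in E r \o f) w).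
Proof.
have E0_SD := ext_schwinger_dyson X_in E0.
have E_SD := schwinger_dyson_sub (@lift_inj _ ord_max) (ext_schwinger_dyson adjoin_in E).
apply: (law_shift (e := 0) E0_SD E_SD (@mtrC _ _) (@mtrC _ _)); last first.
  by rewrite expr0n add0r.
move=> v; rewrite /law !pert0.
rewrite [LHS]evar_law.
have -> : wev (evarE \o f) v = wev evarE (map f v) by rewrite /wev big_map.
rewrite [RHS]evar_law /wev big_map; congr mtr; apply: eq_bigr => j _.
by apply: malg_inj; rewrite /= adjoin_lift.
Qed.

Lemma evar_max_combo : exists q, evarE ord_max = fev (evarE \o f) q.
Proof.
have [q yq] : exists q, y = mval (fev (mvar X_in) q).
  move: y_alg; have -> : range X = [set mval (mvar X_in x) | x in [set x | xpredT x]].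
    by apply/seteqP; split => _ [i _ <-]; exists i.
  by move=> /alg_gen_combo[q _ ->]; exists q.
exists q; apply: malg_inj.
transitivity (ext_emb E (mval (fev (mvar X_in) q))).
  by rewrite -yq /= adjoin_max.
have eP := ext_embP E.
have wE w : ext_emb E (mval (wev (mvar X_in) w)) = mval (wev (evarE \o f) w).
  elim: w => [|x w IH]; first by rewrite !wev_nil [LHS](emb_unit eP).
  rewrite !wev_cons !mvalM (emb_mul eP); try exact: mval_vna.
  by rewrite IH /= adjoin_lift.
have e0 : ext_emb E 0 = 0.
  rewrite -(addNr (idfun : op M)) -scaleN1r (emb_linear eP); try exact: M_id.
  by rewrite scaleN1r addNr.
elim: q {yq} => [|[c w] q IH]; first by rewrite !fev_nil [LHS]e0.
rewrite !fev_cons !mvalD !mvalZ (emb_linear eP); try exact: mval_vna.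
by rewrite IH wE.
Qed.

(* The test vector (y + e s) - f(X + e S) has norm O(e), but pairs to 1 with
   the last score. *)
Lemma last_bound : exists2 c : R, 0 < c & forall r l, 0 < r -> r <= 1 ->
  least_bound (epert adjoin_in E r) (escore E r ord_max) l -> c <= (r * l) ^+ 2.
Proof.
have [q qE] := evar_max_combo.
have [c c0 hc] := pert_combo_lipschitz (evarE \o f) (esc E \o f) q.
have c10 : 0 < c + 1 by rewrite ltr_wpDl.
(* The test vector is r s minus the increment of f, of norm at most r + c r. Pairing to 1 then gives
   1 <= (c + 1) r l. *)
exists ((c + 1)^-1 ^+ 2); first by rewrite exprn_gt0 // invr_gt0.
move=> r l r0 r1 [l0 lb _].
pose p : seq (R[i] * seq 'I_n.+1) :=
  (1, [:: ord_max]) :: [seq (- cw.1, map f cw.2) | cw <- q].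
have fE : fev (epert adjoin_in E r) p =
    epert adjoin_in E r ord_max - fev (pert (evarE \o f) (esc E \o f) r%:C) q.
  rewrite /p fev_cons wev_cons wev_nil mulr1 scale1r; congr (_ + _).
  rewrite /fev big_map -sumrN; apply: eq_bigr => cw _ /=.
  by rewrite scaleNr /wev big_map.
have := lb p.
(* Only the leading letter is hit: the words of f use the other variables. *)
have -> : tau (escore E r ord_max * fev (epert adjoin_in E r) p) = 1.
  rewrite (@tau_score_fev _ _ _ _ ord_max); last by apply: escore_score; rewrite gt_eqF.
  rewrite big_cons big_map big1 /= => [|cw _].
    by rewrite eqxx wev_nil !addr0 mtr1 !mulr1.
  rewrite ell_nohit ?mulr0 // all_map; apply/allP => j _ /=.
  by rewrite eq_sym neq_lift.
rewrite Normc.normc1 fE => h.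
have hn : norm2 (mval (epert adjoin_in E r ord_max -
    fev (pert (evarE \o f) (esc E \o f) r%:C) q)) <= (c + 1) * r.
  have -> : epert adjoin_in E r ord_max - fev (pert (evarE \o f) (esc E \o f) r%:C) q =
     r%:C *: esc E ord_max + (-1) *: (fev (pert (evarE \o f) (esc E \o f) r%:C) q - fev (evarE \o f) q).
    rewrite scaleN1r opprB /epert /pert qE addrA [in RHS]addrC.
    by rewrite [RHS]addrC; congr (_ - _); exact: addrC.
  rewrite (le_trans (norm2D (mval_vna _) (mval_vna _))) //.
  rewrite !mvalZ !norm2Z; try exact: mval_vna.
  rewrite (norm2_esc adjoin_in) mulr1 normc_real ger0_norm ?(ltW r0) // normcNE Normc.normc1 mul1r.
  by rewrite mulrDl mul1r [leRHS]addrC lerD2l hc // (ltW r0).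
have h1 : 1 <= (c + 1) * (r * l).
  by rewrite (le_trans h) // [leRHS]mulrA [leRHS]mulrC ler_wpM2l.
rewrite ler_pXn2r ?nnegrE ?invr_ge0 ?mulr_ge0 ?(ltW c10) ?(ltW r0) //.
by rewrite -[leLHS]mulr1 ler_pdivrMl.
Qed.

Lemma fisher_adjoin : exists2 c : R, 0 < c & forall r : R, 0 < r -> r <= 1 ->
  ((r ^+ 2)%:E * fisher (perturb E0 r) + c%:E <= (r ^+ 2)%:E * fisher (perturb E r))%E.
Proof.
have [c c0 hc] := last_bound; exists c => // r r0 r1.
have rn0 : r != 0 by rewrite gt_eqF.
have [l hl ->] := perturb_fisher adjoin_in adjoin_sa E r0.
have [l' hl' ->] := perturb_fisher X_in X_sa E0 r0.
rewrite -!EFinM -EFinD lee_fin big_ord_recr /= mulrDr -exprMn.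
have hm := hc r (l ord_max) r0 r1 (hl ord_max).
rewrite lerD //.
rewrite ler_wpM2l ?sqr_ge0 //; apply: ler_sum => j _.
have -> : widen_ord (leqnSn n) j = f j by apply: val_inj; rewrite /= /bump leqNgt ltn_ord.
(* The same multiple of s_j is a score for the subtuple inside [E], whose least bound is that of X +
   r S inside [E0] because the moments agree. *)
have sub_score : is_score (epert adjoin_in E r \o f) j (escore E r (f j)).
  move=> w; rewrite /escore -scalerAl mtrZ.
  have E_SD := schwinger_dyson_sub (@lift_inj _ ord_max) (ext_schwinger_dyson adjoin_in E).
  rewrite [X in _ * X](score E_SD j r%:C w).
  by rewrite mulrA -rmorphM /= mulVf // rmorph1 mul1r.
have [l0 _ _] := hl (f j); have [l'0 _ _] := hl' j.
rewrite ler_pXn2r ?nnegrE //.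
apply: (least_bound_sub (hl (f j))).
have sub_sa i : selfadjoint (mval ((epert adjoin_in E r \o f) i)).
  exact: (@epert_sa _ _ _ _ adjoin_in adjoin_sa E r (f i)).
have h := least_bound_law (@epert_sa _ _ _ _ X_in X_sa E0 r) sub_sa (sub_law r)
  (escore_score X_in E0 j rn0) sub_score (hl' j).
exact: h.
Qed.

End Adjoin.

(* No measurability is needed for monotonicity: both parts are suprema of
   integrals of simple functions. *)
Lemma le_integral_any d (T : measurableType d) (R : realType)
    (m : {measure set T -> \bar R}) (D : set T) (f g : T -> \bar R) :
  (forall x, D x -> (f x <= g x)%E) ->
  (\int[m]_(x in D) f x <= \int[m]_(x in D) g x)%E.
Proof.
move=> fg.
have mono (h k : T -> \bar R) : (forall x, 0 <= h x)%E -> (forall x, 0 <= k x)%E ->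
    (forall x, D x -> (h x <= k x)%E) ->
    (\int[m]_(x in D) h x <= \int[m]_(x in D) k x)%E.
  move=> h0 k0 hk; rewrite !ge0_integralE //; apply: le_ereal_sup.
  move=> _ [s sh <-]; exists s => // x; apply: le_trans (sh x) _.
  by rewrite /patch; case: ifPn => //; rewrite inE => /hk.
rewrite integralE [leRHS]integralE; apply: leeB; apply: mono => //.
- by move=> x Dx; rewrite !funeposE ge_max !le_max fg //= lexx orbT.
- by move=> x Dx; rewrite !funenegE ge_max !le_max leeN2 fg //= lexx orbT.
Qed.

Lemma ge0_integrable_value d (T : measurableType d) (R : realType)
    (m : {measure set T -> \bar R}) (D : set T) (g : T -> R) (r : R) :
  measurable D -> (forall x, D x -> 0 <= g x) -> measurable_fun D g ->
  (\int[m]_(x in D) (g x)%:E = r%:E)%E -> m.-integrable D (EFin \o g).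
Proof.
move=> mD g0 mg gr; apply/integrableP; split; first exact/measurable_EFinP.
under eq_integral => x xD.
  rewrite gee0_abs; last by rewrite lee_fin g0 //; rewrite inE in xD.
  over.
by rewrite gr ltry.
Qed.

(** * Entropy bounds *)

Section IntegralBound.
Variable R : realType.
Local Notation mu := (@lebesgue_measure R).

Let cont_add (a : R) : continuous (fun t : R => a + t).
Proof. by move=> t; apply: cvgD; [exact: cvg_cst | exact: cvg_id]. Qed.

Let dadd (a x : R) : is_derive x 1 (fun t : R => a + t) 1.
Proof.
have := is_deriveD (is_derive_cst (a : R^o) x 1) (is_derive_id x 1).
by rewrite add0r.
Qed.

Lemma integral_inv_add (a u : R) : 0 < a -> 0 < u ->
  (\int[mu]_(t in `[0%R, u]) ((a + t)^-1)%:E = (ln (a + u) - ln a)%:E)%E.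
Proof.
move=> a0 u0.
rewrite (@continuous_FTC2 _ (fun t => (a + t)^-1) (fun t => ln (a + t)) 0 u) //.
- by rewrite addr0 EFinB.
- apply: continuous_in_subspaceT => t; rewrite inE /= in_itv /= => /andP[t0 _].
  apply: cvgV; last exact: cont_add.
  by rewrite gt_eqF // ltr_pwDl.
- have cln t : 0 <= t -> {for t, continuous (fun t => ln (a + t))}.
    move=> t0; apply: continuous_comp; first exact: cont_add.
    by apply: continuous_ln; rewrite ltr_pwDl.
  split.
  + move=> x; rewrite in_itv /= => /andP[x0 _].
    have ax : 0 < a + x by rewrite ltr_pwDl // ltW.
    have := @is_derive1_comp R (@ln R) (fun t => a + t) x _ _ (is_derive1_ln ax) (dadd a x).
    by case.
  + by apply: cvg_at_right_filter; apply: cln.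
  + by apply: cvg_at_left_filter; apply: cln; exact: ltW.
- move=> x; rewrite in_itv /= => /andP[x0 _].
  have ax : 0 < a + x by rewrite ltr_pwDl // ltW.
  have [_ h] := @is_derive1_comp R (@ln R) (fun t => a + t) x _ _ (is_derive1_ln ax) (dadd a x).
  by rewrite derive1E [LHS]h mulr1.
Qed.

Lemma integral_inv_sqr : (\int[mu]_(t in `[0%R, +oo[) ((1 + t) ^- 2)%:E = 1)%E.
Proof.
rewrite (@ge0_continuous_FTC2y _ (fun t => (1 + t) ^- 2) (fun t => - (1 + t)^-1) 0 0).
- by rewrite addr0 invr1 sub0e EFinN oppeK.
- by move=> t t0; rewrite invr_ge0 sqr_ge0.
- apply: continuous_in_subspaceT => t; rewrite inE /= in_itv /= andbT => t0.
  apply: cvgV; first by rewrite expf_neq0 // gt_eqF // ltr_pwDl.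
  under eq_fun do rewrite expr2; rewrite expr2.
  by apply: cvgM; exact: cont_add.
- rewrite -oppr0; apply: cvgN; apply/gtr0_cvgV0; last exact: cvg_addrl.
  by exists 0; split => // t t0; rewrite addr_gt0.
- move=> x x0; have x1 : 1 + x != 0 by rewrite gt_eqF // addr_gt0.
  by have [] := is_deriveN (is_deriveV x1 (dadd 1 x)).
- apply: cvg_at_right_filter; apply: cvgN; apply: cvgV; last exact: cont_add.
  by rewrite addr0 oner_neq0.
- move=> x; rewrite in_itv /= andbT => x0.
  have x1 : 1 + x != 0 by rewrite gt_eqF // addr_gt0.
  have [_ h] := is_deriveN (is_deriveV x1 (dadd 1 x)).
  by rewrite derive1E [LHS]h scaleNr opprK; exact: mulr1.
Qed.

Let measurable_inv_add (a : R) (D : set R) : measurable D ->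
  (forall t, D t -> 0 < a + t) -> measurable_fun D (fun t => (a + t)^-1).
Proof.
move=> mD h; apply: subspace_continuous_measurable_fun => //.
apply: continuous_in_subspaceT => t; rewrite inE => /h at0.
by apply: cvgV; [rewrite gt_eqF | exact: cont_add].
Qed.

(** The majorant is K (1 + t)^-2, whose integral is K, minus lam / (a + t) cut off at u, whose
    integral is logarithmic in a. This logarithm drives both entropy statements. *)
Lemma integral_upper_bound (f : R -> \bar R) (K lam a u : R) :
  0 <= K -> 0 <= lam -> 0 < a -> 0 < u ->
  (forall t, 0 < t -> (f t <= (K * (1 + t) ^- 2)%:E)%E) ->
  (forall t, 0 < t -> t < u -> (f t <= (K * (1 + t) ^- 2 - lam * (a + t)^-1)%:E)%E) ->
  (\int[mu]_(t in `]0%R, +oo[) f t <= (K - lam * (ln (a + u) - ln a))%:E)%E.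
Proof.
move=> K0 lam0 a0 u0 fK flam.
pose D : set R := `]0, +oo[%classic; pose U : set R := `]0, u[%classic.
pose g1 t := K * (1 + t) ^- 2.
pose g2 := (fun t => lam * (a + t)^-1) \_ U.
have mD : measurable D by exact: measurable_itv.
have mU : measurable U by exact: measurable_itv.
have D0 t : D t -> 0 < t by rewrite /D /= in_itv /= andbT.
have DU : D `&` U = U.
  by apply/setIidPr => t; rewrite /D /U /= !in_itv /= andbT => /andP[].
have U0 t : U t -> 0 < t by rewrite /U /= in_itv /= => /andP[].
have mh1 : measurable_fun D (fun t => (1 + t) ^- 2).
  under eq_fun do rewrite -exprVn.
  by apply: measurable_funX; apply: measurable_inv_add => // t /D0 t0; rewrite addr_gt0.
have mh2 : measurable_fun U (fun t => (a + t)^-1).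
  by apply: measurable_inv_add => // t /U0 t0; rewrite addr_gt0.
have mg1 : measurable_fun D g1 by apply: measurable_funM.
have mg2 : measurable_fun D g2.
  by apply/measurable_restrict => //; rewrite DU; apply: measurable_funM.
have i1 : (\int[mu]_(t in D) (g1 t)%:E = K%:E)%E.
  rewrite /g1; under eq_integral do rewrite EFinM.
  rewrite (@ge0_integralZl_EFin _ _ _ mu D mD (fun t => ((1 + t) ^- 2)%:E) _ _ K K0).
  - by rewrite integral_itv_obnd_cbnd ?integral_inv_sqr ?mule1 //; exact/measurable_EFinP.
  - by move=> t _; rewrite lee_fin invr_ge0 sqr_ge0.
  - exact/measurable_EFinP.
have i2 : (\int[mu]_(t in D) (g2 t)%:E = (lam * (ln (a + u) - ln a))%:E)%E.
  transitivity (\int[mu]_(t in D) (((fun t => (lam * (a + t)^-1)%:E) \_ U) t))%E.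
    by apply: eq_integral => t _; rewrite /g2 /patch; case: ifP.
  rewrite -integral_mkcondr DU; under eq_integral do rewrite EFinM.
  rewrite (@ge0_integralZl_EFin _ _ _ mu U mU (fun t => ((a + t)^-1)%:E) _ _ lam lam0).
  - rewrite EFinM -integral_inv_add // -integral_itv_obnd_cbnd.
      rewrite -integral_itv_bndo_bndc //.
      exact/measurable_EFinP.
    apply/measurable_EFinP; apply: measurable_inv_add => // t.
    by rewrite /= in_itv /= => /andP[t0 _]; rewrite addr_gt0.
  - by move=> t /U0 t0; rewrite lee_fin invr_ge0 addr_ge0 // ltW.
  - exact/measurable_EFinP.
apply: (@le_trans _ _ (\int[mu]_(t in D) ((g1 t)%:E - (g2 t)%:E))%E).
  apply: le_integral_any => t /D0 t0; rewrite -EFinB /g2 /patch.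
  case: ifPn => [|_]; last by rewrite subr0; exact: fK.
  by rewrite inE /U /= in_itv /= => /andP[_ tu]; exact: flam.
have I1 : mu.-integrable D (EFin \o g1).
  refine (@ge0_integrable_value _ _ _ mu D g1 K mD _ mg1 i1) => t _.
  by rewrite mulr_ge0 // invr_ge0 sqr_ge0.
have I2 : mu.-integrable D (EFin \o g2).
  refine (@ge0_integrable_value _ _ _ mu D g2 _ mD _ mg2 i2) => t /D0 t0.
  by rewrite /g2 /patch; case: ifP => // _; rewrite mulr_ge0 // invr_ge0 addr_ge0 // ltW.
by rewrite (integralB_EFin _ I1 I2) ?i1 ?i2 ?EFinB.
Qed.

End IntegralBound.

(** * Limits inferior and superior at 0 from the right *)

Section RightLimits.
Variable R : realType.
Implicit Types (f g : R -> \bar R) (c : R).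

Lemma right0P (V : set R) : ((0 : R)^'+ V) <->
  exists2 d : R, 0 < d & forall r, 0 < r -> r < d -> V r.
Proof.
split=> [|[d d0 dV]].
  move=> /nbhs_ballP[d /= d0 dV]; exists d => // r r0 rd; apply: dV => //=.
  by rewrite /ball /= sub0r normrN gtr0_norm.
apply/nbhs_ballP; exists d => //= r; rewrite /ball /= sub0r normrN => rd r0.
by apply: dV => //; rewrite -(gtr0_norm r0).
Qed.

Lemma limf_einf_ge f c d : 0 < d -> (forall r, 0 < r -> r < d -> (c%:E <= f r)%E) ->
  (c%:E <= limf_einf f (0 : R)^'+)%E.
Proof.
move=> d0 h; rewrite limf_einfE; pose V := [set r : R | 0 < r < d].
apply: (@le_trans _ _ (ereal_inf (f @` V))).
  by apply: le_ereal_inf_tmp => _ [r /andP[r0 rd] <-]; exact: h.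
apply: ereal_sup_ubound; exists V => //.
by apply/right0P; exists d => // r r0 rd; rewrite /V /= r0 rd.
Qed.

Lemma limf_einf_le f c d : 0 < d -> (forall r, 0 < r -> r < d -> (f r <= c%:E)%E) ->
  (limf_einf f (0 : R)^'+ <= c%:E)%E.
Proof.
move=> d0 h; rewrite limf_einfE; apply: ge_ereal_sup => _ [V /right0P[d' d'0 hV] <-].
have m0 : 0 < Num.min d d' by rewrite lt_min d0.
have [r0 rm] := midf_lt m0.
move: rm; rewrite add0r lt_min => /andP[rd rd']; rewrite add0r in r0.
apply: (@le_trans _ _ (f (Num.min d d' / 2))); last exact: h.
by apply: ereal_inf_lbound; exists (Num.min d d' / 2) => //; exact: hV.
Qed.

Lemma limf_einf_add f g c d : 0 < d ->
  (forall r, 0 < r -> r < d -> (f r + c%:E <= g r)%E) ->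
  (limf_einf f (0 : R)^'+ + c%:E <= limf_einf g (0 : R)^'+)%E.
Proof.
move=> d0 h; rewrite -leeBrDr // limf_einfE.
apply: ge_ereal_sup => _ [V /right0P[d' d'0 hV] <-]; rewrite leeBrDr //.
pose W := [set r : R | 0 < r < Num.min d d'].
apply: (@le_trans _ _ (ereal_inf (g @` W))).
  apply: le_ereal_inf_tmp => _ [r /andP[r0 rm] <-].
  move: rm; rewrite lt_min => /andP[rd rd'].
  apply: le_trans (h r r0 rd); rewrite leeD2r //.
  by apply: ereal_inf_lbound; exists r => //; exact: hV.
rewrite limf_einfE; apply: ereal_sup_ubound; exists W => //.
apply/right0P; exists (Num.min d d'); first by rewrite lt_min d0.
by move=> r r0 rm; rewrite /W /= r0 rm.
Qed.

Lemma lt_limf_einf f c : (c%:E < limf_einf f (0 : R)^'+)%E ->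
  exists2 d : R, 0 < d & forall r, 0 < r -> r < d -> (c%:E <= f r)%E.
Proof.
rewrite limf_einfE => /ereal_sup_gt[_ [V /right0P[d d0 hV] <-] cV].
exists d => // r r0 rd; apply: le_trans (ltW cV) _.
by apply: ereal_inf_lbound; exists r => //; exact: hV.
Qed.

Lemma limf_esup_le f c d : 0 < d -> (forall r, 0 < r -> r < d -> (f r <= c%:E)%E) ->
  (limf_esup f (0 : R)^'+ <= c%:E)%E.
Proof.
move=> d0 h; rewrite limf_esupE; pose V := [set r : R | 0 < r < d].
apply: (@le_trans _ _ (ereal_sup (f @` V))); last first.
  by apply: ge_ereal_sup => _ [r /andP[r0 rd] <-]; exact: h.
apply: ereal_inf_lbound; exists V => //.
by apply/right0P; exists d => // r r0 rd; rewrite /V /= r0 rd.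
Qed.

End RightLimits.

(** * Upper bounds for the entropy *)

Section EntropyBound.
Variables (R : realType) (M : tracial_vna R) (N : nat) (Y : 'I_N -> op M).
Hypothesis Y_in : forall i, vna M (Y i).
Hypothesis Y_sa : forall i, selfadjoint (Y i).
Variable E : semicircular_ext Y.

Lemma fisher_ge0 (r : R) : 0 < r -> (0 <= (r ^+ 2)%:E * fisher (perturb E r))%E.
Proof.
move=> r0; have [l _ ->] := perturb_fisher Y_in Y_sa E r0.
by rewrite -EFinM lee_fin mulr_ge0 ?sqr_ge0 // sumr_ge0 // => i _; rewrite sqr_ge0.
Qed.

Lemma fisher_le (r : R) : 0 < r ->
  ((r ^+ 2)%:E * fisher (perturb E r) <= N%:R%:E)%E.
Proof.
move=> r0; have [l hl ->] := perturb_fisher Y_in Y_sa E r0.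
rewrite -EFinM lee_fin mulr_sumr -[N in leRHS]card_ord -sumr_const ler_sum // => i _.
have [l0 _ _] := hl i; have rl0 : 0 <= r * l i by rewrite mulr_ge0 // ltW.
rewrite -exprMn expr_le1 // -ler_pdivlMl // mulr1.
exact: (escore_bound_le r0 (hl i)).
Qed.

(** One constant, the sum of the second moments, serves all coordinates. It makes N / (1 + t) minus
    the Fisher information at most of order t^-2 at infinity. *)
Lemma fisher_lower_bound : exists2 C : R, 0 <= C & forall r : R, 0 < r ->
  ((N%:R / (C + r ^+ 2))%:E <= fisher (perturb E r))%E.
Proof.
pose v i := complex.Re (trace M (Y i \o Y i)).
have v0 i : 0 <= v i by exact: (norm2_var_ge0 Y_in Y_sa E).
exists (\sum_i v i); first by apply: sumr_ge0.
move=> r r0; have [l hl ->] := perturb_fisher Y_in Y_sa E r0.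
have NE : N%:R = \sum_(i < N) 1 :> R by rewrite sumr_const card_ord.
rewrite lee_fin NE mulr_suml.
apply: ler_sum => i _; rewrite mul1r.
apply: le_trans (escore_bound_ge Y_sa r0 (hl i)).
have r2 : 0 < r ^+ 2 by rewrite exprn_gt0.
have d1 : 0 < v i + r ^+ 2 by rewrite ltr_wpDl.
have d2 : 0 < \sum_i v i + r ^+ 2 by rewrite ltr_wpDl // sumr_ge0.
by rewrite lef_pV2 ?posrE // lerD2r (bigD1 i) //= lerDl sumr_ge0.
Qed.

Let c0 : R := N%:R / 2 * ln (2 * pi * expR 1).

(** K and u are chosen before G, a and b. The choice b = a = e^2 treats Y + e S; the choice b = 0
    treats Y itself, with a > 0 left free to tend to 0. *)
Lemma entropy_upper_bound (lam d : R) : 0 <= lam -> 0 < d ->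
  (forall r, 0 < r -> r < d -> (lam%:E <= (r ^+ 2)%:E * fisher (perturb E r))%E) ->
  exists K u, 0 < u /\ forall (G : R -> \bar R) (a b : R),
    0 <= b -> b <= a -> 0 < a -> a < u ->
    (forall t, 0 < t -> G t = fisher (perturb E (Num.sqrt (b + t)))) ->
    ((2^-1)%:E * \int[lebesgue_measure]_(t in `]0%R, +oo[)
        ((N%:R / (1 + t))%:E - G t) + c0%:E <=
      (K + lam / 2 * ln a)%:E)%E.
Proof.
move=> lam0 d0 hlam; have [C C0 hC] := fisher_lower_bound.
(* For t < u and b <= a < u, the radius stays below d, as b + t < 2 u <= d^2; also b <= 1, which the
   tail estimate uses. *)
pose u := Num.min 1 (d ^+ 2) / 2.
have m0 : 0 < Num.min 1 (d ^+ 2) by rewrite lt_min ltr01 exprn_gt0.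
have u0 : 0 < u by rewrite divr_gt0.
have u1 : u <= 1 by rewrite /u ler_pdivrMr // ge_min; apply/orP; left; lra.
have ud : u + u <= d ^+ 2 by rewrite -splitr ge_min lexx orbT.
(* N C comes from N / (1 + t) - N / (C + 1 + t) <= N C (1 + t)^-2, and 4 N majorises N (1 + t) for t
   < u <= 1. *)
pose K := N%:R * C + 4 * N%:R.
have K0 : 0 <= K by rewrite addr_ge0 // mulr_ge0.
exists (2^-1 * (K - lam * ln u) + c0), u; split=> // G a b b0 ba a0 au hG.
have N0 : 0 <= N%:R :> R by [].
have key : (\int[lebesgue_measure]_(t in `]0%R, +oo[) ((N%:R / (1 + t))%:E - G t) <=
    (K - lam * (ln (a + u) - ln a))%:E)%E.
  apply: integral_upper_bound => // [t t0|t t0 tu].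
    have bt : 0 < b + t by rewrite ltr_wpDl.
    have st : 0 < Num.sqrt (b + t) by rewrite sqrtr_gt0.
    rewrite hG //; have := hC _ st.
    have [l hl ->] := perturb_fisher Y_in Y_sa E st.
    rewrite -EFinB !lee_fin sqr_sqrtr ?(ltW bt) // => hL.
    have t1 : 0 < 1 + t by rewrite addr_gt0.
    have Ct : 0 < C + (1 + t) by rewrite ltr_wpDl.
    have Cb : 0 < C + (b + t) by rewrite ltr_wpDl.
    apply: (@le_trans _ _ (N%:R / (1 + t) - N%:R / (C + (1 + t)))).
      rewrite lerB // (le_trans _ hL) // ler_wpM2l // lef_pV2 ?posrE //; lra.
    have -> : N%:R / (1 + t) - N%:R / (C + (1 + t)) =
        N%:R * C * ((1 + t)^-1 * (C + (1 + t))^-1).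
      by field; rewrite !gt_eqF.
    apply: (@le_trans _ _ (N%:R * C * (1 + t) ^- 2)).
      rewrite ler_wpM2l ?mulr_ge0 // expr2 invfM ler_wpM2l ?invr_ge0 ?(ltW t1) //.
      by rewrite lef_pV2 ?posrE // lerDr.
    by rewrite ler_wpM2r ?invr_ge0 ?sqr_ge0 // lerDl mulr_ge0.
  have bt : 0 < b + t by rewrite ltr_wpDl.
  have st : 0 < Num.sqrt (b + t) by rewrite sqrtr_gt0.
  have sd : Num.sqrt (b + t) < d.
    rewrite -[d]gtr0_norm // -sqrtr_sqr ltr_sqrt ?exprn_gt0 //; lra.
  have := hlam _ st sd; rewrite hG //.
  have [l hl ->] := perturb_fisher Y_in Y_sa E st.
  rewrite sqr_sqrtr ?(ltW bt) // -EFinM -EFinB !lee_fin => h.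
  have t1 : 0 < 1 + t by rewrite addr_gt0.
  apply: lerB.
    rewrite ler_pdivlMr ?exprn_gt0 // expr2 mulrA divfK ?gt_eqF //.
    have : N%:R * (1 + t) <= 4 * N%:R by rewrite mulrC ler_wpM2r //; lra.
    by rewrite /K => h4; rewrite (le_trans h4) // lerDr mulr_ge0.
  rewrite ler_pdivrMr ?addr_gt0 // (le_trans h) // mulrC ler_wpM2l //; last lra.
  by apply: sumr_ge0 => i _; rewrite sqr_ge0.
have half0 : (0 <= (2^-1)%:E :> \bar R)%E by rewrite lee_fin invr_ge0.
apply: (le_trans (leeD2r _ (lee_wpmul2l half0 key))).
rewrite -EFinM -EFinD lee_fin.
have lnu : ln u <= ln (a + u) by rewrite ler_ln ?posrE ?addr_gt0 // lerDr ltW.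
have : lam * ln u <= lam * ln (a + u) by rewrite ler_wpM2l.
by lra.
Qed.

End EntropyBound.

Theorem lemma3p3 (R : realType) (M : tracial_vna R) (n : nat)
    (X : 'I_n -> op M) (y : op M)
    (X_in : forall i, vna M (X i)) (X_sa : forall i, selfadjoint (X i))
    (y_sa : selfadjoint y) (y_alg : alg_gen (range X) y)
    (E : semicircular_ext (adjoin X y))
    (F : forall e : R, semicircular_ext (perturb E e))
    (E0 : semicircular_ext X) :
  [/\ (delta_star F <= delta1 E)%E,
      (delta1 E < delta1 E0 + 1%:E)%E,
      (delta1 E0 + 1%:E <= n%:R%:E + 1%:E)%E &
      chi_star E = -oo%E].
Proof.
have Y_in := adjoin_in X_in y_alg.
have Y_sa := adjoin_sa X_sa y_sa.
have [c c0 hc] := fisher_adjoin X_in X_sa y_sa y_alg E E0.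
pose LE := limf_einf (fun e : R => (e ^+ 2)%:E * fisher (perturb E e))%E (0 : R)^'+.
pose L0 := limf_einf (fun e : R => (e ^+ 2)%:E * fisher (perturb E0 e))%E (0 : R)^'+.
have L0_ge0 : (0%:E <= L0)%E.
  by apply: (limf_einf_ge (d := 1)) => // r r0 _; exact: (fisher_ge0 X_in X_sa).
have L0_le : (L0 <= n%:R%:E)%E.
  by apply: (limf_einf_le (d := 1)) => // r r0 _; exact: (fisher_le X_in X_sa).
have LE_le : (LE <= n.+1%:R%:E)%E.
  by apply: (limf_einf_le (d := 1)) => // r r0 _; exact: (fisher_le Y_in Y_sa).
have LE_ge : (L0 + c%:E <= LE)%E.
  by apply: (limf_einf_add (d := 1)) => // r r0 r1; exact: hc (ltW r1).
(* Both limits inferior are finite, so the gain c > 0 survives as a strict inequality. *)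
have [l0 l0E] : exists l0 : R, L0 = l0%:E.
  by move: L0_ge0 L0_le; case: (L0) => // r _ _; exists r.
have [l lE] : exists l : R, LE = l%:E.
  move: LE_ge LE_le; rewrite l0E; case: (LE) => // r _ _; exists r => //.
rewrite l0E lee_fin in L0_ge0; rewrite l0E lE -EFinD lee_fin in LE_ge.
have cl : c <= l by rewrite (le_trans _ LE_ge) // lerDr.
have delta1E : delta1 E = (n.+1%:R - l)%:E by rewrite /delta1 -/LE lE EFinB.
have delta1E0 : delta1 E0 = (n%:R - l0)%:E by rewrite /delta1 -/L0 l0E EFinB.
split.
- rewrite delta1E EFinB /delta_star; apply: leeD2l; apply/lee_addgt0Pr => eta eta0.
  (* l - h lies below the limit inferior, hence is a bound near 0, and h <= c <= l keeps it
     nonnegative. Of the allowance eta, one h is lost here and another absorbs K. *)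
  pose h := Num.min (eta / 2) c.
  have h0 : 0 < h by rewrite lt_min divr_gt0.
  have hc' : h <= c by rewrite ge_min lexx orbT.
  have h_eta : h + h <= eta.
    by rewrite [leRHS]splitr lerD // ge_min lexx.
  have lam0 : 0 <= l - h by rewrite subr_ge0 (le_trans hc').
  have [d d0 hd] : exists2 d : R, 0 < d & forall r, 0 < r -> r < d ->
      ((l - h)%:E <= (r ^+ 2)%:E * fisher (perturb E r))%E.
    by apply: lt_limf_einf; rewrite -/LE lE lte_fin ltrBlDr ltrDl.
  have [K [u [u0 hK]]] := entropy_upper_bound Y_in Y_sa lam0 d0 hd.
  (* Once ln e < - m, the constant K is at most h |ln e|. *)
  pose m := `|K| / h + 1.
  have m0 : 0 < m by rewrite ltr_wpDl // divr_ge0 // ltW.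
  have su0 : 0 < Num.sqrt u by rewrite sqrtr_gt0.
  rewrite -EFinN -EFinD.
  apply: (limf_esup_le (d := Num.min (Num.sqrt u) (expR (- m)))).
    by rewrite lt_min su0 expR_gt0.
  move=> e e0; rewrite lt_min => /andP[eu em].
  have e2u : e ^+ 2 < u.
    by rewrite -[u]sqr_sqrtr ?(ltW u0) // ltr_pXn2r // nnegrE ltW.
  have e20 : 0 < e ^+ 2 by rewrite exprn_gt0.
  have lne : ln e < - m by rewrite -[X in _ < X]expRK ltr_ln ?posrE ?expR_gt0.
  have lne0 : 0 < - ln e by rewrite oppr_gt0 (lt_trans lne) // oppr_lt0.
  have chi_le : (chi_star (F e) <= (K + (l - h) / 2 * ln (e ^+ 2))%:E)%E.
    (* Here a = b = e^2: the perturbation by [F e] at time t has the Fisher information of Y + r S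
       with r^2 = e^2 + t. *)
    apply: (hK (fun t => fisher (perturb (F e) (Num.sqrt t))) (e ^+ 2) (e ^+ 2)) => //.
      exact: ltW.
    move=> t t0; apply: fisher_semigroup => //.
    + by rewrite sqrtr_gt0.
    + by rewrite sqrtr_gt0 addr_gt0.
    + by rewrite !sqr_sqrtr // ltW // addr_gt0.
  have abs_ln : `|ln e| = - ln e by rewrite ltr0_norm // -oppr_gt0.
  rewrite abs_ln.
  have inv0 : (0 <= ((- ln e)^-1)%:E :> \bar R)%E by rewrite lee_fin invr_ge0 ltW.
  apply: (le_trans (lee_wpmul2r inv0 chi_le)).
  rewrite -EFinM lee_fin ler_pdivrMr // lnXn // -mulr_natl.
  have Kh : K <= h * - ln e.
    have hm : `|K| <= h * m by rewrite /m mulrDr mulrCA mulfV ?gt_eqF // !mulr1 lerDl ltW.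
    rewrite (le_trans (ler_norm _)) // (le_trans hm) // ler_wpM2l ?(ltW h0) //.
    by rewrite lerNr ltW.
  have : (h + h) * - ln e <= eta * - ln e by rewrite ler_wpM2r // ltW.
  lra.
- rewrite delta1E delta1E0 -EFinD lte_fin -natr1; lra.
- by rewrite delta1E0 -!EFinD lee_fin lerD2r gerBl.
- have lam : forall r : R, 0 < r -> r < 1 ->
      (c%:E <= (r ^+ 2)%:E * fisher (perturb E r))%E.
    move=> r r0 r1; apply: le_trans (hc r r0 (ltW r1)).
    by rewrite -[leLHS]add0e leeD2r // (fisher_ge0 X_in X_sa).
  have [K [u [u0 hK]]] := entropy_upper_bound Y_in Y_sa (ltW c0) ltr01 lam.
  suff chiNy A : (chi_star E <= A%:E)%E.
    case: (chi_star E) chiNy => [r|/(_ 0)|//]; last by rewrite leye_eq.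
    by move=> /(_ (r - 1)); rewrite lee_fin lerBrDr gerDl ler10.
  (* The exponential makes K + (c / 2) ln a at most A, and u / 2 keeps a in the admissible range.
     With b = 0 the left-hand side does not depend on a. *)
  pose a := Num.min (u / 2) (expR ((A - K) * 2 / c)).
  have a0 : 0 < a by rewrite lt_min divr_gt0 // expR_gt0.
  have au : a < u by rewrite gt_min ltr_pdivrMr // ltr_pMr // ltr1n.
  have chi_le : (chi_star E <= (K + c / 2 * ln a)%:E)%E.
    apply: (hK (fun t => fisher (perturb E (Num.sqrt t))) a 0) => //.
      exact: ltW.
    by move=> t t0; rewrite add0r.
  apply: (le_trans chi_le); rewrite lee_fin -lerBrDl.
  have lna : ln a <= (A - K) * 2 / c.
    by rewrite -[leRHS]expRK ler_ln ?posrE ?expR_gt0 // ge_min lexx orbT.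
  apply: (@le_trans _ _ (c / 2 * ((A - K) * 2 / c))).
    by rewrite ler_wpM2l // divr_ge0 // ltW.
  by rewrite le_eqVlt; apply/orP; left; apply/eqP; field; rewrite gt_eqF.
Qed.
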